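(* Let $\Omega\subset\mathbb{R}^N$, $N\ge 2$, be a domain (open and connected) with finite Lebesgue measure, and let $d\ge 1$ be an integer. Let $f:\Omega\times\mathbb{R}^d\times\mathbb{R}^{Nd}\to\mathbb{R}$ be a normal integrand such that - $f(x,z,\cdot)$ is level convex for a.e. $x\in\Omega$ and every $z\in\mathbb{R}^d$; - there exist $\alpha,\gamma>0$ such that $f(x,z,\xi)\ge\alpha|\xi|^\gamma$ for a.e. $x\in\Omega$ and every $(z,\xi)\in\mathbb{R}^d\times\mathbb{R}^{Nd}$. Let $L\ge 1$, and for every $n\in\mathbb{N}$ let $\varphi_n\in\Phi_{\mathrm{w}}(\Omega)$ and $p_n\ge 1$ be such that - $\limsup_{n\to\infty}\varphi_n^+(1)=0$ and $\liminf_{n\to\infty}\varphi_n^-(1)^{1/p_n}\ge1$, where $\varphi_n^+(1):=\operatorname{ess\,sup}_{x\in\Omega}\varphi_n(x,1)$ and $\varphi_n^-(1):=\operatorname{ess\,inf}_{x\in\Omega}\varphi_n(x,1)$; - $\varphi_n$ satisfies $(\mathrm{aInc})_{p_n}$ with constant $L$ for every $n\in\mathbb{N}$. If $p_n\to\infty$ as $n\to\infty$, then $$\limsup_{n\to\infty}E_{\varphi_n}(u)\le E_\infty(u)\le\liminf_{n\to\infty}E_{\varphi_n}(u_n)$$ for all $u,u_n\in L^1(\Omega,\mathbb{R}^d)$ with $u_n\rightharpoonup u$ weakly in $L^1(\Omega,\mathbb{R}^d)$.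
   Context: Measurability and a.e. refer to the Lebesgue measure $\mathcal{L}^N$; $\mathcal{B}_k$ denotes the Borel measure/sets on $\mathbb{R}^k$. $L^0(\Omega)$ is the set of measurable functions $\Omega\to\mathbb{R}$. Level convex: $g:\mathbb{R}^{k}\to\mathbb{R}$ is level convex if $\{\xi\in\mathbb{R}^k: g(\xi)\le t\}$ is convex for every $t\in\mathbb{R}$. Normal integrand: $f:\Omega\times\mathbb{R}^d\times\mathbb{R}^k\to\mathbb{R}$ is a normal integrand if it is $\mathcal{L}^N\times\mathcal{B}_d\times\mathcal{B}_k$-measurable and $f(x,\cdot,\cdot)$ is lower semicontinuous for a.e. $x\in\Omega$. $(\mathrm{aInc})_p$: for $p>0$, a function $\varphi:\Omega\times[0,\infty)\to[0,\infty]$ satisfies $(\mathrm{aInc})_p$ with constant $L\ge1$ if $\varphi(x,\lambda t)\le L\lambda^p\varphi(x,t)$ for a.e. $x\in\Omega$ and all $t\ge0$, $\lambda\in[0,1]$ (with the convention $0\cdot\infty=0$). It satisfies $(\mathrm{aInc})_p$ if this holds for some $L\ge1$. Generalized weak $\Phi$-function: $\varphi:\Omega\times[0,\infty)\to[0,\infty]$ belongs to $\Phi_{\mathrm{w}}(\Omega)$ if: $x\mapsto\varphi(x,|g(x)|)$ is measurable for every $g\in L^0(\Omega)$; $\varphi(x,0)=0$, $\lim_{t\to0^+}\varphi(x,t)=0$ and $\lim_{t\to\infty}\varphi(x,t)=\infty$ for a.e. $x\in\Omega$; $t\mapsto\varphi(x,t)$ is increasing (in the non-strict sense) for a.e. $x\in\Omega$;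 and $\varphi$ satisfies $(\mathrm{aInc})_1$. Modular: for $g\in L^0(\Omega)$, $\rho_\varphi(g):=\int_\Omega\varphi(x,|g(x)|)\,dx$. Functional $E_\varphi:L^1(\Omega,\mathbb{R}^d)\to[0,\infty]$: $E_\varphi(u):=\rho_\varphi(f(\cdot,u,Du))$ if $u\in W^{1,1}_{\mathrm{loc}}(\Omega,\mathbb{R}^d)$, and $E_\varphi(u):=\infty$ otherwise. $E_\infty:=E_{\varphi_\infty}$ with $\varphi_\infty(x,t):=\infty\,\chi_{(1,\infty)}(t)$ (that is, $0$ for $t\le1$ and $\infty$ for $t>1$); thus $E_\infty(u)=0$ if $u\in W^{1,1}_{\mathrm{loc}}(\Omega,\mathbb{R}^d)$ and $|f(\cdot,u,Du)|\le1$ a.e. in $\Omega$, and $E_\infty(u)=\infty$ otherwise. *)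

(* Defs.v *)
From HB Require Import structures.
From mathcomp Require Import all_boot all_order all_algebra.
From mathcomp Require Import all_classical all_reals all_analysis.
From mathcomp Require Import measurable_realfun.
Set Implicit Arguments.
Unset Strict Implicit.
Unset Printing Implicit Defensive.
Import Order.TTheory GRing.Theory Num.Theory.
Import numFieldNormedType.Exports.
Local Open Scope classical_set_scope.
Local Open Scope ring_scope.

(* N-dimensional Lebesgue measure: the one-dimensional one is iterated on
   n-tuples with the library's product measure, transported to row vectors and
   completed by Caratheodory's construction. *)
Section tuple_lebesgue.
Context {R : realType}.
Let T : measurableType _ := measurableTypeR R.

Definition cons_pair n (p : T * n.-tuple T) : n.+1.-tuple T :=
  [tuple of p.1 :: p.2].

Lemma measurable_cons_pair n : measurable_fun setT (@cons_pair n).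
Proof. exact: measurable_cons. Qed.

Section step.
Variables (n : nat) (m : {sigma_finite_measure set (n.-tuple T) -> \bar R}).

Definition cons_lebesgue : set (n.+1.-tuple T) -> \bar R :=
  pushforward (@lebesgue_measure R \x m)%E (@cons_pair n).

Let cons_lebesgue0 : cons_lebesgue set0 = 0%E.
Proof. by rewrite /cons_lebesgue /pushforward preimage_set0 measure0. Qed.

Let cons_lebesgue_ge0 A : (0 <= cons_lebesgue A)%E.
Proof. by rewrite /cons_lebesgue /pushforward; exact: (measure_ge0 (lebesgue_measure \x m)%E). Qed.

Let cons_lebesgue_sigma_additive : semi_sigma_additive cons_lebesgue.
Proof.
move=> F mF tF mUF; rewrite /cons_lebesgue /pushforward preimage_bigcup.
have mcF A : measurable A -> measurable (@cons_pair n @^-1` A).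
  by move=> mA; rewrite -[X in measurable X]setTI; exact: measurable_cons_pair.
apply: measure_semi_sigma_additive => [k||]; first exact: mcF.
- apply/trivIsetP => /= i j _ _ ij; rewrite -preimage_setI.
  by move/trivIsetP : tF => /(_ _ _ _ _ ij) ->//; rewrite preimage_set0.
- by rewrite -preimage_bigcup; exact: mcF.
Qed.

HB.instance Definition _ := isMeasure.Build _ _ _ cons_lebesgue
  cons_lebesgue0 cons_lebesgue_ge0 cons_lebesgue_sigma_additive.

Let cons_lebesgue_sigma_finite : sigma_finite setT cons_lebesgue.
Proof.
have /sigma_finiteP[F [TF ndF Foo]] := sigma_finiteT (@lebesgue_measure R).
have /sigma_finiteP[G [TG ndG Goo]] := sigma_finiteT m.
exists (fun k => [set t | F k (thead t) /\ G k [tuple of behead t]]).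
  rewrite predeqE => t; split=> // _.
  have [j _ Fj] : (\bigcup_k F k) (thead t) by rewrite -TF.
  have [k _ Gk] : (\bigcup_k G k) [tuple of behead t] by rewrite -TG.
  exists (maxn j k) => //; split.
  - by move: Fj; apply/subsetPset/ndF/leq_maxl.
  - by move: Gk; apply/subsetPset/ndG/leq_maxr.
move=> k; have [mF Fk] := Foo k; have [mG Gk] := Goo k; split.
  apply: measurableI.
  - by rewrite -[X in measurable X]setTI; exact: measurable_tnth.
  - by rewrite -[X in measurable X]setTI; exact: measurable_behead.
rewrite /= /cons_lebesgue /pushforward.
rewrite (_ : _ @^-1` _ = F k `*` G k); last first.
  apply/seteqP; split=> -[x t] /= [Fx Gt]; split=> //;
    move: Gt; by congr (G k _); apply/val_inj.
by rewrite product_measure1E// lte_mul_pinfty// ge0_fin_numE.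
Qed.

HB.instance Definition _ := Measure_isSigmaFinite.Build _ _ _ cons_lebesgue
  cons_lebesgue_sigma_finite.

End step.

Fixpoint tuple_lebesgue n : {sigma_finite_measure set (n.-tuple T) -> \bar R} :=
  if n is k.+1 then cons_lebesgue (tuple_lebesgue k)
  else dirac [tuple].

End tuple_lebesgue.

Section lebesgue.
Variables (R : realType) (N : nat).

Definition rV_tuple (x : 'rV[R]_N) : N.-tuple (measurableTypeR R) :=
  [tuple x ord0 i | i < N].

Definition lebesgue_outer (A : set 'rV[R]_N) : \bar R :=
  mu_ext (tuple_lebesgue N) (rV_tuple @` A).

Let lebesgue_outer0 : lebesgue_outer set0 = 0%E.
Proof. by rewrite /lebesgue_outer image_set0 outer_measure0. Qed.

Let lebesgue_outer_ge0 A : (0 <= lebesgue_outer A)%E.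
Proof. exact: outer_measure_ge0. Qed.

Let le_lebesgue_outer :
  {homo lebesgue_outer : A B / A `<=` B >-> (A <= B)%E}.
Proof. by move=> A B AB; apply: le_outer_measure; exact: image_subset. Qed.

Let lebesgue_outer_sigma_subadditive : sigma_subadditive lebesgue_outer.
Proof.
move=> A; rewrite /lebesgue_outer image_bigcup.
exact: outer_measure_sigma_subadditive.
Qed.

HB.instance Definition _ := isOuterMeasure.Build R 'rV[R]_N lebesgue_outer
  lebesgue_outer0 lebesgue_outer_ge0 le_lebesgue_outer
  lebesgue_outer_sigma_subadditive.

End lebesgue.

(* 'rV[R]_N with the sigma-algebra of Lebesgue-measurable sets *)
Notation lebesgue_type R N := (caratheodory_type (@lebesgue_outer R N)).

Definition lebesgue (R : realType) (N : nat) :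
  set (lebesgue_type R N) -> \bar R := @lebesgue_outer R N.

Section lebesgue_isMeasure.
Variables (R : realType) (N : nat).

Let lebesgue0 : @lebesgue R N set0 = 0%E.
Proof. exact: outer_measure0. Qed.

Let lebesgue_ge0 A : (0 <= @lebesgue R N A)%E.
Proof. exact: outer_measure_ge0. Qed.

Let lebesgue_sigma_additive : semi_sigma_additive (@lebesgue R N).
Proof. exact: caratheodory_measure_sigma_additive. Qed.

HB.instance Definition _ := isMeasure.Build _ _ _ (@lebesgue R N)
  lebesgue0 lebesgue_ge0 lebesgue_sigma_additive.

End lebesgue_isMeasure.

Lemma measurable_tuple_box (R : realType) m (c d : 'I_m -> R) :
  measurable [set t : m.-tuple (measurableTypeR R) |
    forall i, (tnth t i : R) \in `]c i, d i]].
Proof.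
rewrite [X in measurable X](_ : _ = \bigcap_(i in [set: 'I_m])
    ((@tnth _ (measurableTypeR R))^~ i @^-1` `]c i, d i])); last first.
  by apply/seteqP; split => [t + i _|t + i]; apply.
rewrite -[X in measurable X]setCK setC_bigcap; apply: measurableC.
apply: fin_bigcup_measurable => [|i _]; first exact: finite_finset.
apply: measurableC.
rewrite -[X in measurable X]setTI; apply: measurable_tnth => //.
Qed.

Lemma tuple_lebesgue_box (R : realType) n (a b : 'I_n -> R) :
  (forall i, a i <= b i) ->
  tuple_lebesgue n [set t | forall i, (tnth t i : R) \in `]a i, b i]] =
  (\prod_(i < n) (b i - a i))%:E.
Proof.
elim: n a b => [|n IH] a b ab.
  by rewrite big_ord0 /= diracE mem_set//= => -[].
rewrite /= /cons_lebesgue /pushforward.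
rewrite [X in product_measure1 _ _ X](_ : _ = `]a ord0, b ord0] `*`
    [set t | forall i, (tnth t i : R) \in `]a (lift ord0 i), b (lift ord0 i)]]).
  rewrite product_measure1E/=; [|exact: measurable_itv|exact: measurable_tuple_box].
  rewrite IH; last by move=> i; exact: ab.
  by rewrite lebesgue_measure_itv/= lte_fin big_ord_recl EFinM;
    case: ltgtP (ab ord0) => // ->; rewrite subrr.
apply/seteqP; split=> -[x t] /=.
  move=> H; split; first exact: (H ord0).
  by move=> i; have := H (lift ord0 i); rewrite /cons_pair tnthS.
move=> [Hx Ht] i; rewrite /cons_pair.
by case: (unliftP ord0 i) => [j|] ->; rewrite ?tnthS//; exact: Ht.
Qed.

Lemma lebesgue_box (R : realType) N (a b : 'rV[R]_N) :
  (forall i, a ord0 i <= b ord0 i) ->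
  lebesgue [set x : 'rV[R]_N | forall i, x ord0 i \in `]a ord0 i, b ord0 i]] =
  (\prod_(i < N) (b ord0 i - a ord0 i))%:E.
Proof.
move=> ab; rewrite /lebesgue /lebesgue_outer.
rewrite (_ : _ @` _ = [set t | forall i, (tnth t i : R) \in
    `]a ord0 i, b ord0 i]]).
  rewrite measurable_mu_extE/=; first exact: tuple_lebesgue_box.
  exact: measurable_tuple_box.
apply/seteqP; split => [_ [x Hx <-] i|t Ht] /=.
  by rewrite tnth_mktuple; exact: Hx.
exists (\row_i tnth t i) => [i|]; first by rewrite mxE; exact: Ht.
by apply: eq_from_tnth => i; rewrite tnth_mktuple mxE.
Qed.

Section sobolev.
Context {R : realType} {N : nat}.
Implicit Types (Om K : set 'rV[R]_N) (psi g : 'rV[R]_N -> R).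

Definition domain Om := open Om /\ connected Om.

(* Euclidean (Frobenius) norm; the library's norm on matrices is the sup norm *)
Definition enorm {m n} (A : 'M[R]_(m, n)) : R :=
  Num.sqrt (\sum_(i < m) \sum_(j < n) A i j ^+ 2).

Definition ae_in Om (P : 'rV[R]_N -> Prop) :=
  {ae @lebesgue R N, forall x, Om x -> P x}.

Definition ess_sup_in Om (h : 'rV[R]_N -> \bar R) : \bar R :=
  ereal_inf [set y | ae_in Om (fun x => (h x <= y)%E)].

Definition ess_inf_in Om (h : 'rV[R]_N -> \bar R) : \bar R :=
  ereal_sup [set y | ae_in Om (fun x => (y <= h x)%E)].

Definition L0 Om (g : 'rV[R]_N -> R) :=
  measurable_fun (Om : set (lebesgue_type R N)) g.

Definition L1 {m n} Om (u : 'rV[R]_N -> 'M[R]_(m, n)) :=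
  forall i j, (@lebesgue R N).-integrable Om (fun x => (u x i j)%:E).

Definition L1loc {m n} Om (u : 'rV[R]_N -> 'M[R]_(m, n)) :=
  (forall i j, L0 Om (fun x => u x i j)) /\
  (forall K, compact K -> K `<=` Om -> L1 K u).

Definition L1norm {m n} Om (u : 'rV[R]_N -> 'M[R]_(m, n)) : R :=
  \int[@lebesgue R N]_(x in Om) enorm (u x).

(* convergence against every bounded linear functional on L1; boundedness makes
   T independent of the choice of representatives *)
Definition L1_dual {m n} Om (T : ('rV[R]_N -> 'M[R]_(m, n)) -> R) :=
  (forall (a : R) u v, L1 Om u -> L1 Om v ->
    T (fun x => a *: u x + v x) = a * T u + T v) /\
  (exists C : R, forall u, L1 Om u -> `|T u| <= C * L1norm Om u).

Definition weakly_cvg_L1 {m n} Om (u_ : nat -> 'rV[R]_N -> 'M[R]_(m, n)) u :=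
  forall T, L1_dual Om T -> T (u_ k) @[k --> \oo] --> T u.

Definition partial (j : 'I_N) psi : 'rV[R]_N -> R :=
  fun x => 'D_(delta_mx ord0 j) psi x.

Definition smooth psi := forall s : seq 'I_N,
  let h := foldr partial psi s in
  continuous h /\ forall x j, derivable h x (delta_mx ord0 j).

Definition test_function Om psi :=
  let supp := closure [set x | psi x != 0] in
  [/\ smooth psi, compact supp & supp `<=` Om].

Definition weak_gradient {d} Om (u : 'rV[R]_N -> 'rV[R]_d)
    (G : 'rV[R]_N -> 'M[R]_(d, N)) :=
  L1loc Om G /\
  forall (i : 'I_d) (j : 'I_N) psi, test_function Om psi ->
    \int[@lebesgue R N]_(x in Om) (u x ord0 i * partial j psi x) =
    - \int[@lebesgue R N]_(x in Om) (G x i j * psi x).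

Definition W11loc {d} Om (u : 'rV[R]_N -> 'rV[R]_d) :=
  L1loc Om u /\ exists G, weak_gradient Om u G.

(* Du for u in W11loc; the weak gradient is unique up to a null set *)
Definition gradient {d} Om (u : 'rV[R]_N -> 'rV[R]_d) :
  'rV[R]_N -> 'M[R]_(d, N) := get (weak_gradient Om u).

End sobolev.

(* T with its Borel sigma-algebra *)
Notation borel_type T := (g_sigma_algebraType (@open T)).

Section functional.
Context {R : realType} {N d : nat}.
Implicit Types (Om : set 'rV[R]_N) (phi : 'rV[R]_N -> R -> \bar R)
  (f : 'rV[R]_N -> 'rV[R]_d -> 'M[R]_(d, N) -> R).

Definition level_convex {M : lmodType R} (g : M -> R) :=
  forall t : R, convex_set [set xi | g xi <= t].

Definition normal_integrand Om f :=
  measurable_fun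
    (Om `*` setT `*` setT : set (lebesgue_type R N *
      borel_type 'rV[R]_d * borel_type 'M[R]_(d, N)))
    (fun p => f p.1.1 p.1.2 p.2) /\
  ae_in Om (fun x => lower_semicontinuous
    (fun q : 'rV[R]_d * 'M[R]_(d, N) => (f x q.1 q.2)%:E)).

(* phi : Om x [0, oo) -> [0, oo] is represented by a function on all of
   R^N x R; only its values on Om x [0, oo) are used *)
Definition aInc Om phi (p L : R) :=
  ae_in Om (fun x => forall t lam : R, 0 <= t -> 0 <= lam <= 1 ->
    (phi x (lam * t)%R <= (L * lam `^ p)%:E * phi x t)%E).

Definition weak_Phi Om phi :=
  [/\ forall x t, Om x -> 0 <= t -> (0 <= phi x t)%E,
      forall g, L0 Om g ->
        measurable_fun (Om : set (lebesgue_type R N))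
          (fun x => phi x `|g x|),
      ae_in Om (fun x => [/\ phi x 0 = 0%E,
        phi x t @[t --> 0^'+] --> 0%E & phi x t @[t --> +oo%R] --> +oo%E]),
      ae_in Om (fun x => forall s t : R, 0 <= s -> s <= t ->
        (phi x s <= phi x t)%E)
    & exists2 L : R, 1 <= L & aInc Om phi 1 L].

Definition modular Om phi (g : 'rV[R]_N -> R) : \bar R :=
  (\int[@lebesgue R N]_(x in Om) phi x `|g x|%R)%E.

Definition energy Om f phi (u : 'rV[R]_N -> 'rV[R]_d) : \bar R :=
  if `[< W11loc Om u >] then
    modular Om phi (fun x => f x (u x) (gradient Om u x))
  else +oo%E.

Definition phi_infty (x : 'rV[R]_N) (t : R) : \bar R :=
  if t <= 1 then 0%E else +oo%E.

Definition energy_infty Om f := energy Om f phi_infty.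

End functional.

(* Main.v *)
Require Import Defs.
From mathcomp Require Import all_boot all_order all_algebra.
From mathcomp Require Import all_classical all_reals all_analysis.
From mathcomp Require Import measurable_realfun.
From mathcomp Require Import ring lra.
Import Order.TTheory GRing.Theory Num.Theory.
Import numFieldNormedType.Exports.
Local Open Scope classical_set_scope.
Local Open Scope ring_scope.
Set Implicit Arguments.
Unset Strict Implicit.
Unset Printing Implicit Defensive.

(** The upper bound only uses [phi_n^+(1) -> 0].  For the lower bound, (aInc) turns a
    bound on [E_(phi_n)(u_n)] into a bound on the integral of [|f|^(p_n)] over
    [{|f| >= 1}], up to factors [theta^(p_n)] with [theta < 1] arbitrarily close to 1.
    Along a subsequence this bounds the gradients in [L^2] and yields, for a.e. x and
    every e > 0, [f(x, u_n, Du_n) <= 1 + e] eventually.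

    Lower semicontinuity is obtained without Young measures.  A Poincare inequality on
    boxes, proved by repeated bisection, upgrades weak convergence of the [u_n] to
    strong [L^1] convergence on boxes, hence to a.e. convergence of a subsequence.
    Convex combinations of the gradients, chosen as almost minimizers of the [L^2] norm,
    converge a.e., and their limit is the gradient of [u].  Pointwise, coercivity makes
    the sublevel sets of [f(x, z, .)] compact, so lower semicontinuity and level
    convexity carry the bound [f <= 1] over to the limit. *)

(** Level convexity concerns the gradient variable alone, so convex combinations of gradients can be
    compared with [f x (u x)] only once the functions themselves converge pointwise; this is why
    weak convergence must be made strong. The compactness is local: it is obtained on boxes
    contained in [Om] together with a margin, and countably many of them cover [Om]. Boxes are
    half-open so that bisection partitions them exactly; smooth approximations of their indicators
    then stick out beyond the upper faces, and the margin makes room for this. The exponent 2 is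
    chosen for the parallelogram identity, which turns almost minimizers into a Cauchy sequence; as
    [p n] tends to infinity it eventually exceeds [2 / gamma], so coercivity gives an L^2 bound
    whatever [gamma] is. Convex combinations are taken of the pairs (function, gradient), so that
    the integration by parts formula passes to them and identifies the limit. Any constant may bound
    the energies: it gets divided by [s ^ p_n] with [s > 1], which tends to infinity. *)

Section lebesgue_measurability.
Context {R : realType} {N : nat}.
Local Notation LT := (lebesgue_type R N).

Lemma rV_tuple_imageI (X : set 'rV[R]_N) (B : set (N.-tuple (measurableTypeR R))) :
  @rV_tuple R N @` (X `&` @rV_tuple R N @^-1` B) = (@rV_tuple R N @` X) `&` B.
Proof.
apply/seteqP; split => [_ [x [Xx Bx] <-]|_ [[x Xx <-] Bx]]; last by exists x.
by split => //; exists x.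
Qed.

(** The preimage of [B] cuts a set of row vectors exactly as [B] cuts its image, so the Caratheodory
    condition for [B] transfers to row vectors. *)
Lemma measurable_rV_tuple :
  measurable_fun setT (@rV_tuple R N : LT -> N.-tuple (measurableTypeR R)).
Proof.
move=> _ B mB; rewrite setTI.
suff : caratheodory_measurable (@lebesgue_outer R N) (@rV_tuple R N @^-1` B) by [].
move=> X; rewrite /lebesgue_outer preimage_setC !rV_tuple_imageI.
exact: (caratheodory_measurable_mu_ext (tuple_lebesgue N) mB).
Qed.

Lemma measurable_coord (D : set 'rV[R]_N) (i : 'I_N) :
  measurable_fun (D : set LT) (fun x : LT => (x : 'rV[R]_N) ord0 i).
Proof.
apply: (@measurable_funS _ _ _ _ setT); [exact: measurableT|exact: subsetT|].
have -> : (fun x : LT => (x : 'rV[R]_N) ord0 i) =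
   ((@tnth _ (measurableTypeR R))^~ i \o @rV_tuple R N).
  by apply/funext => x /=; rewrite tnth_mktuple.
apply: measurableT_comp; [exact: measurable_tnth|exact: measurable_rV_tuple].
Qed.

End lebesgue_measurability.

(** * Borel measurability of matrix-valued maps, and open sets of R^N *)

Section matrix_borel.
Context {R : realType} {m n : nat}.

Definition rat_cube (qk : 'M[rat]_(m, n) * nat) : set 'M[R]_(m, n) :=
  [set M | forall i j, `|M i j - ratr (qk.1 i j)| < qk.2.+1%:R^-1].

(** Rational cubes form a countable base. The closed cube of triple radius is kept inside [U] to
    leave room for the margin around the boxes of [box_cover]. *)
Lemma rat_cube_nbhs (U : set 'M[R]_(m, n)) (M : 'M[R]_(m, n)) : nbhs M U ->
  exists qk, rat_cube qk M /\
    [set M' : 'M[R]_(m, n) | forall i j, `|M' i j - ratr (qk.1 i j)| <= 3 * qk.2.+1%:R^-1] `<=` U.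
Proof.
move=> /nbhs_ballP[e e0 eU].
(* With radius [c], a point of the triple cube is within [c + 3 * c] of [M]. *)
have e40 : 0 < e / 4 by rewrite divr_gt0.
have [k _ /(_ k (leqnn k)) ke] := near_infty_natSinv_lt (PosNum e40).
have ke0 : 4 * (k.+1%:R^-1 : R) < e by rewrite mulrC -ltr_pdivlMr.
have ck : (0 : R) < k.+1%:R^-1 by rewrite invr_gt0.
have hq i j : exists q : rat, `|M i j - ratr q| < k.+1%:R^-1.
  have [|q /[!in_itv]/= /andP[q1 q2]] := @rat_in_itvoo R (M i j) (M i j + k.+1%:R^-1).
    by rewrite ltrDl.
  by exists q; rewrite ltr_distlC q2 andbT (lt_trans _ q1)// ltrBlDr ltrDl.
pose q := \matrix_(i, j) xchoose (hq i j).
have qP i j : `|M i j - ratr (q i j)| < k.+1%:R^-1.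
  by rewrite mxE; exact: (xchooseP (hq i j)).
exists (q, k); split => [i j|M' M'q]; first exact: qP.
apply: eU; split => // i j; rewrite /ball/=.
have -> : M i j - M' i j = (M i j - ratr (q i j)) - (M' i j - ratr (q i j)) by ring.
rewrite (le_lt_trans (ler_normB _ _))//.
apply: lt_trans ke0; have -> : 4 * (k.+1%:R^-1 : R) = k.+1%:R^-1 + 3 * k.+1%:R^-1.
  by set c := _^-1; ring.
exact: ltr_leD.
Qed.

(** An open set is the countable union of the rational cubes it contains, and membership in a cube
    is a finite set of conditions on the entries. *)
Lemma measurable_open_coord d (T : measurableType d) (D : set T)
    (f : T -> 'M[R]_(m, n)) (U : set 'M[R]_(m, n)) : measurable D ->
  (forall i j, measurable_fun D (fun x => f x i j)) -> open U ->
  measurable (D `&` f @^-1` U).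
Proof.
move=> mD mf oU.
have -> : D `&` f @^-1` U = \bigcup_(qk : 'M[rat]_(m, n) * nat)
    (if `[< rat_cube qk `<=` U >] then D `&` f @^-1` rat_cube qk else set0).
  apply/seteqP; split => [x [Dx Ux]|x [qk _] /=].
    have [qk [qkx qkU]] := rat_cube_nbhs (open_nbhs_nbhs (conj oU Ux)).
    exists qk => //=; case: asboolP => [_|[]]; first by split.
    by move=> M' qkM'; apply: qkU => i j /=; rewrite (le_trans (ltW (qkM' i j)))// ler_peMl ?invr_ge0// ler1n.
  by case: asboolP => // qkU [Dx qkx]; split => //; exact: qkU.
apply: countable_bigcupT_measurable => [|qk].
  exact: countableP.
case: ifP => // _.
have -> : D `&` f @^-1` rat_cube qk = D `&` \bigcap_(ij in [set: 'I_m * 'I_n])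
   (D `&` (fun x => `|f x ij.1 ij.2 - ratr (qk.1 ij.1 ij.2)|) @^-1` `]-oo, qk.2.+1%:R^-1[).
  apply/seteqP; split => [x [Dx qkx]|x [Dx qkx]]; split => //.
    by move=> [i j] _; split => //=; rewrite in_itv /=; exact: qkx.
  by move=> i j; have [_ /=] := qkx (i, j) Logic.I; rewrite in_itv.
apply: measurableI => //; rewrite -[X in measurable X]setCK setC_bigcap.
apply: measurableC; apply: fin_bigcup_measurable => [|[i j] _].
  exact: finite_finset.
apply: measurableC.
have : measurable_fun D (fun x => `|f x i j - ratr (qk.1 i j)|).
  by apply: measurableT_comp => //; apply: measurable_funB.
exact.
Qed.

Lemma measurable_fun_borel d (T : measurableType d) (D : set T)
    (f : T -> 'M[R]_(m, n)) : measurable D ->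
  (forall i j, measurable_fun D (fun x => f x i j)) ->
  measurable_fun D (f : T -> borel_type 'M[R]_(m, n)).
Proof.
move=> mD mf; have h : @measurable _ (borel_type 'M[R]_(m, n)) = <<s @open 'M[R]_(m, n) >> by [].
apply: (measurability _ h) => _ [U oU <-].
exact: measurable_open_coord.
Qed.

End matrix_borel.

Section lebesgue_open.
Context {R : realType} {N : nat}.
Local Notation LT := (lebesgue_type R N).

Lemma open_lebesgue_measurable (U : set 'rV[R]_N) : open U -> measurable (U : set LT).
Proof.
move=> oU; rewrite -[X in measurable X]setTI.
apply: (@measurable_open_coord R 1 N _ LT setT id U measurableT _ oU) => i j.
by rewrite (ord1 i); exact: (@measurable_coord R N setT j).
Qed.

Lemma closed_lebesgue_measurable (U : set 'rV[R]_N) : closed U -> measurable (U : set LT).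
Proof.
by move=> cU; rewrite -[X in measurable X]setCK; apply/measurableC/open_lebesgue_measurable/closed_openC.
Qed.

Lemma continuous_lebesgue_measurable (D : set 'rV[R]_N) (h : 'rV[R]_N -> R) :
  continuous h -> measurable_fun (D : set LT) h.
Proof.
move=> ch; apply: (@measurable_funS _ _ _ _ setT); [exact: measurableT|exact: subsetT|].
apply: (measurability _ (RGenOpens.measurableE R)) => _ [_ [a [b ->]] <-]; rewrite setTI.
apply: open_lebesgue_measurable.
by apply: open_comp => //; exact: interval_open.
Qed.

Definition box (a b : 'rV[R]_N) : set 'rV[R]_N :=
  [set x | forall i, x ord0 i \in `]a ord0 i, b ord0 i]].

Definition cbox (a b : 'rV[R]_N) : set 'rV[R]_N :=
  [set x | forall i, x ord0 i \in `[a ord0 i, b ord0 i]].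

Lemma measurable_box a b : measurable (box a b : set LT).
Proof.
have -> : box a b = @rV_tuple R N @^-1` [set t : N.-tuple (measurableTypeR R) |
    forall i, (tnth t i : R) \in `]a ord0 i, b ord0 i]].
  apply/seteqP; split => x /= H i; have := H i; rewrite tnth_mktuple//.
rewrite -[X in measurable X]setTI; apply: measurable_rV_tuple => //.
exact: measurable_tuple_box.
Qed.

Lemma compact_cbox a b : compact (cbox a b).
Proof.
rewrite /cbox; apply: (@rV_compact R N (fun i => `[a ord0 i, b ord0 i]%classic)).
by move=> i; exact: segment_compact.
Qed.

Lemma closed_cbox a b : closed (cbox a b).
Proof. by apply: compact_closed; [exact: norm_hausdorff|exact: compact_cbox]. Qed.

Lemma measurable_cbox a b : measurable (cbox a b : set LT).
Proof. exact/closed_lebesgue_measurable/closed_cbox. Qed.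

End lebesgue_open.

(** * Smooth test functions *)

Section smooth_line.
Context {R : realType}.
Implicit Types (t a b s : R) (f F g : R -> R).

(* The factor [t^-1 ^+ k] makes the family stable under differentiation. *)
Definition flat k t : R := if 0 < t then t^-1 ^+ k * expR (- t^-1) else 0.

Lemma flat_ge0 k t : 0 <= flat k t.
Proof.
rewrite /flat; case: ifP => // t0.
by rewrite mulr_ge0 ?expR_ge0// exprn_ge0// invr_ge0 ltW.
Qed.

Lemma flat0_le1 t : flat 0 t <= 1.
Proof.
rewrite /flat; case: ifP => // t0.
by rewrite expr0 mul1r -expR0 ler_expR oppr_le0 invr_ge0 ltW.
Qed.

(** With [y = t^-1], [expR y] dominates the term [y ^ (k + 2) / (k + 2)!] of its series. *)
Lemma flat_le_sqr k t : flat k t <= (k.+2)`!%:R * t ^+ 2.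
Proof.
rewrite /flat; case: ifP => t0; last by rewrite mulr_ge0// ?sqr_ge0.
have y0 : 0 < t^-1 by rewrite invr_gt0.
have F0 : (0 : R) < (k.+2)`!%:R by rewrite ltr0n fact_gt0.
have : t^-1 ^+ k.+2 / (k.+2)`!%:R <= expR t^-1.
  by apply: le_trans (expR_ge1Dxn k.+1 (ltW y0)); rewrite lerDr.
rewrite ler_pdivrMr// => H.
rewrite expRN ler_pdivrMr ?expR_gt0//.
have -> : t^-1 ^+ k = t^-1 ^+ k.+2 * t ^+ 2.
  by rewrite -addn2 exprD -mulrA -exprMn mulVf ?expr1n ?mulr1// gt_eqF.
by rewrite [leRHS]mulrAC ler_pM2r ?exprn_gt0// mulrC.
Qed.

(** Away from the origin this is calculus; at the origin the quadratic bound [flat_le_sqr] makes the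
    difference quotient of order [|h|]. *)
Lemma is_derive_flat k t :
  is_derive t 1 (flat k) (- k%:R * flat k.+1 t + flat k.+2 t).
Proof.
have [t0|t0|->] := ltgtP t 0.
- have -> : - k%:R * flat k.+1 t + flat k.+2 t = 0.
    by rewrite /flat ltNge (ltW t0)/= mulr0 addr0.
  apply: (@near_eq_is_derive R R^o R^o (cst (0 : R)) _ t 1 0).
  near=> s; rewrite /flat; suff /ltW : s < 0 by rewrite leNgt => /negbTE ->.
  by near: s; exact: lt_nbhsl.
- rewrite /flat t0.
  apply: (@near_eq_is_derive _ _ _ (fun s => s^-1 ^+ k * expR (- s^-1))).
    near=> s; suff -> : 0 < s by [].
    by near: s; exact: lt_nbhsr.
  have tn0 : t != 0 by rewrite gt_eqF.
  have d1 : is_derive t 1 (fun s : R => s^-1) (- t ^- 2 *: 1).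
    by apply: (@is_deriveV R id); exact: tn0.
  have d2 := is_deriveX k d1.
  have d3 := is_deriveN d1.
  have d4 := is_derive1_comp (is_derive_expR _) d3.
  have d5 := is_deriveM d2 d4.
  rewrite exprfctE in d5.
  apply: (is_derive_eq d5).
  rewrite /GRing.scale/= !mulr1.
  have -> : (- (fun x : R => x^-1)) t = - t^-1 by [].
  rewrite -exprVn; case: k {d2 d5} => [|k] /=; rewrite !exprS ?expr0; ring.
- have C0 : (0 : R) <= (k.+2)`!%:R by [].
  have f0 j : flat j 0 = 0 by rewrite /flat ltxx.
  suff H : (fun h => h^-1 *: (flat k (h *: 1 + 0) - flat k 0)) h @[h --> 0^'] --> (0 : R).
    rewrite !f0 mulr0 addr0; apply: DeriveDef; first by apply/cvg_ex; exists 0.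
    exact/cvg_lim.
  apply/cvgrPdist_lt => e e0; near=> h.
  have hn0 : h != 0 by near: h; exact: nbhs_dnbhs_neq.
  rewrite sub0r normrN f0 subr0 addr0 normrM normfV ger0_norm ?flat_ge0//.
  rewrite mulrC ltr_pdivrMr ?normr_gt0// (le_lt_trans (flat_le_sqr _ _))//.
  rewrite -[_ *: 1]/(_ * _) mulr1 -real_normK ?num_real// expr2 mulrA ltr_pM2r ?normr_gt0//.
  rewrite (@le_lt_trans _ _ (((k.+2)`!%:R + 1) * `|h|))//.
    by rewrite ler_wpM2r// lerDl.
  rewrite mulrC -ltr_pdivlMr ?ltr_wpDl//.
  near: h; apply: dnbhs0_lt; by rewrite divr_gt0// ltr_wpDl.
Unshelve. all: by end_near. Qed.

(** A syntactic class whose members have derivatives in the class, so that smoothness of every order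
    follows by induction. The primitive constructor admits trapezoids, whose derivatives are
    differences of bumps. *)
Inductive smooth1 : (R -> R) -> Prop :=
| smooth1_flat k c e : smooth1 (fun t => flat k (c * t + e))
| smooth1_cst c : smooth1 (fun=> c)
| smooth1D f g : smooth1 f -> smooth1 g -> smooth1 (fun t => f t + g t)
| smooth1M f g : smooth1 f -> smooth1 g -> smooth1 (fun t => f t * g t)
| smooth1_primitive F f : (forall t, is_derive t 1 F (f t)) ->
    smooth1 f -> smooth1 F.

Lemma smooth1_derive f : smooth1 f ->
  exists2 g, smooth1 g & forall t, is_derive t 1 f (g t).
Proof.
elim=> {f} [k c e|c|f g _ [f' sf' ff'] _ [g' sg' gg']|f g sf [f' sf' ff'] sg [g' sg' gg']|F f Ff sf _].
- exists (fun t => c * (- k%:R * flat k.+1 (c * t + e) + flat k.+2 (c * t + e))).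
    by do ![apply: smooth1M || apply: smooth1D || exact: smooth1_cst || exact: smooth1_flat].
  move=> t; have d1 : is_derive t 1 (fun t : R => c * t + e) c.
    have := is_deriveD (is_deriveZ c (is_derive_id t 1)) (is_derive_cst e t 1).
    by move=> /is_derive_eq; apply; rewrite addr0 /GRing.scale/= mulr1.
  have := @is_derive1_comp R (flat k) (fun t => c * t + e) t _ c (is_derive_flat k (c * t + e)) d1.
  by move=> /is_derive_eq; apply; rewrite mulrC.
- by exists (fun=> 0); [exact: smooth1_cst|move=> t; exact: is_derive_cst].
- by exists (fun t => f' t + g' t); [exact: smooth1D|move=> t; exact: is_deriveD].
- exists (fun t => f t * g' t + g t * f' t).
    by apply: smooth1D; exact: smooth1M.
  by move=> t; exact: is_deriveM.
- by exists f.
Qed.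

Lemma smooth1_continuous f : smooth1 f -> continuous f.
Proof.
move=> /smooth1_derive[g _ fg] t.
by apply: differentiable_continuous; apply/derivable1_diffP; have [] := fg t.
Qed.

(** Since [f] vanishes below [a], it is integrable on every half-line []-oo, x]], so one integral
    formula defines the primitive on the whole line. *)
Lemma primitive_ex f a : continuous f -> (forall t, t <= a -> f t = 0) ->
  exists F, forall t, is_derive t 1 F (f t).
Proof.
move=> cf f0; pose F (x : R) := \int[@lebesgue_measure R]_(t in [set` `]-oo, x]]) f t.
exists F => x.
have xu : x < x + 1 by rewrite ltrDl.
have intf : (@lebesgue_measure R).-integrable [set` `]-oo, (x + 1)]] (EFin \o f).
  have icc : (@lebesgue_measure R).-integrable [set` `[a, (x + 1)]] (EFin \o f).
    apply: continuous_compact_integrable; first exact: segment_compact.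
    by apply: continuous_subspaceT.
  have : (@lebesgue_measure R).-integrable [set` `]-oo, (x + 1)]] ((EFin \o f) \_ [set` `[a, (x + 1)]]).
    apply/integrable_restrict => //; rewrite setIidr//.
    by apply: subset_itvr => //; rewrite bnd_simp.
  apply: eq_integrable => // t; rewrite inE/= in_itv/= => tx.
  rewrite patchE; case: ifPn => //; rewrite notin_setE/= in_itv/= tx andbT => /negP.
  by rewrite -ltNge => /ltW/f0 ->.
have [dF F'] := continuous_FTC1 xu intf (ltNyr _) (cf x).
by apply: DeriveDef; rewrite -?derive1E.
Qed.

End smooth_line.

Section bump.
Context {R : realType}.
Implicit Types (t a b h rho : R).

(* The n-th bump lives on ]a, b + rho / (n + 1)[, so that the pointwise limit
   is the indicator of the half-open interval ]a, b], endpoint included. *)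
Definition sbump rho a b n t : R :=
  flat 0 ((t - a) * n.+1%:R ^+ 2) *
  flat 0 ((b + rho / n.+1%:R - t) * n.+1%:R ^+ 2).

Lemma smooth1_sbump rho a b n : smooth1 (sbump rho a b n).
Proof.
rewrite /sbump; apply: smooth1M.
  rewrite (_ : (fun _ => _) = (fun t => flat 0 (n.+1%:R ^+ 2 * t + - (a * n.+1%:R ^+ 2)))).
    exact: smooth1_flat.
  by apply/funext => t; congr flat; ring.
rewrite (_ : (fun _ => _) = (fun t => flat 0 (- n.+1%:R ^+ 2 * t +
   (b + rho / n.+1%:R) * n.+1%:R ^+ 2))).
  exact: smooth1_flat.
by apply/funext => t; congr flat; ring.
Qed.

Lemma sbump_ge0 rho a b n t : 0 <= sbump rho a b n t.
Proof. by rewrite mulr_ge0// flat_ge0. Qed.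

Lemma sbump_le1 rho a b n t : sbump rho a b n t <= 1.
Proof. by rewrite mulr_ile1// ?flat_ge0// flat0_le1. Qed.

Lemma sbump_neq0 rho a b n t : sbump rho a b n t != 0 ->
  a < t < b + rho / n.+1%:R.
Proof.
have n2 : (0 : R) < n.+1%:R ^+ 2 by rewrite exprn_gt0.
rewrite /sbump mulf_eq0 negb_or => /andP[].
rewrite /flat; case: ifPn; last by rewrite eqxx.
rewrite pmulr_lgt0// subr_gt0 => -> _; case: ifPn; last by rewrite eqxx.
by rewrite pmulr_lgt0// subr_gt0.
Qed.

Lemma cvg_sbump rho a b t : 0 < rho ->
  sbump rho a b n t @[n --> \oo] --> (\1_(`]a, b]%classic) t : R).
Proof.
move=> rho0; rewrite indicE mem_setE in_itv/=.
have [tab|] := boolP (a < t <= b).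
  have /andP[at_ tb] := tab.
  have ta0 : 0 < t - a by rewrite subr_gt0.
  (* Both factors of the bump have the form [expR (- y) >= 1 - y], with [y] at most
     [(t - a)^-1 / (n + 1)] and [rho^-1 / (n + 1)] respectively. The scaling by [(n + 1) ^ 2]
     outweighs the shift [rho / (n + 1)], which matters at the endpoint [t = b]. *)
  pose C := (t - a)^-1 + rho^-1.
  apply: (@squeeze_cvgr _ _ _ _ (fun n => 1 - C * n.+1%:R^-1) (fun=> 1)).
  - near=> n; rewrite sbump_le1 andbT /sbump /flat.
    have n0 : (0 : R) < n.+1%:R by [].
    have n1 : (1 : R) <= n.+1%:R by rewrite ler1n.
    have p1 : 0 < (t - a) * n.+1%:R ^+ 2 by rewrite mulr_gt0// exprn_gt0.
    have q2 : rho * n.+1%:R <= (b + rho / n.+1%:R - t) * n.+1%:R ^+ 2.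
      have -> : rho * n.+1%:R = (rho / n.+1%:R) * n.+1%:R ^+ 2.
        by rewrite expr2 mulrA divfK// gt_eqF.
      by rewrite ler_pM2r ?exprn_gt0// addrAC lerDr subr_ge0.
    have r0 : 0 < rho * n.+1%:R by rewrite mulr_gt0.
    have p2 := lt_le_trans r0 q2.
    rewrite p1 p2 !expr0 !mul1r -expRD.
    apply: le_trans (expR_ge1Dx _); rewrite lerD2l /C mulrDl opprD lerD// lerN2.
      rewrite invfM ler_pM2l ?invr_gt0// lef_pV2 ?posrE ?exprn_gt0//.
      by rewrite expr2 ler_peMl// ltW.
    by rewrite -invfM lef_pV2// ?posrE.
  - rewrite -[X in _ --> X](subr0 1) -[X in _ --> _ - X](mulr0 C).
    by apply: cvgB; [exact: cvg_cst|apply: cvgM; [exact: cvg_cst|exact: cvg_harmonic]].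
  - exact: cvg_cst.
rewrite negb_and -leNgt -ltNge => /orP[ta|bt].
  rewrite (_ : sbump _ _ _ ^~ _ = fun=> 0); first exact: cvg_cst.
  apply/funext => n; apply/eqP; apply: contraTT ta => /sbump_neq0/andP[].
  by rewrite -ltNge.
have tb0 : 0 < (t - b) / rho by rewrite divr_gt0// subr_gt0.
apply/cvgrPdist_le => e e0; near=> n.
suff -> : sbump rho a b n t = 0 by rewrite subr0 normr0 ltW.
apply/eqP; apply: contraT => /sbump_neq0/andP[_]; rewrite ltNge => /negP[].
rewrite -lerBrDl -ler_pdivlMl// mulrC; apply: ltW.
by near: n; exact: (near_infty_natSinv_lt (PosNum tb0)).
Unshelve. all: by end_near. Qed.

(* Its derivative approximates the difference of the indicators of two adjacent
   intervals of length h. *)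
Lemma trapezoid_ex rho a b h n : 0 < h -> exists B,
  [/\ smooth1 B,
      forall t, is_derive t 1 B (sbump rho a b n t - sbump rho a b n (t - h)),
      forall t, `|B t| <= h
    & forall t, B t != 0 -> a < t < b + h + rho / n.+1%:R].
Proof.
move=> h0; have sb := smooth1_sbump rho a b n.
have bz t : t <= a -> sbump rho a b n t = 0.
  move=> ta; apply/eqP; apply: contraTT ta => /sbump_neq0/andP[].
  by rewrite -ltNge.
have [F dF] := primitive_ex (smooth1_continuous sb) bz.
have sF : smooth1 F by exact: smooth1_primitive sb.
have [sh dsh] : smooth1 (fun t => t - h) /\
    forall t, is_derive t 1 (fun t => t - h) (1 - 0).
  have d t : is_derive t 1 (fun t => t - h) (1 - 0).
    exact: is_deriveB.
  split; last exact: d.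
  exact: (smooth1_primitive d (smooth1_cst _)).
have dB t : is_derive t 1 (fun t => F t - F (t - h)) (sbump rho a b n t - sbump rho a b n (t - h)).
  apply: is_deriveB.
  have := @is_derive1_comp R F (fun t => t - h) t _ _ (dF (t - h)) (dsh t).
  by rewrite subr0 mulr1.
have sB : smooth1 (fun t => sbump rho a b n t - sbump rho a b n (t - h)).
  rewrite (_ : (fun _ => _) = (fun t => sbump rho a b n t +
      (- 1) * (flat 0 (n.+1%:R ^+ 2 * t + - ((a + h) * n.+1%:R ^+ 2)) *
      flat 0 (- n.+1%:R ^+ 2 * t + (b + h + rho / n.+1%:R) * n.+1%:R ^+ 2)))).
    by apply: smooth1D => //; do !apply: smooth1M; do ?[exact: smooth1_cst | exact: smooth1_flat].
  apply/funext => t; rewrite mulN1r; congr (_ - _); rewrite /sbump; congr (flat _ _ * flat _ _); ring.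
(* One value of the bump in [[t - h, t]] controls both the size and the support of the trapezoid. *)
have mvt t : exists2 c, c \in `[t - h, t] & F t - F (t - h) = sbump rho a b n c * h.
  have th : t - h <= t by rewrite lerBlDr lerDl ltW.
  have cF : {within `[t - h, t], continuous F}.
    by apply: continuous_subspaceT; exact: smooth1_continuous.
  have [c ct ->] := MVT_segment th (fun x _ => dF x) cF.
  by exists c => //; rewrite opprB addrC subrK.
exists (fun t => F t - F (t - h)); split => //; first exact: smooth1_primitive sB.
- move=> t; have [c _ ->] := mvt t.
  rewrite normrM (gtr0_norm h0) (ger0_norm (sbump_ge0 _ _ _ _ _)).
  by apply: ler_piMl; [exact: ltW|exact: sbump_le1].
- move=> t; have [c + ->] := mvt t.
  rewrite in_itv/= mulf_eq0 negb_or => /andP[c1 c2] /andP[/sbump_neq0/andP[c3 c4] _].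
  by rewrite (lt_le_trans c3)//=; move: c4; set r := rho / _ => c4; lra.
Qed.

End bump.

Section tensor.
Context {R : realType} {N : nat}.
Implicit Types (b : 'I_N -> R -> R) (x : 'rV[R]_N).

Definition tensor b x : R := \prod_(i < N) b i (x ord0 i).

Definition upd b (j : 'I_N) (g : R -> R) : 'I_N -> R -> R :=
  fun i => if i == j then g else b i.

Lemma tensor_upd b j g x :
  tensor (upd b j g) x = g (x ord0 j) * \prod_(i < N | i != j) b i (x ord0 i).
Proof.
rewrite /tensor (bigD1 j)//= /upd eqxx; congr (_ * _).
by apply: eq_bigr => i /negbTE ->.
Qed.

Lemma tensorD1 b j x :
  tensor b x = b j (x ord0 j) * \prod_(i < N | i != j) b i (x ord0 i).
Proof. by rewrite /tensor (bigD1 j). Qed.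

Lemma tensor_continuous b : (forall i, continuous (b i)) -> continuous (tensor b).
Proof.
move=> cb x; rewrite /tensor.
have H (s : seq 'I_N) :
    (fun y : 'rV[R]_N => \prod_(i <- s) b i (y ord0 i)) @ x --> (\prod_(i <- s) b i (x ord0 i) : R).
  elim: s => [|i s IH].
    rewrite (_ : (fun _ => _) = cst 1); last by apply/funext => y; rewrite big_nil.
    by rewrite big_nil; exact: (@cst_continuous _ _ (1 : R) x).
  rewrite (_ : (fun _ => _) = (fun y : 'rV[R]_N => b i (y ord0 i) * \prod_(i <- s) b i (y ord0 i))).
    rewrite big_cons; apply: cvgM => //.
      exact: (nbhs_filter x).
    exact: (@cvg_comp _ _ _ (fun y : 'rV[R]_N => y ord0 i) (b i) (nbhs x) (nbhs (x ord0 i)) _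
      (@coord_continuous R 1 N ord0 i x) (cb i _)).
  by apply/funext => y; rewrite big_cons.
exact: H.
Qed.

Lemma is_derive_tensor b (j : 'I_N) (g : R -> R) x : (forall t : R, is_derive t 1 (b j) (g t)) ->
  is_derive x (delta_mx ord0 j) (tensor b) (tensor (upd b j g) x).
Proof.
move=> dg.
have H : (fun h : R => h^-1 *: (tensor b (h *: delta_mx ord0 j + x) - tensor b x)) h
    @[h --> 0^'] --> tensor (upd b j g) x.
  rewrite tensor_upd; set C := \prod_(i < N | _) _.
  rewrite (_ : (fun h : R => _) = (fun h => (h^-1 *: (b j (h *: 1 + x ord0 j) - b j (x ord0 j))) * C)).
    apply: cvgM; last exact: cvg_cst.
    have [dr <-] := dg (x ord0 j).
    exact: dr.
  apply/funext => h; rewrite !(tensorD1 b j) !mxE !eqxx/= -scalerAl mulrBl.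
  congr (_ *: (_ - _)); congr (_ * _); apply: eq_bigr => i /negbTE ij.
  by rewrite !mxE ij andbF mulr0 add0r.
apply: DeriveDef; first by apply/cvg_ex; exists (tensor (upd b j g) x).
exact/cvg_lim.
Qed.

(** A partial derivative replaces one factor by its derivative, so every iterated partial derivative
    is again a tensor of [smooth1] functions. *)
Lemma tensor_smooth b : (forall i, smooth1 (b i)) -> smooth (tensor b).
Proof.
move=> sb s.
have [c sc ->] : exists2 c : 'I_N -> R -> R, (forall i, smooth1 (c i)) &
    foldr partial (tensor b) s = tensor c.
  elim: s => [|j s [c sc IH]] /=; first by exists b.
  have [g sg dg] := smooth1_derive (sc j).
  exists (upd c j g).
    by move=> i; rewrite /upd; case: ifP.
  rewrite IH; apply/funext => x; rewrite /partial.
  by have [_ ->] := is_derive_tensor x dg.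
split; first by apply: tensor_continuous => i; exact: smooth1_continuous.
move=> x j; have [g _ dg] := smooth1_derive (sc j).
by have [] := is_derive_tensor x dg.
Qed.

Lemma tensor_support b (lo hi : 'rV[R]_N) x :
  (forall i t, b i t != 0 -> lo ord0 i <= t <= hi ord0 i) ->
  tensor b x != 0 -> cbox lo hi x.
Proof.
move=> bs bx i; rewrite in_itv/=; apply: bs.
by apply: contraNneq bx => bx0; rewrite (tensorD1 b i) bx0 mul0r.
Qed.

Lemma tensor_test (Om : set 'rV[R]_N) b (lo hi : 'rV[R]_N) :
  (forall i, smooth1 (b i)) ->
  (forall i t, b i t != 0 -> lo ord0 i <= t <= hi ord0 i) ->
  cbox lo hi `<=` Om -> test_function Om (tensor b).
Proof.
move=> sb bs sub.
have cl : closure [set x | tensor b x != 0] `<=` cbox lo hi.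
  rewrite closureE; apply: smallest_sub; first exact: closed_cbox.
  by move=> x; exact: tensor_support.
split; [exact: tensor_smooth| |exact: subset_trans cl sub].
by apply: subclosed_compact cl => //; [exact: closed_closure|exact: compact_cbox].
Qed.

End tensor.

(** * Integrals over boxes as limits of integrals against test functions *)

Section Rintegral_lemmas.
Context d (T : measurableType d) (R : realType) (mu : {measure set T -> \bar R}).
Implicit Types (D E : set T) (f g h : T -> R).

Lemma dominated_cvg_Rintegral D (f_ : nat -> T -> R) f h : measurable D ->
  (forall n, measurable_fun D (f_ n)) ->
  (forall x, D x -> f_ n x @[n --> \oo] --> f x) ->
  mu.-integrable D (EFin \o h) ->
  (forall n x, D x -> `|f_ n x| <= h x) ->
  mu.-integrable D (EFin \o f) /\
  \int[mu]_(x in D) f_ n x @[n --> \oo] --> (\int[mu]_(x in D) f x : R).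
Proof.
move=> mD mf cf ih fh.
have cvf : {ae mu, forall x, D x -> (f_ n x)%:E @[n --> \oo] --> (f x)%:E}.
  by apply: aeW => x Dx; apply: cvg_EFin; [exact: nearW|exact: cf].
have mff : measurable_fun D f.
  by apply: (measurable_fun_cvg (h := f_)) => // x Dx; exact: cf.
have [intf _ cint] := @dominated_convergence _ T R mu D mD (fun n => EFin \o f_ n)
   (EFin \o f) (EFin \o h) (fun n => (measurable_EFinP _ _).2 (mf n))
   ((measurable_EFinP _ _).2 mff) cvf ih
   (aeW _ (fun x n Dx => fh n x Dx)).
split => //; apply: fine_cvg.
by rewrite fineK//; exact: integrable_fin_num.
Qed.

Lemma integrable_le D f g : measurable D -> measurable_fun D f ->
  (forall x, D x -> `|f x| <= g x) -> mu.-integrable D (EFin \o g) ->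
  mu.-integrable D (EFin \o f).
Proof.
move=> mD mf fg; apply: le_integrable => //; first exact/measurable_EFinP.
by move=> x Dx /=; rewrite lee_fin (le_trans (fg x Dx))// ler_norm.
Qed.

Lemma integrable_measurable D f : mu.-integrable D (EFin \o f) -> measurable_fun D f.
Proof. by move=> /measurable_int/measurable_EFinP. Qed.

Lemma integrable_normr D f : mu.-integrable D (EFin \o f) ->
  mu.-integrable D (EFin \o (fun x => `|f x|)).
Proof. exact: integrable_abse. Qed.

Lemma Rintegral_indic D E f :
  \int[mu]_(x in D) (f x * \1_E x) = \int[mu]_(x in D `&` E) f x.
Proof.
rewrite Rintegral_mkcondr; apply: eq_Rintegral => x _.
by rewrite patchE indicE; case: ifP => _; rewrite ?mulr1 ?mulr0.
Qed.

Lemma Rintegral_subset D E f : E `<=` D -> (forall x, D x -> ~ E x -> f x = 0) ->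
  \int[mu]_(x in D) f x = \int[mu]_(x in E) f x.
Proof.
move=> ED f0; rewrite -[in RHS](setIidr ED) Rintegral_mkcondr.
apply: eq_Rintegral => x; rewrite inE => Dx; rewrite patchE.
by case: ifPn => //; rewrite notin_setE => /(f0 _ Dx).
Qed.

Lemma integrableM_indic D E f : measurable D -> measurable E ->
  mu.-integrable D (EFin \o f) ->
  mu.-integrable D (EFin \o (fun x => f x * \1_E x)).
Proof.
move=> mD mE fi; apply: (integrable_le (g := fun x => `|f x|)) => //.
- by apply: measurable_funM; [exact: integrable_measurable fi|exact: measurable_indic].
- by move=> x _; rewrite normrM ler_piMr// indicE; case: (_ \in _); rewrite ?normr1 ?normr0.
- exact: integrable_normr.
Qed.

End Rintegral_lemmas.

Section box_limits.
Context {R : realType} {N : nat}.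
Local Notation mu := (@lebesgue R N).
Implicit Types (a b x : 'rV[R]_N) (v g : 'rV[R]_N -> R).

Definition updr a (j : 'I_N) (c : R) : 'rV[R]_N :=
  \row_i (if i == j then c else a ord0 i).

Lemma indic_box a b x :
  \1_(box a b) x = \prod_(i < N) \1_(`]a ord0 i, b ord0 i]%classic) (x ord0 i) :> R.
Proof.
rewrite indicE; have [|] := boolP (x \in box a b).
  rewrite inE => xab; rewrite big1// => i _.
  by rewrite indicE mem_setE (xab i).
rewrite notin_setE => /existsNP[i xi].
by rewrite (bigD1 i)//= indicE mem_setE (negbTE (introN idP xi)) mul0r.
Qed.

Lemma cvg_tensor (b_ : nat -> 'I_N -> R -> R) (l : 'I_N -> R) x :
  (forall i, b_ n i (x ord0 i) @[n --> \oo] --> l i) ->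
  tensor (b_ n) x @[n --> \oo] --> \prod_(i < N) l i.
Proof.
move=> bl; rewrite /tensor; elim: (index_enum _) => [|i s IH].
  under eq_cvg do rewrite big_nil.
  by rewrite big_nil; exact: cvg_cst.
under eq_cvg do rewrite big_cons.
by rewrite big_cons; apply: cvgM.
Qed.

Lemma tensor_indic_cvg rho a b x : 0 < rho ->
  tensor (fun i => sbump rho (a ord0 i) (b ord0 i) n) x @[n --> \oo] -->
    (\1_(box a b) x : R).
Proof. by move=> r0; rewrite indic_box; apply: cvg_tensor => i; exact: cvg_sbump. Qed.

Lemma tensor_bump_itv rho a b n x : 0 <= tensor (fun i => sbump rho (a ord0 i) (b ord0 i) n) x <= 1.
Proof.
rewrite /tensor prodr_ge0 => [|i _]; last exact: sbump_ge0.
by apply: prodr_ile1 => i _; rewrite sbump_ge0 sbump_le1.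
Qed.

Lemma box_sub_cbox a b : box a b `<=` cbox a b.
Proof. by move=> x xab i; apply: subset_itv_oc_cc; exact: xab. Qed.

(** The upper faces belong to the box, so the half-open box is the decreasing limit of its
    enlargements. *)
Lemma indic_box_shrink rho a b x : 0 < rho ->
  \1_(box a (b + const_mx (rho / n.+1%:R))) x @[n --> \oo] --> (\1_(box a b) x : R).
Proof.
move=> r0; rewrite indic_box; under eq_cvg do rewrite indic_box.
apply: (@cvg_tensor (fun n i t => \1_(`]a ord0 i, (b + const_mx (rho / n.+1%:R)) ord0 i]%classic) t)) => i.
rewrite indicE mem_setE in_itv/=.
have [bx|xb] := ltP (b ord0 i) (x ord0 i); last first.
  apply: cvg_near_cst; apply: nearW => n; rewrite indicE mem_setE in_itv/= !mxE.
  by rewrite (le_trans xb)// lerDl divr_ge0// ltW.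
have tb0 : 0 < (x ord0 i - b ord0 i) / rho by rewrite divr_gt0// subr_gt0.
apply: cvg_near_cst; near=> n; rewrite indicE mem_setE in_itv/= !mxE.
have H : b ord0 i + rho / n.+1%:R < x ord0 i.
  rewrite -ltrBrDl mulrC -ltr_pdivlMr//.
  by near: n; exact: (near_infty_natSinv_lt (PosNum tb0)).
by rewrite (lt_geF H) !andbF.
Unshelve. all: by end_near. Qed.

Lemma sbump_support rho a b n (i : 'I_N) t : 0 < rho ->
  sbump rho (a ord0 i) (b ord0 i) n t != 0 ->
  a ord0 i <= t <= (b + const_mx rho) ord0 i.
Proof.
move=> r0 /sbump_neq0/andP[ta tb]; rewrite (ltW ta)/= !mxE (le_trans (ltW tb))// lerD2l.
by rewrite ler_pdivrMr// ler_peMr ?ler1n// ltW.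
Qed.

Lemma sbump_test (Om : set 'rV[R]_N) rho a b n : 0 < rho ->
  cbox a (b + const_mx rho) `<=` Om ->
  test_function Om (tensor (fun i => sbump rho (a ord0 i) (b ord0 i) n)).
Proof.
move=> r0 sub; apply: tensor_test sub => [i|i t]; first exact: smooth1_sbump.
exact: sbump_support.
Qed.

Lemma cbox_subr a b b' : (forall i, b ord0 i <= b' ord0 i) -> cbox a b `<=` cbox a b'.
Proof. by move=> bb x xab i; have := xab i; rewrite !in_itv/= => /andP[-> /le_trans]; apply. Qed.

(** Dominated convergence along tensors of bumps, which tend pointwise to the indicator of the
    half-open box. *)
Lemma box_integral_eq0 (Om : set 'rV[R]_N) rho a b g : 0 < rho ->
  cbox a (b + const_mx rho) `<=` Om ->
  mu.-integrable (cbox a (b + const_mx rho)) (EFin \o g) ->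
  (forall psi, test_function Om psi -> \int[mu]_(x in Om) (g x * psi x) = 0) ->
  \int[mu]_(x in box a b) g x = 0.
Proof.
move=> r0 sub ig g0; set K := cbox _ _ in sub ig *.
have mK : measurable (K : set (lebesgue_type R N)) by exact: measurable_cbox.
pose psi n := tensor (fun i => sbump rho (a ord0 i) (b ord0 i) n).
have psiT n : test_function Om (psi n) by exact: sbump_test.
have bK : box a b `<=` K.
  move=> x /box_sub_cbox; apply: cbox_subr => i.
  by rewrite !mxE lerDl ltW.
have mpsi n : measurable_fun (K : set (lebesgue_type R N)) (psi n).
  apply: continuous_lebesgue_measurable; apply: tensor_continuous => i.
  exact/smooth1_continuous/smooth1_sbump.
have gK n : \int[mu]_(x in K) (g x * psi n x) = 0.
  rewrite -(g0 _ (psiT n)); apply/esym/Rintegral_subset => // x _ xK.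
  have [->|pn0] := eqVneq (psi n x) 0; first by rewrite mulr0.
  by case: xK; apply: tensor_support pn0 => i t; exact: sbump_support.
have [n|x Kx||n x Kx|_] := @dominated_cvg_Rintegral _ _ R mu K (fun n x => g x * psi n x)
  (fun x => g x * \1_(box a b) x) (fun x => `|g x|) mK.
- by apply: measurable_funM => //; exact: integrable_measurable ig.
- by apply: cvgM; [exact: cvg_cst|exact: tensor_indic_cvg].
- exact: integrable_normr.
- have /andP[p0 p1] := tensor_bump_itv rho a b n x.
  by rewrite normrM ler_piMr// ger0_norm.
under eq_fun do rewrite gK.
rewrite Rintegral_indic setIidr// => /cvg_lim <- //.
exact: lim_cst.
Qed.

Definition weak_partial (Om : set 'rV[R]_N) v g (j : 'I_N) :=
  forall psi, test_function Om psi ->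
    \int[mu]_(x in Om) (v x * partial j psi x) =
    - \int[mu]_(x in Om) (g x * psi x).

Definition mid a b (j : 'I_N) : R := a ord0 j + (b ord0 j - a ord0 j) / 2.
Definition lower_half a b j := box a (updr b j (mid a b j)).
Definition upper_half a b j := box (updr a j (mid a b j)) b.

(* Tested against a tensor of bumps whose j-th factor is the trapezoid, the weak
   derivative compares the integrals over the two halves of the box. *)
Lemma half_integrals (Om : set 'rV[R]_N) rho a b v g j :
  measurable (Om : set (lebesgue_type R N)) ->
  0 < rho -> a ord0 j < b ord0 j ->
  cbox a (b + const_mx rho) `<=` Om ->
  mu.-integrable Om (EFin \o v) ->
  mu.-integrable (cbox a (b + const_mx rho)) (EFin \o g) ->
  weak_partial Om v g j ->
  `|\int[mu]_(x in lower_half a b j) v x - \int[mu]_(x in upper_half a b j) v x| <=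
    (b ord0 j - a ord0 j) / 2 * \int[mu]_(x in box a b) `|g x|.
Proof.
move=> mOm r0 abj sub iv ig wp; set K := cbox _ _ in sub ig *.
have mK : measurable (K : set (lebesgue_type R N)) by exact: measurable_cbox.
set h := (b ord0 j - a ord0 j) / 2; set m := mid a b j.
have h0 : 0 < h by rewrite divr_gt0// subr_gt0.
have bmh : b ord0 j = m + h by rewrite /m /h /mid; lra.
have amh : m = a ord0 j + h by rewrite /m /h /mid; lra.
pose be n i := sbump rho (a ord0 i) (b ord0 i) n.
have /choice[B HB] : forall n, exists B : R -> R,
  [/\ smooth1 B,
      forall t : R, is_derive t 1 B (sbump rho (a ord0 j) m n t - sbump rho (a ord0 j) m n (t - h)),
      forall t, `|B t| <= h
    & forall t, B t != 0 -> a ord0 j < t < m + h + rho / n.+1%:R].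
  by move=> n; exact: trapezoid_ex.
pose bb n := upd (be n) j (B n).
pose psi n := tensor (bb n).
pose dB n t := sbump rho (a ord0 j) m n t - sbump rho (a ord0 j) m n (t - h).
have bbs n i t : bb n i t != 0 -> a ord0 i <= t <= (b + const_mx rho) ord0 i.
  rewrite /bb /upd; case: ifPn => [/eqP ->|_]; last exact: sbump_support.
  have [_ _ _ H] := HB n; move=> /H/andP[ta tb]; rewrite (ltW ta)/= !mxE.
  by rewrite (le_trans (ltW tb))// bmh lerD2l ler_pdivrMr// ler_peMr ?ler1n// ltW.
have sbb n i : smooth1 (bb n i).
  by rewrite /bb /upd; case: ifP => _; [have [] := HB n|exact: smooth1_sbump].
have psiT n : test_function Om (psi n) by exact: (tensor_test (sbb n) (bbs n) sub).
have dpsi n x : partial j (psi n) x = tensor (upd (be n) j (dB n)) x.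
  have d (t : R) : is_derive t 1 (bb n j) (dB n t).
    by have [_ + _ _] := HB n; rewrite /bb /upd eqxx; apply.
  rewrite /partial; have [_ ->] := is_derive_tensor x d.
  by rewrite !tensor_upd; congr (_ * _); apply: eq_bigr => i /negbTE ij; rewrite /bb /upd ij.
have bK : box a b `<=` K.
  move=> x /box_sub_cbox; apply: cbox_subr => i.
  by rewrite !mxE lerDl ltW.
have mpsi n : measurable_fun (K : set (lebesgue_type R N)) (psi n).
  by apply: continuous_lebesgue_measurable; apply: tensor_continuous => i; exact/smooth1_continuous.
have prod01 n x : 0 <= \prod_(i < N | i != j) be n i (x ord0 i) <= 1.
  rewrite prodr_ge0 => [|i _]; last exact: sbump_ge0.
  by apply: prodr_ile1 => i _; rewrite sbump_ge0 sbump_le1.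
have LO : lower_half a b j `<=` Om.
  move=> x xL; apply: sub; move: xL => /box_sub_cbox; apply: cbox_subr => i.
  by rewrite !mxE; case: eqVneq => [->|_]; rewrite -?bmh ?bmh -/m; lra.
have UO : upper_half a b j `<=` Om.
  move=> x xU; apply: sub; apply: bK => i; have := xU i; rewrite !in_itv/= mxE.
  case: eqVneq => [->|_ //]; move=> /andP[mx ->]; rewrite andbT.
  by apply: lt_trans mx; rewrite -/m; lra.
have mL : measurable (lower_half a b j : set (lebesgue_type R N)) by exact: measurable_box.
have mU : measurable (upper_half a b j : set (lebesgue_type R N)) by exact: measurable_box.
have lhs : \int[mu]_(x in Om) (v x * partial j (psi n) x) @[n --> \oo] -->
    \int[mu]_(x in lower_half a b j) v x - \int[mu]_(x in upper_half a b j) v x.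
  have [n|x Kx||n x Kx|_] := @dominated_cvg_Rintegral _ _ R mu Om (fun n x => v x * partial j (psi n) x)
    (fun x => v x * (\1_(lower_half a b j) x - \1_(upper_half a b j) x)) (fun x => `|v x|) mOm.
  - apply: measurable_funM; first exact: integrable_measurable iv.
    by have [/(_ [:: j])[c _] _ _] := psiT n; exact: continuous_lebesgue_measurable.
  - apply: cvgM; first exact: cvg_cst.
    under eq_cvg do rewrite dpsi.
    pose l i : R := if i == j then \1_(`]a ord0 j, m]%classic) (x ord0 j) -
       \1_(`]m, b ord0 j]%classic) (x ord0 j)
       else \1_(`]a ord0 i, b ord0 i]%classic) (x ord0 i).
    rewrite (_ : _ - _ = \prod_(i < N) l i).
      apply: cvg_tensor => i; rewrite /l /upd; case: eqVneq => [->|_]; last exact: cvg_sbump.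
      apply: cvgB; first exact: cvg_sbump.
      (* In direction [j], the upper half is the lower half translated by [h]. *)
      rewrite (_ : \1_(`]m, b ord0 j]%classic) (x ord0 j) =
        \1_(`]a ord0 j, m]%classic) (x ord0 j - h)); first exact: cvg_sbump.
      by rewrite !indicE !mem_setE !in_itv/= ltrBrDr lerBlDr -amh -bmh.
    rewrite !indic_box (bigD1 j)//= [X in _ - X](bigD1 j)//= [RHS](bigD1 j)//=.
    rewrite /l eqxx !mxE eqxx mulrBl; congr (_ * _ - _ * _);
      by apply: eq_bigr => i /negbTE ij; rewrite !mxE ij.
  - exact: integrable_normr.
  - rewrite normrM ler_piMr// dpsi tensor_upd normrM mulr_ile1//.
      rewrite ler_norml /dB; have := sbump_ge0 rho (a ord0 j) m n (x ord0 j).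
      have := sbump_le1 rho (a ord0 j) m n (x ord0 j).
      have := sbump_ge0 rho (a ord0 j) m n (x ord0 j - h).
      have := sbump_le1 rho (a ord0 j) m n (x ord0 j - h).
      by move=> *; apply/andP; split; lra.
    by have /andP[p0 p1] := prod01 n x; rewrite ger0_norm.
  under [X in _ --> X -> _]eq_Rintegral do rewrite mulrBr.
  by rewrite RintegralB ?integrableM_indic// !Rintegral_indic !setIidr.
have ing : mu.-integrable K (EFin \o (fun x => h * `|g x|)).
  by apply: (integrableZl mK h (integrable_normr ig)).
(* The support of [psi n] exceeds the box by at most [rho / (n + 1)] and [|psi n|] is at most [h];
   the integrals over these enlarged boxes tend to the one over the box. *)
have rhs : \int[mu]_(x in K) (`|g x| * (h * \1_(box a (b + const_mx (rho / n.+1%:R))) x)) @[n --> \oo]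
   --> h * \int[mu]_(x in box a b) `|g x|.
  have [n|x Kx||n x Kx|_] := @dominated_cvg_Rintegral _ _ R mu K (fun n x => `|g x| * (h * \1_(box a (b + const_mx (rho / n.+1%:R))) x))
    (fun x => `|g x| * (h * \1_(box a b) x)) (fun x => h * `|g x|) mK.
  - apply: measurable_funM; first by apply: measurableT_comp => //; exact: integrable_measurable ig.
    by apply: measurable_funM => //; apply: measurable_indic; exact: measurable_box.
  - apply: cvgM; first exact: cvg_cst.
    apply: cvgM; first exact: cvg_cst.
    exact: indic_box_shrink.
  - exact: ing.
  - rewrite mulrCA normrM gtr0_norm// ler_pM2l// normrM normr_id ler_piMr// indicE.
    by case: (_ \in _); rewrite ?normr1 ?normr0.
  under [X in _ --> X -> _]eq_Rintegral do rewrite mulrCA mulrA.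
  rewrite Rintegral_indic setIidr// RintegralZl//; first exact: measurable_box.
  by apply: integrable_normr; apply: integrableS ig => //; exact: measurable_box.
have bound n : `|\int[mu]_(x in Om) (v x * partial j (psi n) x)| <=
   \int[mu]_(x in K) (`|g x| * (h * \1_(box a (b + const_mx (rho / n.+1%:R))) x)).
  rewrite wp// normrN (@Rintegral_subset _ _ R mu Om (K : set (lebesgue_type R N)))//; last first.
    move=> x _ xK; have [->|pn0] := eqVneq (psi n x) 0; first by rewrite mulr0.
    by case: xK; exact: (tensor_support (bbs n) pn0).
  have psih x : `|psi n x| <= h * \1_(box a (b + const_mx (rho / n.+1%:R))) x.
    have hprod : psi n x = B n (x ord0 j) * \prod_(i < N | i != j) be n i (x ord0 i).
      by rewrite /psi /bb tensor_upd.
    have [_ _ Bh Bs] := HB n; have /andP[p0 p1] := prod01 n x.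
    rewrite indicE; have [xQ|] := boolP (x \in _).
      by rewrite mulr1 hprod normrM -[leRHS]mulr1 ler_pM// ger0_norm.
    rewrite notin_setE mulr0 normr_le0 => xQ; apply/negPn/negP => pn0.
    apply: xQ => i; have : bb n i (x ord0 i) != 0.
      by apply: contraNneq pn0 => b0; rewrite /psi (tensorD1 _ i) b0 mul0r.
    rewrite in_itv/= !mxE /bb /upd; case: (eqVneq i j) => [->|_].
      by move/Bs; rewrite -bmh => /andP[-> /ltW].
    by move/sbump_neq0/andP => [-> /ltW].
  have igp : mu.-integrable K (EFin \o (fun x => g x * psi n x)).
    apply: (integrable_le mK _ _ ing).
      by apply: measurable_funM; [exact: integrable_measurable ig|exact: mpsi].
    move=> x _; rewrite normrM mulrC ler_wpM2r// (le_trans (psih x))//.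
    by rewrite ler_piMr ?(ltW h0)// indicE; case: (_ \in _).
  have igq : mu.-integrable K (EFin \o (fun x => `|g x| * (h * \1_(box a (b + const_mx (rho / n.+1%:R))) x))).
    have := integrableM_indic mK (measurable_box a (b + const_mx (rho / n.+1%:R))) ing.
    by congr (mu.-integrable K _); apply/funext => x /=; rewrite mulrCA mulrA.
  apply: (le_trans (le_normr_Rintegral mK igp)).
  apply: (le_Rintegral mK (integrable_normr igp) igq).
  by move=> x _; rewrite normrM ler_wpM2l.
apply: ler_cvg_to rhs _; last by apply: nearW => n; exact: bound.
exact: cvg_norm.
Qed.

End box_limits.

(** * A Poincare inequality on boxes *)

Section bisection.
Context {R : realType} {N : nat}.
Local Notation mu := (@lebesgue R N).
Local Notation LT := (lebesgue_type R N).
Local Notation rV := 'rV[R]_N.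
Implicit Types (a b x : rV) (Q P : rV * rV) (f g : rV -> R) (js : seq 'I_N).

Definition bx Q : set rV := box Q.1 Q.2.
Definition side Q i : R := Q.2 ord0 i - Q.1 ord0 i.
Definition vol Q : R := \prod_(i < N) side Q i.
Definition proper_box Q := forall i, Q.1 ord0 i < Q.2 ord0 i.
Definition lo Q j : rV * rV := (Q.1, updr Q.2 j (mid Q.1 Q.2 j)).
Definition hi Q j : rV * rV := (updr Q.1 j (mid Q.1 Q.2 j), Q.2).

(** [js] lists the directions of the successive bisections; the leaves partition the box [Q]. *)
Fixpoint leaves js Q : seq (rV * rV) :=
  if js is j :: js' then leaves js' (lo Q j) ++ leaves js' (hi Q j) else [:: Q].

Lemma measurable_bx Q : measurable (bx Q : set LT).
Proof. exact: measurable_box. Qed.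

Lemma side_gt0 Q i : proper_box Q -> 0 < side Q i.
Proof. by move=> ndQ; rewrite subr_gt0. Qed.

Lemma vol_gt0 Q : proper_box Q -> 0 < vol Q.
Proof. by move=> ndQ; rewrite prodr_gt0// => i _; exact: side_gt0. Qed.

Lemma mu_bx Q : proper_box Q -> mu (bx Q) = (vol Q)%:E.
Proof. by move=> ndQ; rewrite /bx lebesgue_box// => i; exact: ltW. Qed.

Lemma side_lo Q j i : side (lo Q j) i = if i == j then side Q i / 2 else side Q i.
Proof.
by rewrite /side /lo/= mxE; case: eqVneq => [->|//]; rewrite /mid; field.
Qed.

Lemma side_hi Q j i : side (hi Q j) i = if i == j then side Q i / 2 else side Q i.
Proof.
by rewrite /side /hi/= mxE; case: eqVneq => [->|//]; rewrite /mid; field.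
Qed.

Lemma proper_box_lo Q j : proper_box Q -> proper_box (lo Q j).
Proof.
move=> ndQ i; rewrite -subr_gt0 -/(side _ _) side_lo.
by case: ifP => _; rewrite ?divr_gt0// side_gt0.
Qed.

Lemma proper_box_hi Q j : proper_box Q -> proper_box (hi Q j).
Proof.
move=> ndQ i; rewrite -subr_gt0 -/(side _ _) side_hi.
by case: ifP => _; rewrite ?divr_gt0// side_gt0.
Qed.

Lemma mid_itv Q j : proper_box Q -> Q.1 ord0 j < mid Q.1 Q.2 j < Q.2 ord0 j.
Proof. by move=> /(_ j) ndQ; rewrite /mid; apply/andP; split; lra. Qed.

Definition subbox P Q :=
  forall i, Q.1 ord0 i <= P.1 ord0 i /\ P.2 ord0 i <= Q.2 ord0 i.

Lemma subbox_lo Q j : proper_box Q -> subbox (lo Q j) Q.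
Proof.
move=> ndQ i; split=> //=; rewrite mxE; case: eqVneq => [->|//].
by have /andP[_ /ltW] := mid_itv j ndQ.
Qed.

Lemma subbox_hi Q j : proper_box Q -> subbox (hi Q j) Q.
Proof.
move=> ndQ i; split=> //=; rewrite mxE; case: eqVneq => [->|//].
by have /andP[/ltW] := mid_itv j ndQ.
Qed.

Lemma subbox_trans P P' Q : subbox P P' -> subbox P' Q -> subbox P Q.
Proof.
by move=> PP' P'Q i; have [? ?] := PP' i; have [? ?] := P'Q i; split; lra.
Qed.

Lemma subbox_sub P Q : subbox P Q -> bx P `<=` bx Q.
Proof.
move=> PQ x xP i; have [h1 h2] := PQ i; have := xP i; rewrite !in_itv/= => /andP[x1 x2].
by rewrite (le_lt_trans h1 x1) (le_trans x2 h2).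
Qed.

Lemma bx_split Q j : proper_box Q -> bx Q = bx (lo Q j) `|` bx (hi Q j).
Proof.
move=> ndQ; apply/seteqP; split => [x xQ|x []]; last 2 first.
- exact/subbox_sub/subbox_lo.
- exact/subbox_sub/subbox_hi.
have [xm|mx] := leP (x ord0 j) (mid Q.1 Q.2 j); [left|right] => i;
  have := xQ i; rewrite /= mxE !in_itv/=; case: eqVneq => [->|//] /andP[x1 x2].
  by rewrite x1.
by rewrite mx.
Qed.

Lemma bx_disj Q j : [disjoint bx (lo Q j) & bx (hi Q j)].
Proof.
apply/disj_setPS => x [/(_ j) xl /(_ j) xh]; move: xl xh => /=.
by rewrite !mxE !eqxx !in_itv/= => /andP[_ /le_lt_trans h] /andP[/h]; rewrite ltxx.
Qed.

Lemma Rintegral_split Q j f : proper_box Q -> mu.-integrable (bx Q) (EFin \o f) ->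
  \int[mu]_(x in bx Q) f x =
  \int[mu]_(x in bx (lo Q j)) f x + \int[mu]_(x in bx (hi Q j)) f x.
Proof.
move=> ndQ fi; rewrite (bx_split j ndQ) Rintegral_setU//.
- exact: measurable_bx.
- exact: measurable_bx.
- by rewrite -(bx_split j ndQ).
- exact: bx_disj.
Qed.

Lemma integrable_subbox P Q f : subbox P Q -> mu.-integrable (bx Q) (EFin \o f) ->
  mu.-integrable (bx P) (EFin \o f).
Proof.
move=> PQ; apply: integrableS; [exact: measurable_bx|exact: measurable_bx|].
exact: subbox_sub.
Qed.

Lemma leavesP js Q P : proper_box Q -> P \in leaves js Q ->
  [/\ proper_box P, subbox P Q &
      forall i, side P i = side Q i / 2 ^+ count_mem i js].
Proof.
elim: js Q => [|j js IH] Q ndQ /=.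
  rewrite inE => /eqP ->; split => // i.
  by rewrite expr0 divr1.
rewrite mem_cat => /orP[|] /IH.
- move=> /(_ (proper_box_lo j ndQ))[ndP sP dP]; split => //.
    exact: subbox_trans sP (subbox_lo j ndQ).
  move=> i; rewrite dP side_lo (eq_sym j); case: eqVneq => _ //.
  by rewrite add1n exprS invfM mulrA.
- move=> /(_ (proper_box_hi j ndQ))[ndP sP dP]; split => //.
    exact: subbox_trans sP (subbox_hi j ndQ).
  move=> i; rewrite dP side_hi (eq_sym j); case: eqVneq => _ //.
  by rewrite add1n exprS invfM mulrA.
Qed.

Lemma Rintegral_leaves js Q f : proper_box Q -> mu.-integrable (bx Q) (EFin \o f) ->
  \int[mu]_(x in bx Q) f x = \sum_(P <- leaves js Q) \int[mu]_(x in bx P) f x.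
Proof.
elim: js Q => [|j js IH] Q ndQ fi /=; first by rewrite big_seq1.
rewrite big_cat/= (Rintegral_split j ndQ fi); congr (_ + _); apply: IH.
- exact: proper_box_lo.
- exact: integrable_subbox (subbox_lo j ndQ) fi.
- exact: proper_box_hi.
- exact: integrable_subbox (subbox_hi j ndQ) fi.
Qed.

Lemma bounded_integrable Q f (c : R) : proper_box Q ->
  measurable_fun (bx Q : set LT) f -> (forall x, bx Q x -> `|f x| <= c) ->
  mu.-integrable (bx Q) (EFin \o f).
Proof.
move=> ndQ mf fc; apply: (integrable_le (g := cst c) (measurable_bx Q) mf fc).
apply/integrableP; split; first by apply/measurable_EFinP; exact: measurable_cst.
rewrite (integral_cst mu (measurable_bx Q) `|c|%:E).
by rewrite [X in (_ * X)%E](_ : _ = (vol Q)%:E) ?ltry//; exact: mu_bx.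
Qed.

Lemma Rintegral_cst_bx Q (c : R) : proper_box Q -> \int[mu]_(_ in bx Q) c = c * vol Q.
Proof.
move=> ndQ; rewrite Rintegral_cst; last exact: measurable_bx.
by rewrite [X in fine X](_ : _ = (vol Q)%:E)//; exact: mu_bx.
Qed.

Lemma integrable_cst_bx Q (c : R) : proper_box Q -> mu.-integrable (bx Q) (EFin \o cst c).
Proof. by move=> ndQ; apply: (@bounded_integrable Q (cst c) `|c|). Qed.

Definition mean f Q : R := (\int[mu]_(x in bx Q) f x) / vol Q.
Definition osc f Q : R := \int[mu]_(x in bx Q) `|f x - mean f Q|.
Definition Osc js f Q : R := \sum_(P <- leaves js Q) osc f P.

Lemma integrable_subc Q f (c : R) : proper_box Q -> mu.-integrable (bx Q) (EFin \o f) ->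
  mu.-integrable (bx Q) (EFin \o (fun x => f x - c)).
Proof.
move=> ndQ fi; exact: (integrableB (measurable_bx Q) fi (integrable_cst_bx c ndQ)).
Qed.

Lemma mean_dist Q f (c : R) : proper_box Q -> mu.-integrable (bx Q) (EFin \o f) ->
  `|mean f Q - c| * vol Q <= \int[mu]_(x in bx Q) `|f x - c|.
Proof.
move=> ndQ fi; have v0 := vol_gt0 ndQ.
rewrite -(gtr0_norm v0) -normrM mulrBl /mean divfK ?gt_eqF//.
rewrite -(Rintegral_cst_bx c ndQ) -RintegralB//; last 2 first.
- exact: measurable_bx.
- exact: integrable_cst_bx.
by apply: le_normr_Rintegral; [exact: measurable_bx|exact: integrable_subc].
Qed.

Lemma osc_ge0 f Q : 0 <= osc f Q.
Proof. by apply: Rintegral_ge0 => x _. Qed.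

(** Integrate [f - mean f Q = (g - c) + (f - g) - (mean f Q - c)]. The choices [g = f] and
    [c = mean g Q] give the two estimates that follow. *)
Lemma osc_perturb Q f g (c : R) : proper_box Q ->
  mu.-integrable (bx Q) (EFin \o f) -> mu.-integrable (bx Q) (EFin \o g) ->
  osc f Q <= \int[mu]_(x in bx Q) `|g x - c| + \int[mu]_(x in bx Q) `|f x - g x| +
    `|mean f Q - c| * vol Q.
Proof.
move=> ndQ fi gi; have mQ := measurable_bx Q.
have i1 := integrable_normr (integrable_subc c ndQ gi).
have i2 : mu.-integrable (bx Q) (EFin \o (fun x => `|f x - g x|)).
  exact/integrable_normr/(integrableB mQ fi gi).
have i3 := integrable_cst_bx `|mean f Q - c| ndQ.
have i12 := integrableD mQ i1 i2.
rewrite -(Rintegral_cst_bx _ ndQ) -RintegralD// -RintegralD//.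
apply: le_Rintegral => //.
- exact/integrable_normr/integrable_subc.
- exact: (integrableD mQ i12 i3).
move=> x _; rewrite (_ : f x - _ = (g x - c) + (f x - g x) - (mean f Q - c)); last by ring.
by rewrite (le_trans (ler_normB _ _))// lerD2r ler_normD.
Qed.

Lemma osc_le_cst Q f (c : R) : proper_box Q -> mu.-integrable (bx Q) (EFin \o f) ->
  osc f Q <= 2 * \int[mu]_(x in bx Q) `|f x - c|.
Proof.
move=> ndQ fi; have := osc_perturb c ndQ fi fi.
under [X in _ <= _ + X + _ -> _]eq_Rintegral do rewrite subrr normr0.
rewrite (Rintegral_cst_bx _ ndQ) mul0r addr0 => /le_trans; apply.
by rewrite mulr_natl mulr2n lerD2l; exact: mean_dist.
Qed.

Lemma osc_le Q f g : proper_box Q ->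
  mu.-integrable (bx Q) (EFin \o f) -> mu.-integrable (bx Q) (EFin \o g) ->
  osc f Q <= osc g Q + 2 * \int[mu]_(x in bx Q) `|f x - g x|.
Proof.
move=> ndQ fi gi; have mQ := measurable_bx Q.
apply: (le_trans (osc_perturb (mean g Q) ndQ fi gi)).
rewrite -addrA lerD2l mulr_natl mulr2n lerD2l.
rewrite /mean -mulrBl normrM normfV (gtr0_norm (vol_gt0 ndQ)) divfK ?gt_eqF ?vol_gt0//.
rewrite -RintegralB//; apply: le_normr_Rintegral => //.
exact: (integrableB mQ fi gi).
Qed.

End bisection.

Lemma ge0_cvg0P (R : realType) (u : nat -> R) : (forall k, 0 <= u k) ->
  u k @[k --> \oo] --> (0 : R) <->
  forall e, 0 < e -> \forall k \near \oo, u k <= e.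
Proof.
move=> u0; split => [/cvgrPdist_le uc e /uc|uc].
  by apply: filterS => k; rewrite sub0r normrN ger0_norm.
apply/cvgrPdist_le => e /uc; apply: filterS => k.
by rewrite sub0r normrN ger0_norm.
Qed.

(** * Approximation in L^1 by averages over ever finer boxes *)

Section step_density.
Context {R : realType} {N : nat}.
Local Notation mu := (@lebesgue R N).
Local Notation LT := (lebesgue_type R N).
Local Notation rV := 'rV[R]_N.
Implicit Types (a b x : rV) (Q P : rV * rV) (f g : rV -> R) (js : seq 'I_N).

(** One round bisects once in every direction, so [k] rounds divide every side by [2 ^ k]. *)
Definition rounds k : seq 'I_N := flatten (nseq k (enum 'I_N)).

Lemma count_rounds k i : count_mem i (rounds k) = k.
Proof.
rewrite /rounds count_flatten map_nseq sumn_nseq count_uniq_mem ?enum_uniq//.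
by rewrite mem_enum mul1n.
Qed.

Lemma ler_leaves js Q (F G : rV * rV -> R) : proper_box Q ->
  (forall P, proper_box P -> subbox P Q ->
    (forall i, side P i = side Q i / 2 ^+ count_mem i js) -> F P <= G P) ->
  \sum_(P <- leaves js Q) F P <= \sum_(P <- leaves js Q) G P.
Proof.
move=> ndQ FG; rewrite big_seq [leRHS]big_seq; apply: ler_sum => P PQ.
by have [ndP sP dP] := leavesP ndQ PQ; exact: FG.
Qed.

Lemma Osc_ge0 js f Q : 0 <= Osc js f Q.
Proof. by apply: sumr_ge0 => P _; exact: osc_ge0. Qed.

Lemma Osc_le js Q f g : proper_box Q ->
  mu.-integrable (bx Q) (EFin \o f) -> mu.-integrable (bx Q) (EFin \o g) ->
  Osc js f Q <= Osc js g Q + 2 * \int[mu]_(x in bx Q) `|f x - g x|.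
Proof.
move=> ndQ fi gi; have mQ := measurable_bx Q.
rewrite (Rintegral_leaves js ndQ); last first.
  exact/integrable_normr/(integrableB mQ fi gi).
rewrite mulr_sumr -big_split/=; apply: ler_leaves => // P ndP PQ _.
by apply: osc_le => //; exact: integrable_subbox PQ _.
Qed.

(* The averages of f over ever finer boxes approximate f in L^1. *)
Definition vanish Q f := mu.-integrable (bx Q) (EFin \o f) /\
  Osc (rounds k) f Q @[k --> \oo] --> (0 : R).

Lemma vanish_approx Q f : proper_box Q -> mu.-integrable (bx Q) (EFin \o f) ->
  (forall e, 0 < e -> exists2 g, vanish Q g & \int[mu]_(x in bx Q) `|f x - g x| <= e) ->
  vanish Q f.
Proof.
move=> ndQ fi H; split => //.
apply/(ge0_cvg0P (fun k => Osc_ge0 (rounds k) f Q)) => e e0.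
(* The approximation error counts twice in [Osc_le]: [e / 2 + 2 * (e / 4) = e]. *)
have [|g [gi cg] fg] := H (e / 4); first by rewrite divr_gt0.
have e2 : 0 < e / 2 by rewrite divr_gt0.
move/(ge0_cvg0P (fun k => Osc_ge0 (rounds k) g Q)) : cg => /(_ _ e2).
apply: filterS => k gk.
by apply: (le_trans (Osc_le _ ndQ fi gi)); lra.
Qed.

(** Dominated convergence turns bounded pointwise limits on a box into L^1 limits. This is what
    closes the class of sets below under countable unions. *)
Lemma vanish_lim Q f (g_ : nat -> rV -> R) : proper_box Q ->
  (forall n x, bx Q x -> `|g_ n x| <= 1) ->
  (forall x, bx Q x -> g_ n x @[n --> \oo] --> f x) ->
  (forall n, vanish Q (g_ n)) -> vanish Q f.
Proof.
move=> ndQ g1 gf vg; have mQ := measurable_bx Q.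
have mg n : measurable_fun (bx Q : set LT) (g_ n).
  by have [gi _] := vg n; exact: integrable_measurable gi.
have i1 := integrable_cst_bx 1 ndQ.
have [fi _] := dominated_cvg_Rintegral mQ mg gf i1 g1.
apply: vanish_approx => // e e0.
have i2 := integrable_cst_bx 2 ndQ.
have f1 x : bx Q x -> `|f x| <= 1.
  move=> Qx; apply: (cvgr_to_le (cvg_norm (gf x Qx))).
  by apply: nearW => n; exact: g1.
have mf := integrable_measurable fi.
have [n|x Qx||n x Qx|_] := @dominated_cvg_Rintegral _ _ R mu (bx Q)
    (fun n x => `|f x - g_ n x|) (fun=> 0) (cst 2) mQ.
- by apply: (measurableT_comp (@normr_measurable R setT)); exact: measurable_funB.
- rewrite -[X in _ --> X](@normr0 R R) -(subrr (f x)).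
  by apply: cvg_norm; apply: cvgB; [exact: cvg_cst|exact: gf].
- exact: i2.
- rewrite normr_id (le_trans (ler_normB _ _))//.
  by rewrite /cst /= -[leRHS](_ : 1 + 1 = 2 :> R)// lerD ?f1 ?g1.
rewrite Rintegral_cst// mul0r => /ge0_cvg0P H.
have [n _ /(_ n (leqnn n)) fg] := H (fun n => Rintegral_ge0 mu (fun x _ => normr_ge0 _)) _ e0.
by exists (g_ n).
Qed.

Lemma squeeze_vanish Q f (u : nat -> R) : mu.-integrable (bx Q) (EFin \o f) ->
  (forall k, Osc (rounds k) f Q <= u k) -> u k @[k --> \oo] --> (0 : R) ->
  vanish Q f.
Proof.
move=> fi fu u0; split => //.
apply: (@squeeze_cvgr _ _ _ _ (fun=> 0) u) => //; last exact: cvg_cst.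
by apply: nearW => k; rewrite Osc_ge0 fu.
Qed.

Lemma vanishD Q f g : proper_box Q -> vanish Q f -> vanish Q g ->
  vanish Q (fun x => f x + g x).
Proof.
move=> ndQ [fi vf] [gi vg]; have mQ := measurable_bx Q.
have fgi := integrableD mQ fi gi.
apply: (@squeeze_vanish _ _ (fun k => Osc (rounds k) f Q + Osc (rounds k) g Q)) => //.
  move=> k; rewrite -big_split/=; apply: ler_leaves => // P ndP PQ _.
  have mP := measurable_bx P.
  have {}fi := integrable_subbox PQ fi; have {}gi := integrable_subbox PQ gi.
  have i1 := integrable_normr (integrable_subc (mean f P) ndP fi).
  have i2 := integrable_normr (integrable_subc (mean g P) ndP gi).
  have i3 := integrable_normr (integrable_subc (mean (fun x => f x + g x) P) ndP (integrable_subbox PQ fgi)).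
  rewrite /osc -RintegralD//; apply: (le_Rintegral mP i3 (integrableD mP i1 i2)).
  move=> x _; rewrite /mean RintegralD// mulrDl opprD addrACA.
  exact: ler_normD.
by rewrite -[X in _ --> X](addr0 0); exact: (cvgD vf vg).
Qed.

Lemma vanishZ Q f (c : R) : proper_box Q -> vanish Q f ->
  vanish Q (fun x => c * f x).
Proof.
move=> ndQ [fi vf]; have mQ := measurable_bx Q.
apply: (@squeeze_vanish _ _ (fun k => `|c| * Osc (rounds k) f Q)).
- exact: (integrableZl mQ c fi).
- move=> k; rewrite mulr_sumr; apply: ler_leaves => // P ndP PQ _.
  have mP := measurable_bx P; have {}fi := integrable_subbox PQ fi.
  rewrite /osc -RintegralZl//; last exact/integrable_normr/integrable_subc.
  rewrite le_eqVlt; apply/orP; left; apply/eqP/eq_Rintegral => x _.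
  by rewrite /mean RintegralZl// -mulrA -mulrBr normrM.
- by rewrite -[X in _ --> X](mulr0 `|c|); apply: cvgM vf; exact: cvg_cst.
Qed.

Lemma vanish_cst Q (c : R) : proper_box Q -> vanish Q (fun=> c).
Proof.
move=> ndQ; apply: (@squeeze_vanish _ _ (fun=> 0)); last exact: cvg_cst.
  exact: integrable_cst_bx.
move=> k; rewrite -[leRHS](@big1_eq R 0 +%R _ (leaves (rounds k) Q) xpredT).
apply: ler_leaves => // P ndP PQ _.
apply: (le_trans (osc_le_cst c ndP (integrable_cst_bx c ndP))).
under eq_Rintegral do rewrite subrr normr0.
by rewrite (Rintegral_cst_bx _ ndP) mul0r mulr0.
Qed.

(** On a leaf [P], the product is compared with [mean f P * mean g P]; as [|mean f P|] and [|g|] are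
    at most 1, the difference is at most the sum of the deviations of the factors. *)
Lemma vanishM Q f g : proper_box Q -> vanish Q f -> vanish Q g ->
  (forall x, bx Q x -> `|f x| <= 1) -> (forall x, bx Q x -> `|g x| <= 1) ->
  vanish Q (fun x => f x * g x).
Proof.
move=> ndQ [fi vf] [gi vg] f1 g1; have mQ := measurable_bx Q.
have fgi : mu.-integrable (bx Q) (EFin \o (fun x => f x * g x)).
  apply: (@bounded_integrable _ _ Q (fun x => f x * g x) 1 ndQ).
    exact: (measurable_funM (integrable_measurable fi) (integrable_measurable gi)).
  by move=> x Qx; rewrite normrM mulr_ile1// ?f1 ?g1.
apply: (@squeeze_vanish _ _ (fun k => 2 * (Osc (rounds k) f Q + Osc (rounds k) g Q))) => //.
  move=> k; rewrite -big_split/= mulr_sumr; apply: ler_leaves => // P ndP PQ _.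
  have mP := measurable_bx P.
  have {}fi := integrable_subbox PQ fi; have {}gi := integrable_subbox PQ gi.
  have {}fgi := integrable_subbox PQ fgi.
  apply: (le_trans (osc_le_cst (mean f P * mean g P) ndP fgi)).
  rewrite ler_pM2l// /osc.
  have i1 := integrable_normr (integrable_subc (mean f P) ndP fi).
  have i2 := integrable_normr (integrable_subc (mean g P) ndP gi).
  have i3 := integrable_normr (integrable_subc (mean f P * mean g P) ndP fgi).
  have fP1 : `|mean f P| <= 1.
    rewrite /mean normrM normfV (gtr0_norm (vol_gt0 ndP)) ler_pdivrMr ?vol_gt0//.
    apply: (le_trans (le_normr_Rintegral mP fi)).
    rewrite -(Rintegral_cst_bx _ ndP); apply: le_Rintegral => //.
    - exact: integrable_normr.
    - exact: integrable_cst_bx.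
    by move=> x Px; apply/f1/(subbox_sub PQ).
  rewrite -RintegralD//; apply: (le_Rintegral mP i3 (integrableD mP i1 i2)).
  move=> x Px; have gx : `|g x| <= 1 by apply/g1/(subbox_sub PQ).
  rewrite (_ : f x * g x - _ = (f x - mean f P) * g x + mean f P * (g x - mean g P)); last by ring.
  rewrite (le_trans (ler_normD _ _))// (normrM (f x - mean f P)) (normrM (mean f P)).
  by apply: lerD; [exact: ler_piMr|exact: ler_piMl].
rewrite [X in _ --> X](_ : 0 = 2 * (0 + 0) :> R); last by rewrite addr0 mulr0.
by apply: cvgM; [exact: cvg_cst|exact: (cvgD vf vg)].
Qed.

(** On a leaf of [k] rounds the coordinate varies by at most [side Q j / 2 ^ k], and the volumes of
    the leaves add up to [vol Q]. *)
Lemma vanish_lipschitz_coord Q (th : R -> R) (j : 'I_N) (K : R) : proper_box Q ->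
  measurable_fun setT th -> (forall t, `|th t| <= 1) -> 0 <= K ->
  (forall s t, `|th s - th t| <= K * `|s - t|) ->
  vanish Q (fun x => th (x ord0 j)).
Proof.
move=> ndQ mth th1 K0 thK; have mQ := measurable_bx Q.
have fi : mu.-integrable (bx Q) (EFin \o (fun x : rV => th (x ord0 j))).
  apply: (@bounded_integrable _ _ Q (fun x => th (x ord0 j)) 1 ndQ) => [|x _].
    by apply: (measurableT_comp mth); exact: measurable_coord.
  exact: th1.
apply: (@squeeze_vanish _ _ (fun k => (2 * K * side Q j * vol Q) * (1 / 2) ^+ k)) => //.
  move=> k; have -> : 2 * K * side Q j * vol Q * (1 / 2) ^+ k =
      \int[mu]_(x in bx Q) (2 * K * side Q j * (1 / 2) ^+ k).
    by rewrite (Rintegral_cst_bx _ ndQ); ring.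
  rewrite (Rintegral_leaves (rounds k) ndQ); last exact: integrable_cst_bx.
  apply: ler_leaves => // P ndP PQ dP.
  apply: (le_trans (osc_le_cst (th (P.1 ord0 j)) ndP (integrable_subbox PQ fi))).
  have mP := measurable_bx P.
  apply: (@le_trans _ _ (2 * \int[mu]_(x in bx P) (K * side P j))).
    rewrite ler_pM2l//; apply: (le_Rintegral mP).
    - exact/integrable_normr/integrable_subc/integrable_subbox/fi.
    - exact: integrable_cst_bx.
    move=> x Px; apply: (le_trans (thK _ _)); rewrite ler_wpM2l// /side.
    have := Px j; rewrite in_itv/= => /andP[x1 x2].
    by rewrite ger0_norm ?subr_ge0 ?(ltW x1)// lerD2r.
  rewrite !(Rintegral_cst_bx _ ndP) dP count_rounds expr_div_n expr1n.
  by rewrite le_eqVlt; apply/orP; left; apply/eqP; ring.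
rewrite -[X in _ --> X](mulr0 (2 * K * side Q j * vol Q)).
apply: cvgM; first exact: cvg_cst.
by apply: cvg_expr; rewrite ger0_norm; lra.
Qed.

End step_density.

Section step_density_all.
Context {R : realType} {N : nat}.
Local Notation mu := (@lebesgue R N).
Local Notation LT := (lebesgue_type R N).
Local Notation rV := 'rV[R]_N.
Implicit Types (x : rV) (Q : rV * rV) (f g : rV -> R) (X Y : set rV).

(** These sets form a sigma-algebra. It contains the half-spaces bounded in one coordinate, hence
    the preimages of all measurable sets of tuples. *)
Definition vset Q X := measurable (X : set LT) /\ vanish Q (\1_X : rV -> R).

Lemma normr_indic_le1 X x : `|\1_X x : R| <= 1.
Proof. by rewrite indicE; case: (_ \in _); rewrite ?normr1 ?normr0. Qed.

Lemma vsetC Q X : proper_box Q -> vset Q X -> vset Q (~` X).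
Proof.
move=> ndQ [mX vX]; split; first exact: measurableC.
have := vanishD ndQ (vanish_cst 1 ndQ) (vanishZ (-1) ndQ vX).
congr (vanish Q _); apply/funext => x; rewrite !indicE in_setC.
by case: (_ \in _); rewrite /= ?mulr1 ?mulr0 ?subrr ?addr0.
Qed.

Lemma vsetI Q X Y : proper_box Q -> vset Q X -> vset Q Y -> vset Q (X `&` Y).
Proof.
move=> ndQ [mX vX] [mY vY]; split; first exact: measurableI.
have := vanishM ndQ vX vY (fun x _ => normr_indic_le1 X x) (fun x _ => normr_indic_le1 Y x).
by congr (vanish Q _); apply/funext => x; rewrite indicI.
Qed.

Lemma vset0 Q : proper_box Q -> vset Q set0.
Proof.
move=> ndQ; split; first exact: measurable0.
have := vanish_cst 0 ndQ.
by congr (vanish Q _); apply/funext => x; rewrite indic0.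
Qed.

Lemma vset_bigcup Q (F : nat -> set rV) : proper_box Q ->
  (forall n, vset Q (F n)) -> vset Q (\bigcup_n F n).
Proof.
move=> ndQ vF; split; first by apply: bigcupT_measurable => n; have [] := vF n.
pose G n := \big[setU/set0]_(k < n) F k.
have vG n : vset Q (G n).
  rewrite /G; elim: n => [|n IH]; first by rewrite big_ord0; exact: vset0.
  rewrite big_ord_recr/= -[X in vset Q X]setCK setCU.
  exact: (vsetC ndQ (vsetI ndQ (vsetC ndQ IH) (vsetC ndQ (vF n)))).
apply: (@vanish_lim _ _ Q _ (fun n => \1_(G n)) ndQ).
- by move=> n x _; exact: normr_indic_le1.
- move=> x _; rewrite indicE; have [|nF] := boolP (x \in _).
    rewrite inE => -[m _ Fm]; apply: cvg_near_cst.
    exists m.+1 => // n /= mn; rewrite indicE mem_set// /G -bigcup_mkord.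
    by exists m.
  apply: cvg_near_cst; apply: nearW => n; rewrite indicE memNset//.
  rewrite /G -bigcup_mkord => -[m _ Fm].
  by move: nF; rewrite notin_setE; apply; exists m.
- by move=> n; have [] := vG n.
Qed.

Lemma sigma_algebra_vset Q (T : Type) (p : rV -> T) : proper_box Q ->
  sigma_algebra setT [set B : set T | vset Q (p @^-1` B)].
Proof.
move=> ndQ; split => /=.
- by rewrite preimage_set0; exact: vset0.
- by move=> A vA; rewrite setTD; exact: vsetC.
- by move=> A vA; rewrite preimage_bigcup; exact: vset_bigcup.
Qed.

Definition ramp (n : nat) (c t : R) : R := Num.min 1 (Num.max 0 (n%:R * (t - c))).

Lemma ramp_norm n c t : `|ramp n c t| <= 1.
Proof.
rewrite /ramp; case: (leP 1 _) => h; first by rewrite normr1.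
by rewrite ger0_norm ?le_max ?lexx// ltW.
Qed.

Lemma ramp_lipschitz n c s t : `|ramp n c s - ramp n c t| <= n%:R * `|s - t|.
Proof.
have -> : n%:R * `|s - t| = `|n%:R * (s - c) - n%:R * (t - c)|.
  by rewrite -mulrBr normrM normr_nat; congr (_ * `|_|); ring.
rewrite /ramp; move: (n%:R * (s - c)) (n%:R * (t - c)) => u v.
have hmax (a b : R) : `|Num.max 0 a - Num.max 0 b| <= `|a - b|.
  have h1 := ler_norm (a - b); have := ler_norm (b - a); rewrite distrC => h2.
  by rewrite ler_norml; case: (leP 0 a) => ?; case: (leP 0 b) => ?; apply/andP; split; lra.
have hmin (a b : R) : `|Num.min 1 a - Num.min 1 b| <= `|a - b|.
  have h1 := ler_norm (a - b); have := ler_norm (b - a); rewrite distrC => h2.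
  by rewrite ler_norml; case: (leP 1 a) => ?; case: (leP 1 b) => ?; apply/andP; split; lra.
exact: le_trans (hmin _ _) (hmax _ _).
Qed.

Lemma measurable_ramp n c : measurable_fun setT (ramp n c).
Proof.
apply: continuous_measurable_fun => t.
apply/cvgrPdist_lt => e e0; near=> s.
rewrite (le_lt_trans (ramp_lipschitz _ _ _ _))//.
rewrite (@le_lt_trans _ _ ((n%:R + 1) * `|t - s|))//.
  by rewrite ler_wpM2r// lerDl.
rewrite mulrC -ltr_pdivlMr ?ltr_wpDl//.
near: s; apply: cvgr_dist_lt => //; by rewrite divr_gt0// ltr_wpDl.
Unshelve. all: by end_near. Qed.

Lemma cvg_ramp c t : ramp n c t @[n --> \oo] --> (\1_(`]c, +oo[%classic) t : R).
Proof.
rewrite indicE mem_setE in_itv/= andbT; apply: cvg_near_cst.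
have [ct|tc] := ltP c t; last first.
  apply: nearW => n; rewrite /ramp (max_idPl _) ?min_r//.
  by rewrite mulr_ge0_le0// subr_le0.
have tc0 : 0 < t - c by rewrite subr_gt0.
near=> n; rewrite /ramp min_l// le_max; apply/orP; right.
rewrite -ler_pdivrMr// div1r.
by near: n; exact: nbhs_infty_ger.
Unshelve. all: by end_near. Qed.

Lemma vset_ray Q (j : 'I_N) (c : R) : proper_box Q ->
  vset Q ((fun x : rV => x ord0 j) @^-1` `]c, +oo[).
Proof.
move=> ndQ; split.
  have h := @measurable_coord R N setT j.
  by rewrite -[X in measurable X]setTI; apply: h.
apply: (@vanish_lim _ _ Q _ (fun n x => ramp n c (x ord0 j)) ndQ).
- by move=> n x _; exact: ramp_norm.
- by move=> x _; exact: cvg_ramp.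
- move=> n; exact: (vanish_lipschitz_coord j ndQ (measurable_ramp n c) (ramp_norm n c)
    (ler0n R n) (ramp_lipschitz n c)).
Qed.

Lemma vset_coord Q (j : 'I_N) (B : set (measurableTypeR R)) : proper_box Q -> measurable B ->
  vset Q ((fun x : rV => x ord0 j) @^-1` B).
Proof.
move=> ndQ; rewrite RGenOInfty.measurableE.
have sub := @smallest_sub _ (sigma_algebra setT) (@RGenOInfty.G R) _
  (sigma_algebra_vset (fun x : rV => x ord0 j) ndQ).
by apply: sub => _ [c ->]; exact: vset_ray.
Qed.

Lemma vset_tuple Q (B : set (N.-tuple (measurableTypeR R))) : proper_box Q -> measurable B ->
  vset Q (@rV_tuple R N @^-1` B).
Proof.
move=> ndQ; have sub := @smallest_sub _ (sigma_algebra setT) _ _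
  (sigma_algebra_vset (@rV_tuple R N) ndQ).
apply: sub; apply: (big_ind (fun S => S `<=` _)) => [C []|S S' h h' C [/h|/h']|i _ C [D mD <-]] //=.
have := vset_coord i ndQ mD; congr (vset Q _).
apply/seteqP; split => [x Dx|x [_ /=]]; last by rewrite tnth_mktuple.
by split => //=; rewrite tnth_mktuple.
Qed.

(** Lebesgue sets need not come from measurable sets of tuples, but the outer measure is an infimum
    over covers by such sets: some cover [U] of [X] in the box exceeds it by measure at most [e],
    and [vset_tuple] applies to its members. *)
Lemma vanish_indic Q X : proper_box Q -> measurable (X : set LT) ->
  vanish Q (\1_X : rV -> R).
Proof.
move=> ndQ mX; have mQ := measurable_bx Q.
apply: (vanish_approx ndQ).
  apply: (@bounded_integrable _ _ Q _ 1 ndQ) => [|x _]; last exact: normr_indic_le1.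
  exact: measurable_indic.
move=> e e0.
pose XQ := X `&` bx Q.
have mXQ : measurable (XQ : set LT) by exact: measurableI.
have fXQ : mu XQ \is a fin_num.
  rewrite ge0_fin_numE; last exact: measure_ge0.
  apply: (@le_lt_trans _ _ (mu (bx Q))); last by rewrite (mu_bx ndQ) ltry.
  by apply: le_measure; rewrite ?inE// => x [].
have [s [F [mF FX] <-] Fe] := lb_ereal_inf_adherent e0 fXQ.
pose U := \bigcup_k (@rV_tuple R N @^-1` F k).
have [mU vU] : vset Q U.
  by apply: (vset_bigcup ndQ) => k; exact: (vset_tuple ndQ (mF k)).
exists (\1_U); first exact: vU.
have XU : XQ `<=` U.
  move=> x XQx; have [|k _ Fk] := FX (rV_tuple x); first by exists x.
  by exists k.
have mDif : measurable (U `\` XQ : set LT) by exact: measurableD.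
have UX : (mu (U `\` XQ) <= e%:E)%E.
  have mUe : (mu U < mu XQ + e%:E)%E.
    apply: le_lt_trans Fe; apply: le_trans (measure_sigma_subadditive _ _ _ _) _.
    - by move=> k; rewrite -[X in measurable X]setTI; exact: measurable_rV_tuple.
    - exact: mU.
    - exact: subset_refl.
    apply: lee_nneseries => [k _ _|k _]; first exact: measure_ge0.
    rewrite -(measurable_mu_extE (tuple_lebesgue N) (mF k)).
    by apply: le_outer_measure => _ [x Fx <-].
  have mUfin : (mu U < +oo)%E by apply: lt_trans mUe _; rewrite lte_add_pinfty ?ltry// -ge0_fin_numE.
  have mD := measureD mU mXQ mUfin.
  rewrite (setIidr XU) in mD; rewrite [X in (X <= _)%E]mD.
  by rewrite leeBlDr// addeC ltW.
have i1 : mu.-integrable (bx Q) (EFin \o (fun x => `|\1_X x - \1_U x : R|)).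
  apply: (@bounded_integrable _ _ Q _ 1 ndQ) => [|x _].
    apply: (measurableT_comp (@normr_measurable R setT)).
    by apply: measurable_funB; exact: measurable_indic.
  rewrite normr_id !indicE; do 2![case: (_ \in _)]; by rewrite ?subrr ?subr0 ?sub0r ?normrN ?normr0 ?normr1.
have mUX : measurable (U `\` XQ : set LT) by exact: measurableD.
have i2 : mu.-integrable (bx Q) (EFin \o (\1_(U `\` XQ) : rV -> R)).
  apply: (@bounded_integrable _ _ Q _ 1 ndQ) => [|x _]; last exact: normr_indic_le1.
  exact: measurable_indic.
apply: (@le_trans _ _ (\int[mu]_(x in bx Q) \1_(U `\` XQ) x)).
  apply: le_Rintegral => // x Qx.
  have UXx : X x -> U x by move=> Xx; apply: XU; split.
  rewrite !indicE; have [Xx|nXx] := boolP (x \in X).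
    by rewrite mem_set ?subrr ?normr0//; apply/UXx/set_mem.
  rewrite sub0r normrN ger0_norm// ler_nat in_setD.
  by case: (x \in U) => //=; rewrite memNset// => -[/mem_set]; rewrite (negbTE nXx).
rewrite -lee_fin /Rintegral fineK; last exact: integrable_fin_num i2.
rewrite integral_indic//; apply: le_trans UX; apply: le_measure; rewrite ?inE//.
exact: measurableI.
Qed.

Import HBSimple.

(** Linearity extends the result from indicators to simple functions, and their density in L^1 does
    the rest. *)
Lemma vanish_integrable Q f : proper_box Q -> mu.-integrable (bx Q) (EFin \o f) ->
  vanish Q f.
Proof.
move=> ndQ fi; have mQ := measurable_bx Q.
have [g [gi _ gf]] := approximation_sfun_integrable mQ fi.
apply: (vanish_approx ndQ fi) => e e0.
have vg n : vanish Q (fun x => g n x).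
  rewrite (_ : (fun x => g n x) = fun x : LT => \sum_(y <- finmap.enum_fset (fset_set (range (g n))))
      (y * \1_((fun x => g n x) @^-1` [set y]) x)); last first.
    by apply/funext => x; rewrite fimfunE fsbig_finite.
  elim: (finmap.enum_fset _) => [|y s IH].
    by under eq_fun do rewrite big_nil; exact: vanish_cst.
  under eq_fun do rewrite big_cons.
  apply: (vanishD ndQ _ IH); apply: (vanishZ y ndQ); apply: (vanish_indic ndQ).
  exact: (measurable_funPTI (g n) (measurable_set1 y)).
have /fine_cvgP[_ /ge0_cvg0P gf'] := gf.
have [n _ /(_ n (leqnn n)) ge] := gf' (fun n => fine_ge0 (integral_ge0 mu (fun x _ => abse_ge0 _))) _ e0.
by exists (fun x => g n x).
Qed.

End step_density_all.

(** * Bisection estimates for weakly differentiable functions *)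

Section poincare.
Context {R : realType} {N : nat}.
Local Notation mu := (@lebesgue R N).
Local Notation LT := (lebesgue_type R N).
Local Notation rV := 'rV[R]_N.
Implicit Types (x : rV) (Q P : rV * rV) (f v : rV -> R) (Om : set rV).

(** The margin is added at the upper faces alone, as the bumps never cross the lower ones. *)
Definition collar (rho : R) Q : set rV := cbox Q.1 (Q.2 + const_mx rho).
Definition perimeter Q : R := \sum_(i < N) side Q i.

Lemma measurable_collar rho Q : measurable (collar rho Q : set LT).
Proof. exact: measurable_cbox. Qed.

Lemma collar_subbox rho P Q : subbox P Q -> collar rho P `<=` collar rho Q.
Proof.
move=> PQ x xP i; have [h1 h2] := PQ i; have := xP i; rewrite !in_itv/= !mxE.
by move=> /andP[x1 x2]; rewrite (le_trans h1 x1) (le_trans x2)// lerD2r.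
Qed.

Lemma bx_sub_collar rho Q : 0 < rho -> bx Q `<=` collar rho Q.
Proof.
move=> r0 x /box_sub_cbox; apply: cbox_subr => i.
by rewrite !mxE lerDl ltW.
Qed.

Lemma integrable_collar rho Q f : 0 < rho ->
  mu.-integrable (collar rho Q) (EFin \o f) -> mu.-integrable (bx Q) (EFin \o f).
Proof.
move=> r0; apply: integrableS; [exact: measurable_collar|exact: measurable_bx|].
exact: bx_sub_collar.
Qed.

Lemma integrable_collar_sub rho P Q f : subbox P Q ->
  mu.-integrable (collar rho Q) (EFin \o f) -> mu.-integrable (collar rho P) (EFin \o f).
Proof.
move=> PQ; apply: integrableS; [exact: measurable_collar|exact: measurable_collar|].
exact: collar_subbox.
Qed.

Lemma vol_half (j : 'I_N) Q P :
  (forall i, side P i = if i == j then side Q i / 2 else side Q i) ->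
  vol P = vol Q / 2.
Proof.
move=> sP; rewrite /vol (bigD1 j)//= [in RHS](bigD1 j)//= sP eqxx mulrAC.
by congr (_ * _ / 2); apply: eq_bigr => i /negbTE ij; rewrite sP ij.
Qed.

Lemma perimeter_half (j : 'I_N) Q P :
  (forall i, side P i = if i == j then side Q i / 2 else side Q i) ->
  perimeter P = perimeter Q - side Q j / 2.
Proof.
move=> sP; rewrite /perimeter (bigD1 j)//= [in RHS](bigD1 j)//= sP eqxx.
rewrite (eq_bigr (side Q)); last by move=> i /negbTE ij; rewrite sP ij.
lra.
Qed.

Lemma perimeter_ge0 Q : proper_box Q -> 0 <= perimeter Q.
Proof. by move=> ndQ; apply: sumr_ge0 => i _; apply/ltW/side_gt0. Qed.

Lemma dist_cst_le_osc P v (c : R) : proper_box P -> mu.-integrable (bx P) (EFin \o v) ->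
  \int[mu]_(x in bx P) `|v x - c| <= osc v P + `|mean v P - c| * vol P.
Proof.
move=> ndP vi; have mP := measurable_bx P.
have i0 := integrable_normr (integrable_subc c ndP vi).
have i1 := integrable_normr (integrable_subc (mean v P) ndP vi).
have i2 := integrable_cst_bx `|mean v P - c| ndP.
rewrite -(Rintegral_cst_bx _ ndP) /osc -RintegralD//.
apply: (le_Rintegral mP i0 (integrableD mP i1 i2)) => x _.
by rewrite (_ : v x - c = (v x - mean v P) + (mean v P - c)) ?ler_normD//; ring.
Qed.

(** If [a] and [b] are the integrals over the halves, their means deviate from [mean v Q] by
    [(a - b) / vol Q] and its opposite; each deviation is integrated over the volume [vol Q / 2]. *)
Lemma osc_bisect Q v (j : 'I_N) : proper_box Q -> mu.-integrable (bx Q) (EFin \o v) ->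
  osc v Q <= osc v (lo Q j) + osc v (hi Q j) +
    `|\int[mu]_(x in bx (lo Q j)) v x - \int[mu]_(x in bx (hi Q j)) v x|.
Proof.
move=> ndQ vi; have v0 := vol_gt0 ndQ.
have ndl := proper_box_lo j ndQ; have ndh := proper_box_hi j ndQ.
have il := integrable_subbox (subbox_lo j ndQ) vi.
have ih := integrable_subbox (subbox_hi j ndQ) vi.
have vl := vol_half (side_lo Q j); have vh := vol_half (side_hi Q j).
rewrite {1}/osc (Rintegral_split j ndQ); last exact/integrable_normr/integrable_subc.
have hl := dist_cst_le_osc (mean v Q) ndl il.
have hh := dist_cst_le_osc (mean v Q) ndh ih.
apply: (le_trans (lerD hl hh)).
rewrite addrACA lerD2l.
set a := \int[mu]_(x in bx (lo Q j)) v x; set b := \int[mu]_(x in bx (hi Q j)) v x.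
have ml : mean v (lo Q j) - mean v Q = (a - b) / vol Q.
  by rewrite /mean (Rintegral_split j ndQ vi) vl -/a -/b; field; rewrite gt_eqF.
have mh : mean v (hi Q j) - mean v Q = - ((a - b) / vol Q).
  by rewrite /mean (Rintegral_split j ndQ vi) vh -/a -/b; field; rewrite gt_eqF.
rewrite ml mh vl vh normrN normrM normfV (gtr0_norm v0) le_eqVlt.
by apply/orP; left; apply/eqP; field; rewrite gt_eqF.
Qed.

Lemma integrable_sum_normr (D : set rV) (g : 'I_N -> rV -> R) :
  measurable (D : set LT) -> (forall j, mu.-integrable D (EFin \o g j)) ->
  mu.-integrable D (EFin \o (fun x => \sum_(j < N) `|g j x|)).
Proof.
move=> mD gi; rewrite (_ : _ \o _ = (fun x => \sum_(j < N) (`|g j x|)%:E)%E).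
  by apply: (integrable_sum mD) => i _; exact: (integrable_normr (gi i)).
by apply/funext => x /=; rewrite sumEFin.
Qed.

(* The perimeter of a box exceeds that of its halves by exactly the length paid
   for the bisection, so the errors of successive bisections telescope. *)
Lemma osc_le_Osc Om rho Q v (g : 'I_N -> rV -> R) js :
  measurable (Om : set LT) -> 0 < rho -> proper_box Q ->
  collar rho Q `<=` Om -> mu.-integrable Om (EFin \o v) ->
  (forall j, mu.-integrable (collar rho Q) (EFin \o g j)) ->
  (forall j, weak_partial Om v (g j) j) ->
  osc v Q <= Osc js v Q +
    perimeter Q * \int[mu]_(x in bx Q) (\sum_(j < N) `|g j x|).
Proof.
move=> mOm r0 + + vi + wp; elim: js Q => [|j js IH] Q ndQ sub gi.
  rewrite /Osc/= big_seq1 lerDl mulr_ge0//; first exact: perimeter_ge0.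
  by apply: Rintegral_ge0 => x _; exact: sumr_ge0.
have mQ := measurable_bx Q.
have vQ : mu.-integrable (bx Q) (EFin \o v).
  apply: (integrableS mOm mQ) vi => x /(bx_sub_collar r0); exact: sub.
have ndl := proper_box_lo j ndQ; have ndh := proper_box_hi j ndQ.
have sl := subbox_lo j ndQ; have sh := subbox_hi j ndQ.
have igQ i := integrable_collar r0 (gi i).
have iG := integrable_sum_normr mQ igQ.
have il := IH _ ndl (subset_trans (collar_subbox sl) sub) (fun i => integrable_collar_sub sl (gi i)).
have ih := IH _ ndh (subset_trans (collar_subbox sh) sub) (fun i => integrable_collar_sub sh (gi i)).
have half := half_integrals mOm r0 (ndQ j) sub vi (gi j) (wp j).
apply: (le_trans (osc_bisect j ndQ vQ)).
rewrite [Osc (j :: js) v Q](_ : _ = Osc js v (lo Q j) + Osc js v (hi Q j)); last by rewrite /Osc/= big_cat.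
rewrite (perimeter_half (side_lo Q j)) in il.
rewrite (perimeter_half (side_hi Q j)) in ih.
have gG : \int[mu]_(x in bx Q) `|g j x| <= \int[mu]_(x in bx Q) (\sum_(j < N) `|g j x|).
  apply: (le_Rintegral mQ (integrable_normr (igQ j)) iG) => x _.
  by rewrite (bigD1 j)//= lerDl sumr_ge0.
have h0 : 0 < side Q j / 2 by rewrite divr_gt0// side_gt0.
move: half gG; rewrite -/(side Q j) -/(bx (lo Q j)) -/(bx (hi Q j)) -/(bx Q) => half gG.
have := le_trans half (ler_wpM2l (ltW h0) gG).
rewrite (Rintegral_split j ndQ iG); move: il ih; clear; lra.
Qed.

(** Let the number of rounds tend to infinity in [osc_le_Osc]: the oscillation on the leaves
    disappears and the telescoped gradient term stays. *)
Lemma osc_poincare Om rho Q v (g : 'I_N -> rV -> R) :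
  measurable (Om : set LT) -> 0 < rho -> proper_box Q ->
  collar rho Q `<=` Om -> mu.-integrable Om (EFin \o v) ->
  (forall j, mu.-integrable (collar rho Q) (EFin \o g j)) ->
  (forall j, weak_partial Om v (g j) j) ->
  osc v Q <= perimeter Q * \int[mu]_(x in bx Q) (\sum_(j < N) `|g j x|).
Proof.
move=> mOm r0 ndQ sub vi gi wp.
have vQ : mu.-integrable (bx Q) (EFin \o v).
  apply: (integrableS mOm (measurable_bx Q)) vi => x /(bx_sub_collar r0); exact: sub.
have [_ v0] := vanish_integrable ndQ vQ.
rewrite -[leRHS]add0r.
set c := perimeter Q * _.
apply: (cvgr_to_ge (cvgD v0 (cvg_cst c))).
by apply: nearW => k; exact: (osc_le_Osc (rounds k) mOm r0 ndQ sub vi gi wp).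
Qed.

(** The mean of [g] is zero on every leaf, so [Osc (rounds k) g Q] is the L^1 norm of [g] for every
    [k], while it tends to 0. *)
Lemma null_of_weak_null Om rho Q (g : rV -> R) : 0 < rho -> proper_box Q ->
  collar rho Q `<=` Om -> mu.-integrable (collar rho Q) (EFin \o g) ->
  (forall psi, test_function Om psi -> \int[mu]_(x in Om) (g x * psi x) = 0) ->
  \int[mu]_(x in bx Q) `|g x| = 0.
Proof.
move=> r0 ndQ sub gi g0; have gQ := integrable_collar r0 gi.
have [_ v0] := vanish_integrable ndQ gQ.
apply/esym; apply: (cvg_unique (@norm_hausdorff _ R^o) v0).
rewrite (_ : (fun k => _) = fun=> \int[mu]_(x in bx Q) `|g x|); first exact: cvg_cst.
apply/funext => k; rewrite (Rintegral_leaves (rounds k) ndQ (integrable_normr gQ)).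
rewrite /Osc big_seq [RHS]big_seq; apply: eq_bigr => P PQ.
have [ndP sP _] := leavesP ndQ PQ.
have m0 : mean g P = 0.
  rewrite /mean (box_integral_eq0 r0 _ (integrable_collar_sub sP gi) g0) ?mul0r//.
  exact: subset_trans (collar_subbox sP) sub.
by rewrite /osc; apply: eq_Rintegral => x _; rewrite m0 subr0.
Qed.

Lemma dist_le_osc P f v : proper_box P ->
  mu.-integrable (bx P) (EFin \o f) -> mu.-integrable (bx P) (EFin \o v) ->
  \int[mu]_(x in bx P) `|f x - v x| <= osc f P + osc v P +
    `|\int[mu]_(x in bx P) f x - \int[mu]_(x in bx P) v x|.
Proof.
move=> ndP fi vi; have mP := measurable_bx P.
have i0 := integrable_normr (integrableB mP fi vi).
have i1 := integrable_normr (integrable_subc (mean f P) ndP fi).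
have i2 := integrable_normr (integrable_subc (mean v P) ndP vi).
have i3 := integrable_cst_bx `|mean f P - mean v P| ndP.
have -> : `|\int[mu]_(x in bx P) f x - \int[mu]_(x in bx P) v x| =
    \int[mu]_(x in bx P) `|mean f P - mean v P|.
  rewrite (Rintegral_cst_bx _ ndP) /mean -mulrBl normrM normfV (gtr0_norm (vol_gt0 ndP)).
  by rewrite divfK// gt_eqF// vol_gt0.
have i12 := integrableD mP i1 i2.
rewrite /osc -RintegralD// -RintegralD//.
apply: (le_Rintegral mP i0 (integrableD mP i12 i3)) => x _.
rewrite (_ : f x - v x = (f x - mean f P) - (v x - mean v P) + (mean f P - mean v P)); last by ring.
by rewrite (le_trans (ler_normD _ _))// lerD2r ler_normB.
Qed.

(** Poincare's inequality on each leaf, whose perimeter is that of [Q] divided by [2 ^ k]. The decay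
    depends on [v] only through the L^1 norm of its gradient. *)
Lemma Osc_rounds_le Om rho Q v (g : 'I_N -> rV -> R) k :
  measurable (Om : set LT) -> 0 < rho -> proper_box Q ->
  collar rho Q `<=` Om -> mu.-integrable Om (EFin \o v) ->
  (forall j, mu.-integrable (collar rho Q) (EFin \o g j)) ->
  (forall j, weak_partial Om v (g j) j) ->
  Osc (rounds k) v Q <=
    perimeter Q * \int[mu]_(x in bx Q) (\sum_(j < N) `|g j x|) / 2 ^+ k.
Proof.
move=> mOm r0 ndQ sub vi gi wp; have mQ := measurable_bx Q.
have iG := integrable_sum_normr mQ (fun i => integrable_collar r0 (gi i)).
rewrite (Rintegral_leaves (rounds k) ndQ iG) mulr_sumr mulr_suml.
apply: ler_leaves => // P ndP PQ sP.
have subP := subset_trans (collar_subbox (rho := rho) PQ) sub.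
apply: (le_trans (osc_poincare mOm r0 ndP subP vi (fun i => integrable_collar_sub PQ (gi i)) wp)).
rewrite mulrAC ler_wpM2r//; first by apply: Rintegral_ge0 => x _; exact: sumr_ge0.
rewrite /perimeter mulr_suml le_eqVlt; apply/orP; left; apply/eqP.
by apply: eq_bigr => i _; rewrite sP count_rounds.
Qed.

(** On a sufficiently fine fixed grid, the [v_ n] and [v] are close to their averages uniformly in
    [n]; the finitely many averages converge by assumption. Each of the three errors gets
    [e / 3]. *)
Lemma strong_cvg_box Om rho Q (v_ : nat -> rV -> R) v (g : nat -> 'I_N -> rV -> R) (M : R) :
  measurable (Om : set LT) -> 0 < rho -> proper_box Q ->
  collar rho Q `<=` Om ->
  (forall n, mu.-integrable Om (EFin \o v_ n)) -> mu.-integrable Om (EFin \o v) ->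
  (forall n j, mu.-integrable (collar rho Q) (EFin \o g n j)) ->
  (forall n j, weak_partial Om (v_ n) (g n j) j) ->
  (forall n, \int[mu]_(x in bx Q) (\sum_(j < N) `|g n j x|) <= M) ->
  (forall P, proper_box P -> subbox P Q ->
    \int[mu]_(x in bx P) v_ n x @[n --> \oo] --> (\int[mu]_(x in bx P) v x : R)) ->
  \int[mu]_(x in bx Q) `|v_ n x - v x| @[n --> \oo] --> (0 : R).
Proof.
move=> mOm r0 ndQ sub vni vi gi wp gM vP; have mQ := measurable_bx Q.
have QOm : bx Q `<=` Om by move=> x /(bx_sub_collar r0); exact: sub.
have vnQ n := integrableS mOm mQ QOm (vni n).
have vQ := integrableS mOm mQ QOm vi.
apply/ge0_cvg0P => [n|e e0]; first by apply: Rintegral_ge0 => x _.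
have e3 : 0 < e / 3 by rewrite divr_gt0.
have [_ /ge0_cvg0P v0] := vanish_integrable ndQ vQ.
have {}v0 := v0 (fun k => Osc_ge0 _ _ _) _ e3.
have c0 : perimeter Q * M * (1 / 2) ^+ k @[k --> \oo] --> (0 : R).
  rewrite -[X in _ --> X](mulr0 (perimeter Q * M)); apply: cvgM; first exact: cvg_cst.
  by apply: cvg_expr; rewrite ger0_norm; lra.
have M0 : 0 <= M.
  by apply: le_trans (gM 0%N); apply: Rintegral_ge0 => x _; exact: sumr_ge0.
have pQ := perimeter_ge0 ndQ.
have {}c0 : \forall k \near \oo, perimeter Q * M * (1 / 2) ^+ k <= e / 3.
  have /ge0_cvg0P H := c0; apply: H => // k.
  by rewrite !mulr_ge0// exprn_ge0.
have [k _ /(_ k (leqnn k)) [vk ck]] : \forall k \near \oo,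
    Osc (rounds k) v Q <= e / 3 /\ perimeter Q * M * (1 / 2) ^+ k <= e / 3.
  by near=> k; split; near: k.
pose S n : R := \sum_(P <- leaves (rounds k) Q)
  `|\int[mu]_(x in bx P) v_ n x - \int[mu]_(x in bx P) v x|.
have S0 : S n @[n --> \oo] --> (0 : R).
  have : {in leaves (rounds k) Q, forall P, proper_box P /\ subbox P Q}.
    by move=> P PQ; have [] := leavesP ndQ PQ.
  rewrite /S; elim: (leaves _ _) => [|P s IH] H.
    by under eq_cvg do rewrite big_nil; exact: cvg_cst.
  have [ndP PQ] := H P (mem_head _ _).
  have A : `|\int[mu]_(x in bx P) v_ n x - \int[mu]_(x in bx P) v x| @[n --> \oo] -->
      `|\int[mu]_(x in bx P) v x - \int[mu]_(x in bx P) v x : R|.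
    by apply: cvg_norm; apply: cvgB; [exact: (vP P ndP PQ)|exact: cvg_cst].
  rewrite subrr normr0 in A.
  have B := IH (fun P' Ps => H P' (mem_behead (s := P :: s) Ps)).
  have C : (`|\int[mu]_(x in bx P) v_ n x - \int[mu]_(x in bx P) v x| + \sum_(P <- s)
      `|\int[mu]_(x in bx P) v_ n x - \int[mu]_(x in bx P) v x|) @[n --> \oo] --> (0 + 0 : R).
    exact: cvgD A B.
  by rewrite addr0 in C; under eq_cvg do rewrite big_cons.
have /ge0_cvg0P S0' := S0.
have {}S0 := S0' (fun n => sumr_ge0 _ (fun P _ => normr_ge0 _)) _ e3.
apply: filterS S0 => n Sn.
rewrite (Rintegral_leaves (rounds k) ndQ (integrable_normr (integrableB mQ (vnQ n) vQ))).
apply: (@le_trans _ _ (Osc (rounds k) (v_ n) Q + Osc (rounds k) v Q + S n)).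
  rewrite /Osc /S -big_split/= -big_split/=; apply: ler_leaves => // P ndP PQ _.
  by apply: dist_le_osc => //; [exact: integrable_subbox (vnQ n)|exact: integrable_subbox vQ].
have := Osc_rounds_le k mOm r0 ndQ sub (vni n) (gi n) (wp n).
have : perimeter Q * \int[mu]_(x in bx Q) (\sum_(j < N) `|g n j x|) / 2 ^+ k <= perimeter Q * M * (1 / 2) ^+ k.
  by rewrite expr_div_n expr1n div1r ler_wpM2r ?invr_ge0 ?exprn_ge0// ler_wpM2l.
move=> h1 h2; have -> : e = e / 3 + e / 3 + e / 3 by field.
exact: lerD (lerD (le_trans h2 (le_trans h1 ck)) vk) Sn.
Unshelve. all: by end_near. Qed.

End poincare.

(** * Almost everywhere limits of convex combinations *)

Section fast_sequences.
Context d (T : measurableType d) (R : realType) (mu : {measure set T -> \bar R}).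
Implicit Types (D : set T) (a w : nat -> T -> R).

Lemma fast_integrable_series D a (C : R) : measurable D ->
  (forall n, mu.-integrable D (EFin \o a n)) ->
  (forall n, \int[mu]_(x in D) `|a n x| <= C / 2 ^+ n) ->
  mu.-integrable D (fun x => \sum_(k <oo) (`|a k x|)%:E)%E.
Proof.
move=> mD ai aC.
have ma n : measurable_fun D (fun x => (`|a n x|)%:E).
  by apply/measurable_EFinP; exact: (integrable_measurable (integrable_normr (ai n))).
have ge0 n x : D x -> (0 <= (`|a n x|)%:E)%E by rewrite lee_fin.
apply/integrableP; split.
  by apply: ge0_emeasurable_sum => // k x Dx _; exact: ge0.
rewrite (eq_integral (fun x => \sum_(k <oo) (`|a k x|)%:E))%E; last first.
  by move=> x _; rewrite gee0_abs//; apply: nneseries_ge0 => n _ _; rewrite lee_fin.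
rewrite integral_nneseries//.
apply: (@le_lt_trans _ _ (\sum_(n <oo) (C / 2 ^+ n)%:E)%E).
  apply: lee_nneseries => [n _ _|n _]; first exact: integral_ge0.
  rewrite (_ : (\int[mu]_(x in D) _)%E = (\int[mu]_(x in D) `|a n x|)%:E) ?lee_fin//.
  by rewrite fineK//; exact: integrable_fin_num (integrable_normr (ai n)).
have cv : series (geometric C (2^-1)) @ \oo --> C * (1 - 2^-1)^-1.
  by apply: cvg_geometric_series; rewrite ger0_norm; lra.
rewrite (_ : (\sum_(n <oo) _)%E = (C * (1 - 2^-1)^-1)%:E) ?ltry//.
apply/cvg_lim => //.
rewrite (_ : (fun n => _) = EFin \o series (geometric C (2^-1))); first exact: cvg_EFin (nearW _ _) cv.
apply/funext => n; rewrite /= /series/= -sumEFin; apply: eq_bigr => i _.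
by rewrite /geometric/= exprVn.
Qed.

Lemma fast_ae_summable D a (C : R) : measurable D ->
  (forall n, mu.-integrable D (EFin \o a n)) ->
  (forall n, \int[mu]_(x in D) `|a n x| <= C / 2 ^+ n) ->
  {ae mu, forall x, D x -> cvgn (series (fun n => `|a n x|))}.
Proof.
move=> mD ai aC; have := fast_integrable_series mD ai aC.
move=> /(integrable_ae mD); apply: filterS => x + Dx => /(_ Dx) sfin.
apply: nondecreasing_is_cvgn.
  by apply/nondecreasing_seqP => n; rewrite -subr_ge0 seriesSB.
exists (fine (\sum_(k <oo) (`|a k x|)%:E)%E) => _ [n _ <-].
rewrite -lee_fin fineK// /series/= -sumEFin.
by apply: nneseries_lim_ge => k _ _; rewrite lee_fin.
Qed.

Lemma fast_ae_cvg0 D a (C : R) : measurable D ->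
  (forall n, mu.-integrable D (EFin \o a n)) ->
  (forall n, \int[mu]_(x in D) `|a n x| <= C / 2 ^+ n) ->
  {ae mu, forall x, D x -> a n x @[n --> \oo] --> (0 : R)}.
Proof.
move=> mD ai aC; apply: filterS (fast_ae_summable mD ai aC) => x H /H.
by move=> /cvg_series_cvg_0 /norm_cvg0.
Qed.

Lemma fast_cauchy_limit D w (C : R) : measurable D ->
  (forall n, mu.-integrable D (EFin \o w n)) ->
  (forall n, \int[mu]_(x in D) `|w n.+1 x - w n x| <= C / 2 ^+ n) ->
  exists G : T -> R, [/\ mu.-integrable D (EFin \o G),
    {ae mu, forall x, D x -> w n x @[n --> \oo] --> G x} &
    \int[mu]_(x in D) `|w n x - G x| @[n --> \oo] --> (0 : R)].
Proof.
move=> mD wi wC; pose a n x := w n.+1 x - w n x.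
have ai n : mu.-integrable D (EFin \o a n) by exact: (integrableB mD (wi n.+1) (wi n)).
(* The upper limit is measurable on all of [D] and agrees with the limit wherever that exists. *)
pose G x := fine (limn_esup (fun n => (w n x)%:E)).
have mG : measurable_fun D G.
  apply: measurableT_comp => //; apply: measurable_fun_limn_esup => n.
  exact: measurable_int (wi n).
have aeG : {ae mu, forall x, D x -> w n x @[n --> \oo] --> G x}.
  apply: filterS (fast_ae_summable mD ai wC) => x H /H /normed_cvg.
  rewrite -[series _]/(series (telescope (fun n => w n x))) telescopeK.
  move=> cv.
  have {}cv : cvgn (fun n => w n x).
    rewrite (_ : (fun n => w n x) = (fun n => (w n x - w 0%N x) + w 0%N x)).
      by apply: is_cvgD => //; exact: is_cvg_cst.
    by apply/funext => n; rewrite subrK.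
  have -> : G x = limn (fun n => w n x).
    have h : (w n x)%:E @[n --> \oo] --> (limn (fun n => w n x))%:E.
      by apply: cvg_EFin; [exact: nearW|exact: cv].
    by rewrite /G (cvg_limn_einf_sup h).2.
  exact: cv.
pose g x := ((`|w 0%N x|)%:E + \sum_(k <oo) (`|a k x|)%:E)%E.
have gi : mu.-integrable D g.
  by apply: integrableD => //; [exact: integrable_normr|exact: fast_integrable_series wC].
have wg x n : D x -> ((`|w n x|)%:E <= g x)%E.
  move=> Dx; rewrite /g; apply: (@le_trans _ _ ((`|w 0%N x|)%:E + \sum_(0 <= k < n) (`|a k x|)%:E)%E).
    rewrite sumEFin -EFinD lee_fin (eq_sum_telescope (fun n => w n x) n).
    by rewrite (le_trans (ler_normD _ _))// lerD2l; exact: ler_norm_sum.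
  by rewrite leeD2l//; apply: nneseries_lim_ge => k _ _; rewrite lee_fin.
have aeE : {ae mu, forall x, D x -> (w n x)%:E @[n --> \oo] --> (G x)%:E}.
  by apply: filterS aeG => x H Dx; apply: cvg_EFin; [exact: nearW|exact: H].
have [intG cv0 _] := @dominated_convergence _ T R mu D mD (fun n => EFin \o w n) (EFin \o G) g
  (fun n => measurable_int mu (wi n)) ((measurable_EFinP _ _).2 mG) aeE gi (aeW _ wg).
exists G; split => //.
exact: (fine_cvg cv0).
Qed.

End fast_sequences.

Section midpoint_hull.
Context {R : realType} {T : Type} {V : lmodType R}.
Implicit Types (s : nat -> T -> V) (f g : T -> V).

Definition midpoint f g : T -> V := fun x => 2^-1 *: (f x + g x).

(** Midpoints suffice for the parallelogram identity, and properties of convex combinations become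
    inductions without weights. The bound [k] restricts the generators to a tail of the sequence. *)
Inductive mid_hull s k : (T -> V) -> Prop :=
| hull_gen i : (k <= i)%N -> mid_hull s k (s i)
| hull_mid f g : mid_hull s k f -> mid_hull s k g -> mid_hull s k (midpoint f g).

Lemma mid_hull_le s k k' f : (k <= k')%N -> mid_hull s k' f -> mid_hull s k f.
Proof.
move=> kk'; elim => {f} [i k'i|f g _ hf _ hg]; last exact: hull_mid.
exact/hull_gen/(leq_trans kk').
Qed.

Lemma mid_hull_pointwise s k f (K : set V) x :
  (forall a b, K a -> K b -> K (2^-1 *: (a + b))) ->
  (forall i, (k <= i)%N -> K (s i x)) -> mid_hull s k f -> K (f x).
Proof. by move=> Kmid Ks; elim => {f} [i /Ks//|f g _ hf _ hg]; exact: Kmid. Qed.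

(* Almost minimizers of q over shrinking midpoint-convex sets are close to each
   other by the parallelogram identity, as in the projection theorem in a
   Hilbert space. *)
Lemma mid_hull_minimizing s (q : (T -> V) -> R) (dist : (T -> V) -> (T -> V) -> R) M :
  (forall f g, mid_hull s 0 f -> mid_hull s 0 g ->
    q (midpoint f g) = (q f + q g) / 2 - dist f g / 4) ->
  (forall f, 0 <= q f) -> (forall n, q (s n) <= M) ->
  exists w : nat -> T -> V, exists K : nat -> nat,
    [/\ forall k, (k <= K k)%N, forall k, mid_hull s (K k) (w k) &
        forall k, dist (w k) (w k.+1) <= (4^-1) ^+ k].
Proof.
move=> para q0 qM; pose E k := [set q f | f in mid_hull s k].
pose dd k := inf (E k).
have hasE k : has_inf (E k).
  split; first by exists (q (s k)), (s k) => //; exact: hull_gen.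
  by exists 0 => _ [f _ <-].
have ddM k : dd k <= M.
  apply: le_trans (qM k); apply: ge_inf; first by have [] := hasE k.
  by exists (s k) => //; exact: hull_gen.
have dd_mono k k' : (k <= k')%N -> dd k <= dd k'.
  move=> kk'; apply: lb_le_inf; first by have [] := hasE k'.
  move=> _ [f hf <-]; apply: ge_inf; first by have [] := hasE k.
  by exists f => //; exact: mid_hull_le hf.
have hasd : has_sup (range dd).
  by split; [exists (dd 0%N), 0%N|exists M => _ [k _ <-]].
pose l := sup (range dd).
have dl k : dd k <= l by apply: ub_le_sup; [have [] := hasd|exists k].
(* The parallelogram identity will give a squared distance below [6 * e k]. The rate [4^-1] for
   squares corresponds to [2^-1] for norms, hence to a summable sequence of distances. *)
pose e k : R := (4^-1) ^+ k / 8.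
have e0 k : 0 < e k by rewrite divr_gt0// exprn_gt0.
have eS k : e k.+1 <= e k.
  by rewrite ler_pM2r// exprS ler_piMl ?exprn_ge0//; lra.
have /choice[ka kaP] : forall j, exists k, l - e j < dd k.
  by move=> j; have [_ [k _ <-] h] := sup_adherent (e0 j) hasd; exists k.
(* The sum makes [K] nondecreasing and at least [ka j]; the summand [j] sends it to infinity. *)
pose K j := (\sum_(i < j.+1) ka i + j)%N.
have Kka j : (ka j <= K j)%N.
  by rewrite /K big_ord_recr/= -addnA (leq_trans _ (leq_addl _ _))// leq_addr.
have KS j : (K j <= K j.+1)%N.
  by rewrite /K [X in (_ <= X + _)%N]big_ord_recr/= leq_add// leq_addr.
have /choice[w wP] : forall j, exists f, mid_hull s (K j) f /\ q f < dd (K j) + e j.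
  move=> j; have [_ [f hf <-] h] := inf_adherent (e0 j) (hasE (K j)).
  by exists f.
exists w, K; split => [k|k|k]; first exact: leq_addl.
  by have [] := wP k.
have [h1 q1] := wP k; have [h2 q2] := wP k.+1.
have h2' := mid_hull_le (KS k) h2.
have := para _ _ (mid_hull_le (leq0n _) h1) (mid_hull_le (leq0n _) h2').
have : dd (K k) <= q (midpoint (w k) (w k.+1)).
  apply: ge_inf; first by have [] := hasE (K k).
  by exists (midpoint (w k) (w k.+1)) => //; exact: hull_mid.
have := kaP k; have := dd_mono _ _ (Kka k); have := dl (K k); have := dl (K k.+1).
have := eS k; have : (4^-1) ^+ k = 8 * e k by rewrite /e; field.
move: q1 q2; clear; lra.
Qed.

End midpoint_hull.

Section hull_L2.
Context d0 (T : measurableType d0) (R : realType) (mu : {measure set T -> \bar R}).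
Context {m n : nat} {U : lmodType R}.
Implicit Types (A B : 'M[R]_(m, n)) (f g : T -> U * 'M[R]_(m, n)).

Definition sqn A : R := \sum_i \sum_j A i j ^+ 2.

Lemma sqn_ge0 A : 0 <= sqn A.
Proof. by apply: sumr_ge0 => i _; apply: sumr_ge0 => j _; exact: sqr_ge0. Qed.

Lemma sqr_le_sqn A i j : A i j ^+ 2 <= sqn A.
Proof.
rewrite /sqn (bigD1 i)//= (bigD1 j)//= -addrA lerDl addr_ge0//.
  by apply: sumr_ge0 => *; exact: sqr_ge0.
by apply: sumr_ge0 => *; apply: sumr_ge0 => *; exact: sqr_ge0.
Qed.

Lemma sqn_parallelogram A B :
  sqn (2^-1 *: (A + B)) = (sqn A + sqn B) / 2 - sqn (A - B) / 4.
Proof.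
rewrite /sqn !mulr_suml -big_split/= mulr_suml -sumrB; apply: eq_bigr => i _.
rewrite !mulr_suml -big_split/= mulr_suml -sumrB; apply: eq_bigr => j _.
by rewrite !mxE; field.
Qed.

Lemma measurable_sqn (D : set T) (h : T -> 'M[R]_(m, n)) :
  (forall i j, measurable_fun D (fun x => h x i j)) ->
  measurable_fun D (fun x => sqn (h x)).
Proof.
move=> mh; apply: measurable_sum => i; apply: measurable_sum => j.
exact/measurable_funX.
Qed.

Definition sq_integrable (D : set T) f :=
  (forall i j, measurable_fun D (fun x => (f x).2 i j)) /\
  mu.-integrable D (EFin \o (fun x => sqn (f x).2)).

Lemma integrable_sqnB D f g : measurable D -> sq_integrable D f -> sq_integrable D g ->
  mu.-integrable D (EFin \o (fun x => sqn ((f x).2 - (g x).2))).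
Proof.
move=> mD [mf fi] [mg gi].
have fgi := integrableD mD (integrableZl mD 2 fi) (integrableZl mD 2 gi).
apply: (integrable_le (g := fun x => 2 * sqn (f x).2 + 2 * sqn (g x).2) mD _ _ fgi).
  apply: measurable_sqn => i j.
  rewrite (_ : (fun _ => _) = (fun x => (f x).2 i j - (g x).2 i j)); first exact: measurable_funB.
  by apply/funext => x; rewrite !mxE.
move=> x _; rewrite ger0_norm ?sqn_ge0//.
have := sqn_parallelogram (f x).2 (g x).2; have := sqn_ge0 (2^-1 *: ((f x).2 + (g x).2)); lra.
Qed.

Lemma sq_integrable_mid D f g : measurable D -> sq_integrable D f -> sq_integrable D g ->
  sq_integrable D (midpoint f g).
Proof.
move=> mD [mf fi] [mg gi].
have mfg i j : measurable_fun D (fun x => (midpoint f g x).2 i j).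
  rewrite (_ : (fun _ => _) = (fun x => 2^-1 * ((f x).2 i j + (g x).2 i j))).
    by apply: measurable_funM => //; exact: measurable_funD.
  by apply/funext => x; rewrite !mxE.
split => //.
have fgi := integrableD mD fi gi.
apply: (integrable_le (g := fun x => sqn (f x).2 + sqn (g x).2) mD _ _ fgi).
  exact: measurable_sqn.
move=> x _; rewrite ger0_norm ?sqn_ge0// sqn_parallelogram.
have := sqn_ge0 ((f x).2 - (g x).2); have := sqn_ge0 (f x).2; have := sqn_ge0 (g x).2; lra.
Qed.

Lemma integrable_cst_fin D (c : R) : measurable D -> (mu D < +oo)%E ->
  mu.-integrable D (EFin \o cst c).
Proof.
move=> mD Doo; apply/integrableP; split; first by apply/measurable_EFinP; exact: measurable_cst.
rewrite (integral_cst mu mD `|c|%:E).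
by rewrite lte_mul_pinfty// ge0_fin_numE.
Qed.

Lemma sq_integrable_entry D f i j : measurable D -> (mu D < +oo)%E ->
  sq_integrable D f -> mu.-integrable D (EFin \o (fun x => (f x).2 i j)).
Proof.
move=> mD Doo [mf fi].
apply: (integrable_le (g := fun x => sqn (f x).2 + 1) mD (mf i j) _ (integrableD mD fi (integrable_cst_fin 1 mD Doo))).
move=> x _; apply: (@le_trans _ _ (((f x).2 i j) ^+ 2 + 1)); last by rewrite lerD2r sqr_le_sqn.
have := sqr_ge0 (`|(f x).2 i j| - 1).
rewrite -(real_normK (num_real ((f x).2 i j))); have := normr_ge0 ((f x).2 i j).
move: `|_| => t; nra.
Qed.

Lemma mid_hull_sq_integrable D (s : nat -> T -> U * 'M[R]_(m, n)) k f : measurable D ->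
  (forall k, sq_integrable D (s k)) -> mid_hull s k f -> sq_integrable D f.
Proof.
by move=> mD si; elim => {f} [i _|f g _ hf _ hg]; [exact: si|exact: sq_integrable_mid].
Qed.

Lemma hull_L2_limit (D : set T) (s : nat -> T -> U * 'M[R]_(m, n)) (M : R) :
  measurable D -> (mu D < +oo)%E ->
  (forall k, sq_integrable D (s k)) ->
  (forall k, \int[mu]_(x in D) sqn (s k x).2 <= M) ->
  exists w : nat -> T -> U * 'M[R]_(m, n), exists K : nat -> nat,
  exists G : T -> 'M[R]_(m, n),
    [/\ forall k, (k <= K k)%N, forall k, mid_hull s (K k) (w k),
        forall i j, mu.-integrable D (EFin \o (fun x => G x i j)),
        forall i j, {ae mu, forall x, D x -> (w k x).2 i j @[k --> \oo] --> (G x i j : R)} &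
        forall i j, \int[mu]_(x in D) `|(w k x).2 i j - G x i j| @[k --> \oo] --> (0 : R)].
Proof.
move=> mD Doo si sM.
have hullS k f : mid_hull s k f -> sq_integrable D f by exact: mid_hull_sq_integrable.
pose q f := \int[mu]_(x in D) sqn (f x).2.
pose dist f g := \int[mu]_(x in D) sqn ((f x).2 - (g x).2).
have para f g : mid_hull s 0 f -> mid_hull s 0 g ->
    q (midpoint f g) = (q f + q g) / 2 - dist f g / 4.
  move=> /hullS[mf fi] /hullS[mg gi].
  have di := integrable_sqnB mD (conj mf fi) (conj mg gi).
  rewrite /q /dist -RintegralD// -!RintegralZr//; last exact: (integrableD mD fi gi).
  rewrite -RintegralB//; last 2 first.
  - exact: (integrableZr mD 2^-1 (integrableD mD fi gi)).
  - exact: (integrableZr mD 4^-1 di).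
  by apply: eq_Rintegral => x _; rewrite sqn_parallelogram.
have q0 f : 0 <= q f by apply: Rintegral_ge0 => x _; exact: sqn_ge0.
have [w [K [kK hK wd]]] := mid_hull_minimizing para q0 sM.
have wS k := hullS _ _ (hK k).
pose C := (fine (mu D) + 1) / 2.
have cst_i (c : R) := integrable_cst_fin c mD Doo.
have lim_ij i j : exists G : T -> R, [/\ mu.-integrable D (EFin \o G),
    {ae mu, forall x, D x -> (w k x).2 i j @[k --> \oo] --> G x} &
    \int[mu]_(x in D) `|(w k x).2 i j - G x| @[k --> \oo] --> (0 : R)].
  apply: (@fast_cauchy_limit _ _ _ _ D (fun k x => (w k x).2 i j) C) => // k.
    exact: sq_integrable_entry.
  have di := integrable_sqnB mD (wS k) (wS k.+1).
  have p2 : (0 : R) < 2 ^+ k by rewrite exprn_gt0.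
  have i1 := integrableZl mD (2 ^+ k / 2) di.
  have i2 := cst_i ((2 ^+ k)^-1 / 2).
  (* Young's inequality with weight [2 ^ k] trades the bound [4 ^ -k] on squared L^2 distances for
     the bound [C / 2 ^ k] on L^1 distances; this is the origin of [C]. *)
  have amgm x : `|(w k.+1 x).2 i j - (w k x).2 i j| <=
      2 ^+ k / 2 * sqn ((w k x).2 - (w k.+1 x).2) + (2 ^+ k)^-1 / 2.
    have := sqr_le_sqn ((w k x).2 - (w k.+1 x).2) i j.
    rewrite distrC !mxE -(real_normK (num_real (_ - _))).
    move: (sqn _) `|_| => y t ty.
    rewrite -(ler_pM2r p2) mulrDl mulrAC [X in _ + X]mulrAC mulVf ?gt_eqF//.
    have := sqr_ge0 (2 ^+ k * t - 1); move: p2 (2 ^+ k : R) => _ p.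
    have := ler_wpM2l (sqr_ge0 p) ty; nra.
  have i3 : mu.-integrable D (EFin \o (fun x => `|(w k.+1 x).2 i j - (w k x).2 i j|)).
    apply: (integrable_le mD _ _ (integrableD mD i1 i2)); last first.
      by move=> x _; rewrite normr_id; exact: amgm.
    apply: (measurableT_comp (@normr_measurable R setT)).
    exact: (measurable_funB ((wS k.+1).1 i j) ((wS k).1 i j)).
  apply: (@le_trans _ _ (\int[mu]_(x in D) (2 ^+ k / 2 * sqn ((w k x).2 - (w k.+1 x).2) + (2 ^+ k)^-1 / 2))).
    by apply: (le_Rintegral mD i3 (integrableD mD i1 i2)) => x _.
  rewrite RintegralD// RintegralZl// Rintegral_cst//.
  have := wd k; rewrite -/(dist _ _); move: (dist _ _) => y yk.
  have -> : C / 2 ^+ k = 2 ^+ k / 2 * (4^-1) ^+ k + (2 ^+ k)^-1 / 2 * fine (mu D).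
    rewrite exprVn (_ : 4 = 2 * 2 :> R) ?exprMn; last by ring.
    by rewrite /C; field; rewrite gt_eqF.
  by rewrite lerD2r ler_wpM2l// divr_ge0// ltW.
have /choice[G' G'P] : forall i, exists G : 'I_n -> T -> R, forall j, [/\ mu.-integrable D (EFin \o G j),
    {ae mu, forall x, D x -> (w k x).2 i j @[k --> \oo] --> G j x} &
    \int[mu]_(x in D) `|(w k x).2 i j - G j x| @[k --> \oo] --> (0 : R)].
  by move=> i; have /choice[G GP] := lim_ij i; exists G.
exists w, K, (fun x => \matrix_(i, j) G' i j x); split => // i j.
- have [gi _ _] := G'P i j; rewrite (_ : (fun x => _) = G' i j)//.
  by apply/funext => x; rewrite mxE.
- have [_ gi _] := G'P i j; apply: filterS gi => x H /H; by rewrite mxE.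
- have [_ _ gi] := G'P i j; under eq_fun do under eq_Rintegral do rewrite mxE.
  exact: gi.
Qed.

End hull_L2.

(** * Pointwise passage to the limit in sublevel sets *)

Section matrix_topology_lemmas.
Context {R : realType}.

Lemma cvg_mx {I : Type} {F : set_system I} {FF : Filter F} m n (A_ : I -> 'M[R]_(m, n))
    (A : 'M[R]_(m, n)) :
  (forall i j, A_ k i j @[k --> F] --> (A i j : R)) -> A_ k @[k --> F] --> A.
Proof.
move=> cA U [P nP PU]; rewrite /nbhs/=.
have : \forall k \near F, forall ij : 'I_m * 'I_n, P ij.1 ij.2 (A_ k ij.1 ij.2).
  by apply: filter_forall => -[i j]; exact: (cA i j _ (nP i j)).
by apply: filterS => k H; apply: PU => i j; exact: (H (i, j)).
Qed.

Lemma mx_bounded_compact m n (r : R) :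
  compact [set A : 'M[R]_(m, n) | forall i j, `|A i j| <= r].
Proof.
have -> : [set A : 'M[R]_(m, n) | forall i j, `|A i j| <= r] =
    vec_mx @` [set v : 'rV[R]_(m * n) | forall k, `[- r, r]%classic (v ord0 k)].
  apply/seteqP; split => [A Ar|_ [v vr <-] i j]; last first.
    by have := vr (mxvec_index i j); rewrite mxE /= in_itv/= -ler_norml.
  exists (mxvec A); last exact: mxvecK.
  by move=> k; case/mxvec_indexP: k => i j /=; rewrite mxvecE in_itv/= -ler_norml.
apply: continuous_compact; last first.
  by apply: (@rV_compact R _ (fun=> `[- r, r]%classic)) => i; exact: segment_compact.
apply: continuous_subspaceT => v; apply: (@cvg_mx _ (nbhs v) (nbhs_filter v)) => i j.
rewrite mxE (_ : (fun k : 'rV[R]_(m * n) => _) = (fun w : 'rV[R]_(m * n) => w ord0 (mxvec_index i j))).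
  exact: coord_continuous.
by apply/funext => w; rewrite mxE.
Qed.

End matrix_topology_lemmas.

Section level_limit.
Context {R : realType} {N d : nat}.
Implicit Types (g : 'rV[R]_d -> 'M[R]_(d, N) -> R).

Lemma entry_le_enorm m n (A : 'M[R]_(m, n)) i j : `|A i j| <= enorm A.
Proof.
rewrite /enorm -sqrtr_sqr; apply: ler_wsqrtr.
exact: sqr_le_sqn.
Qed.

Lemma level_convex_midpoint m n (h : 'M[R]_(m, n) -> R) (c : R) (A B : 'M[R]_(m, n)) :
  level_convex h -> h A <= c -> h B <= c -> h (2^-1 *: (A + B)) <= c.
Proof.
move=> hc hA hB.
have h0 : 0 <= 2^-1 :> R by lra.
have h1 : 2^-1 <= 1 :> R by lra.
have := hc c A B (Itv01 h0 h1); rewrite !inE /= => /(_ hA hB).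
have half : 1 - 2^-1 = 2^-1 :> R by lra.
apply: le_trans; rewrite le_eqVlt; apply/orP; left; apply/eqP; congr (h _).
by rewrite scalerDr -{2}half.

Qed.

(* The sublevel sets at the moving point u_ k need not lie in the one at u, but
   by compactness and lower semicontinuity they end up in any neighbourhood of
   it, and these neighbourhoods are midpoint convex. *)
Lemma level_limit g (alpha gamma : R) (u_ : nat -> 'rV[R]_d) (u : 'rV[R]_d)
    (xi w : nat -> 'M[R]_(d, N)) (K : nat -> nat) (G : 'M[R]_(d, N)) :
  lower_semicontinuous (fun q : 'rV[R]_d * 'M[R]_(d, N) => (g q.1 q.2)%:E) ->
  (forall z, level_convex (g z)) -> 0 < alpha -> 0 < gamma ->
  (forall z xi, alpha * enorm xi `^ gamma <= g z xi) ->
  u_ k @[k --> \oo] --> u ->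
  (forall e, 0 < e -> \forall k \near \oo, g (u_ k) (xi k) <= 1 + e) ->
  (forall k, (k <= K k)%N) ->
  (forall k (C : set 'M[R]_(d, N)), (forall a b, C a -> C b -> C (2^-1 *: (a + b))) ->
     (forall i, (K k <= i)%N -> C (xi i)) -> C (w k)) ->
  (forall i j, w k i j @[k --> \oo] --> (G i j : R)) ->
  g u G <= 1.
Proof.
move=> lsc lc a0 g0 coer uu gx kK wC wG; rewrite leNgt; apply/negP => g1.
pose c := (1 + g u G) / 2.
have c1 : 1 < c by rewrite /c; lra.
have cg : c < g u G by rewrite /c; lra.
pose Kinf := [set eta | g u eta <= c].
have [V nV Vc] := lsc (u, G) c cg.
have [dl dl0 dlP] : exists2 dl : R, 0 < dl &
    forall eta : 'M[R]_(d, N), (forall i j, `|G i j - eta i j| < dl) -> c < g u eta.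
  have : nbhs G [set eta | V (u, eta)].
    have [[A B] [nA nB] ABV] := nV.
    apply: filterS nB => eta Beta; apply: ABV; split => //=.
    exact: nbhs_singleton nA.
  move=> /nbhs_ballP[e /= e0 eV]; exists e => // eta H.
  by have := Vc (u, eta) (eV _ (conj e0 H)); rewrite lte_fin.
(* The other half of [dl] is spent on the distance from [w k] to [G], so that a point of [Kinf] ends
   up within [dl] of [G], where [g u] exceeds [c]. *)
pose Kd := [set x : 'M[R]_(d, N) | exists2 eta, Kinf eta & forall i j, `|x i j - eta i j| <= dl / 2].
have Kd_mid A B : Kd A -> Kd B -> Kd (2^-1 *: (A + B)).
  move=> [eta eK etaA] [eta' eK' etaB]; exists (2^-1 *: (eta + eta')).
    exact: level_convex_midpoint.
  move=> i j; rewrite !mxE -mulrBr opprD addrACA normrM ger0_norm; last by lra.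
  have := ler_normD (A i j - eta i j) (B i j - eta' i j).
  have := etaA i j; have := etaB i j; lra.
pose r := (c / alpha) `^ gamma^-1.
have xi_bound z x : g z x <= c -> forall i j, `|x i j| <= r.
  move=> gc i j; apply: (le_trans (entry_le_enorm _ _ _)).
  have e0 : 0 <= enorm x by exact: sqrtr_ge0.
  have gn0 : gamma != 0 by rewrite gt_eqF.
  rewrite -[leLHS](powRr1 e0) -(mulfV gn0) powRrM; apply: ge0_ler_powR.
  - by rewrite invr_ge0 ltW.
  - by rewrite nnegrE powR_ge0.
  - by rewrite nnegrE divr_ge0 ?ltW//; lra.
  by rewrite ler_pdivlMr// mulrC (le_trans (coer _ _) gc).
(* By compactness one threshold on [k] serves all matrices bounded by [r]. Near a point of [Kinf],
   [Kd] contains a ball; near any other point, lower semicontinuity keeps [g (u_ k)] above [c] for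
   large [k]. *)
have cov := (compact_near_coveringP _).1 (@mx_bounded_compact R d N r).
have evK : \forall k \near \oo, [set A : 'M[R]_(d, N) | forall i j, `|A i j| <= r] `<=`
    [set A | g (u_ k) A <= c -> Kd A].
  apply: cov => eta _.
  have [ge|lt] := leP (g u eta) c.
    have [e /= e0 eP] : exists2 e : R, 0 < e & ball eta e `<=` Kd.
      exists (dl / 2); first by rewrite divr_gt0.
      move=> A [_ HA]; exists eta => // i j; rewrite distrC; exact/ltW/HA.
    have : \forall A \near eta & k \near \oo, Kd A.
      exists (ball eta e, setT) => /=; last by move=> [A k] [/= + _]; exact: eP.
      by split; [exact: nbhsx_ballx|exact: filterT].
    by apply: filterS => -[A k] /= + _.
  have [V' [[A B] /= [nA nB] ABV] V'c] := lsc (u, eta) c lt.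
  exists (B, [set k | A (u_ k)]) => /=; first by split => //; exact: uu.
  move=> [x k] /= [Bx Ak] gc; have := V'c (u_ k, x) (ABV (u_ k, x) (conj Ak Bx)).
  by rewrite lte_fin ltNge gc.
have e0 : 0 < c - 1 by rewrite subr_gt0.
have evxi : \forall k \near \oo, Kd (xi k).
  near=> k.
  have gk : g (u_ k) (xi k) <= c.
    by rewrite -(subrKC 1 c); near: k; exact: gx.
  suff : [set A : 'M[R]_(d, N) | forall i j, `|A i j| <= r] `<=` [set A | g (u_ k) A <= c -> Kd A].
    by apply => //; exact: xi_bound gk.
  by near: k.
have [k0 _ k0P] := evxi.
have : \forall k \near \oo, forall ij : 'I_d * 'I_N, `|G ij.1 ij.2 - w k ij.1 ij.2| < dl / 2.
  apply: filter_forall => -[i j] /=; move/cvgrPdist_lt: (wG i j); apply.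
  by rewrite divr_gt0.
move=> [k1 _ k1P].
pose k := maxn k0 k1.
have [eta eK etaP] : Kd (w k).
  apply: (wC k Kd Kd_mid) => i Ki; apply: k0P => /=.
  exact: leq_trans (leq_trans (leq_maxl k0 k1) (kK k)) Ki.
have := dlP eta _; rewrite ltNge eK => H; apply: (notF (H _)) => i j.
have := k1P k (leq_maxr k0 k1) (i, j) => /=; have := etaP i j.
have := ler_normD (G i j - w k i j) (w k i j - eta i j).
rewrite addrA subrK; lra.
Unshelve. all: by end_near. Qed.

End level_limit.

#[global] Instance ae_lebesgue_filter (R : realType) (N : nat) :
  Filter (nbhs (almost_everywhere (@lebesgue R N))).
Proof. exact: (ae_filter_ringOfSetsType (Measure.clone _ _ _ (@lebesgue R N) _)). Qed.

(** * Weak gradients and compactness *)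

Section covering.
Context {R : realType} {N : nat}.
Local Notation mu := (@lebesgue R N).
Local Notation LT := (lebesgue_type R N).
Local Notation rV := 'rV[R]_N.
Implicit Types (Om : set rV).

Definition inner_box Om (Qr : (rV * rV) * R) :=
  [/\ proper_box Qr.1, 0 < Qr.2 & collar Qr.2 Qr.1 `<=` Om].

Lemma box_cover Om : open Om -> exists Q : nat -> (rV * rV) * R,
  forall x, Om x -> exists n, inner_box Om (Q n) /\ bx (Q n).1 x.
Proof.
move=> oOm.
pose bq (qk : 'rV[rat]_N * nat) : (rV * rV) * R :=
  let c := qk.2.+1%:R^-1 in let q : rV := map_mx ratr qk.1 in
  ((q - const_mx c, q + const_mx c), c).
(* The default value has margin 0, so it is never an [inner_box]. The box of radius [c] with its
   margin [c] stays within the cube of radius [3 * c]. *)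
exists (fun n => if unpickle n is Some qk then bq qk else ((0, 0), 0)) => x Omx.
have [qk [qkx sub]] := rat_cube_nbhs (open_nbhs_nbhs (conj oOm Omx)).
have c0 : (0 : R) < qk.2.+1%:R^-1 by rewrite invr_gt0.
exists (pickle qk); rewrite pickleK; split.
  split => //= [i|y yc]; first by rewrite !mxE ltrBlDr -addrA ltrDl addr_gt0.
  apply: sub => i j; rewrite (ord1 i).
  have := yc j; rewrite in_itv/= !mxE ler_norml.
  move: (_^-1) c0 (ratr _ : R) (y _ _) => c c0 q t /andP[y1 y2].
  by apply/andP; split; lra.
move=> i; have := qkx ord0 i; rewrite in_itv/= !mxE ltr_norml.
move: (_^-1) c0 (ratr _ : R) (x _ _) => c c0 q t /andP[x1 x2].
by apply/andP; split; lra.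
Qed.

Lemma ae_from_boxes Om (Q : nat -> (rV * rV) * R) (P : rV -> Prop) :
  (forall x, Om x -> exists n, inner_box Om (Q n) /\ bx (Q n).1 x) ->
  (forall n, inner_box Om (Q n) -> {ae mu, forall x, bx (Q n).1 x -> P x}) ->
  ae_in Om P.
Proof.
move=> cov H.
have : {ae mu, forall x, forall n, inner_box Om (Q n) -> bx (Q n).1 x -> P x}.
  apply: ae_foralln => n; have [iQ|nQ] := pselect (inner_box Om (Q n)).
    by apply: filterS (H n iQ) => x Hx _.
  by apply: aeW => x.
move=> H'; apply: filterS H' => x Hx Omx.
by have [n [iQ xQ]] := cov x Omx; exact: Hx iQ xQ.
Qed.

Lemma Rintegral_norm_eq0 (D : set rV) (g : rV -> R) : measurable (D : set LT) ->
  mu.-integrable D (EFin \o g) -> \int[mu]_(x in D) `|g x| = 0 ->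
  {ae mu, forall x, D x -> g x = 0}.
Proof.
move=> mD gi g0.
have : (\int[mu]_(x in D) `|(EFin \o g) x| = 0)%E.
  rewrite -[RHS](_ : (\int[mu]_(x in D) `|g x|)%:E = 0%E); last by rewrite g0.
  by rewrite fineK//; exact: integrable_fin_num (integrable_normr gi).
move=> /(ae_eq_integral_abs mu mD (measurable_int mu gi)) H.
by apply: filterS H => x Hx /Hx [].
Qed.

End covering.

Section weak_gradient_lemmas.
Context {R : realType} {N d : nat}.
Local Notation mu := (@lebesgue R N).
Local Notation LT := (lebesgue_type R N).
Local Notation rV := 'rV[R]_N.
Implicit Types (Om : set rV) (psi : rV -> R) (u : rV -> 'rV[R]_d) (G : rV -> 'M[R]_(d, N)).

Lemma collar_compact rho (Q : rV * rV) : compact (collar rho Q).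
Proof. exact: compact_cbox. Qed.

Lemma test_bounded Om psi (j : 'I_N) : test_function Om psi ->
  exists C, forall x, `|psi x| <= C /\ `|partial j psi x| <= C.
Proof.
move=> [sm cS _]; set S := closure _ in cS.
have psi0 x : ~ S x -> psi x = 0.
  by move=> nS; apply/eqP; apply: contra_notT nS => px; exact: subset_closure.
have dpsi0 x : ~ S x -> partial j psi x = 0.
  move=> nS; rewrite /partial.
  have nb : \near x, cst (0 : R) x = psi x.
    have oS : open (~` S) by apply: closed_openC; exact: closed_closure.
    apply: filterS (open_nbhs_nbhs (conj oS nS)) => y yS; by rewrite psi0.
  have [_ <-] := near_eq_is_derive nb (is_derive_cst (0 : R) x (delta_mx ord0 j)).
  by [].
have bnd (h : rV -> R) : continuous h -> (forall x, ~ S x -> h x = 0) ->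
    exists C, forall x, `|h x| <= C.
  move=> ch h0; have : compact (h @` S).
    by apply: continuous_compact => //; exact: continuous_subspaceT.
  move=> /compact_bounded[M [_ HM]]; exists (`|M| + 1) => x.
  have [Sx|nS] := pselect (S x); last by rewrite h0// normr0 addr_ge0.
  apply: (HM (`|M| + 1)); last by exists x.
  by rewrite (le_lt_trans (ler_norm _))// ltrDl.
have [C1 H1] := bnd psi (sm [::]).1 psi0.
have [C2 H2] := bnd _ (sm [:: j]).1 dpsi0.
exists (Num.max C1 C2) => x; rewrite !le_max; split; apply/orP; [left|right].
  exact: H1.
exact: H2.
Qed.

Lemma test_measurable Om psi (j : 'I_N) (D : set rV) : test_function Om psi ->
  measurable_fun (D : set LT) psi /\ measurable_fun (D : set LT) (partial j psi).
Proof.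
move=> [sm _ _]; split; apply: continuous_lebesgue_measurable.
  exact: (sm [::]).1.
exact: (sm [:: j]).1.
Qed.

Lemma integrable_mul_bounded (D : set rV) (f h : rV -> R) (C : R) : measurable (D : set LT) ->
  mu.-integrable D (EFin \o f) -> measurable_fun (D : set LT) h ->
  (forall x, `|h x| <= C) -> mu.-integrable D (EFin \o (fun x => f x * h x)).
Proof.
move=> mD fi mh hC; have Ci := integrableZl mD C (integrable_normr fi).
apply: (@integrable_le _ _ R mu D (fun x => f x * h x) (fun x => C * `|f x|) mD _ _ Ci).
  exact: (measurable_funM (integrable_measurable fi) mh).
by move=> x _; rewrite normrM mulrC ler_wpM2r.
Qed.

Lemma weak_gradient_partial Om u G : weak_gradient Om u G -> forall i j,
  weak_partial Om (fun x => u x ord0 i) (fun x => G x i j) j.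
Proof. by move=> [_ H] i j psi; exact: H. Qed.

Lemma enorm_le_sum m n (A : 'M[R]_(m, n)) : enorm A <= \sum_i \sum_j `|A i j|.
Proof.
have sub (a b : R) : 0 <= a -> 0 <= b -> Num.sqrt (a + b) <= Num.sqrt a + Num.sqrt b.
  move=> a0 b0; rewrite -(@ler_pXn2r R 2)// ?nnegrE ?addr_ge0 ?sqrtr_ge0//.
  rewrite sqrrD !sqr_sqrtr ?addr_ge0// lerD2r lerDl.
  by rewrite mulrn_wge0// mulr_ge0 ?sqrtr_ge0.
have subs (I : finType) (F : I -> R) : (forall i, 0 <= F i) ->
    Num.sqrt (\sum_i F i) <= \sum_i Num.sqrt (F i).
  move=> F0; elim: (index_enum I) => [|i s IH]; first by rewrite !big_nil sqrtr0.
  rewrite !big_cons (le_trans (sub _ _ _ _))// ?sumr_ge0//.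
  by rewrite lerD2l.
rewrite /enorm; apply: (le_trans (subs _ _ _)) => [i|].
  by apply: sumr_ge0 => j _; exact: sqr_ge0.
apply: ler_sum => i _; apply: (le_trans (subs _ _ _)) => [j|]; first exact: sqr_ge0.
by apply: ler_sum => j _; rewrite sqrtr_sqr.
Qed.

Lemma integrable_enorm m n Om (h : rV -> 'M[R]_(m, n)) : measurable (Om : set LT) ->
  L1 Om h -> mu.-integrable Om (EFin \o (fun x => enorm (h x))).
Proof.
move=> mOm hi.
have si : mu.-integrable Om (EFin \o (fun x => \sum_i \sum_j `|h x i j|)).
  rewrite (_ : _ \o _ = (fun x => \sum_(i < m) \sum_(j < n) (`|h x i j|)%:E)%E); last first.
    by apply/funext => x /=; rewrite -sumEFin; apply: eq_bigr => i _; rewrite -sumEFin.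
  apply: (integrable_sum mOm) => i _; apply: (integrable_sum mOm) => j _.
  exact: (integrable_normr (hi i j)).
apply: (@integrable_le _ _ R mu Om (fun x => enorm (h x)) _ mOm _ _ si) => [|x _]; last first.
  by rewrite ger0_norm ?enorm_le_sum// sqrtr_ge0.
apply: (measurableT_comp (continuous_measurable_fun (@sqrt_continuous R))).
apply: (@measurable_sqn _ LT R m n Om h) => i j.
exact: (integrable_measurable (hi i j)).
Qed.

(** Weak convergence enters through these pairings, with [h] the indicator of a box or a partial
    derivative of a test function. *)
Lemma pairing_dual Om (i : 'I_d) (h : rV -> R) (C : R) : measurable (Om : set LT) ->
  measurable_fun (Om : set LT) h -> (forall x, `|h x| <= C) ->
  L1_dual Om (fun u : rV -> 'rV[R]_d => \int[mu]_(x in Om) (u x ord0 i * h x)).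
Proof.
move=> mOm mh hC; have int_h f (fi : mu.-integrable Om (EFin \o f)) := integrable_mul_bounded mOm fi mh hC.
split => [a u v Lu Lv|].
  have iu := int_h _ (Lu ord0 i); have iv := int_h _ (Lv ord0 i).
  rewrite -RintegralZl// -RintegralD//; last exact: (integrableZl mOm a iu).
  by apply: eq_Rintegral => x _; rewrite !mxE; ring.
exists C => u Lu; have iu := int_h _ (Lu ord0 i).
have ie := integrable_enorm mOm Lu.
rewrite /L1norm -RintegralZl//.
apply: (le_trans (le_normr_Rintegral mOm iu)).
apply: (le_Rintegral mOm (integrable_normr iu) (integrableZl mOm C ie)) => x _.
by rewrite normrM mulrC ler_pM// entry_le_enorm.
Qed.

Lemma L1loc_mul_test Om G psi i (j : 'I_N) : measurable (Om : set LT) ->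
  L1loc Om G -> test_function Om psi ->
  mu.-integrable Om (EFin \o (fun x => G x i j * psi x)).
Proof.
move=> mOm [_ LG] tpsi; have [C HC] := test_bounded j tpsi.
have [mpsi _] := test_measurable j (closure [set x | psi x != 0]) tpsi.
have [_ cS SOm] := tpsi; set S := closure _ in cS SOm mpsi.
have mS : measurable (S : set LT) by apply/closed_lebesgue_measurable/closed_closure.
have iS := integrable_mul_bounded mS (LG _ cS SOm i j) mpsi (fun x => (HC x).1).
have : mu.-integrable Om ((EFin \o (fun x => G x i j * psi x)) \_ S).
  by apply/(integrable_restrict mu mS mOm); rewrite setIidr.
apply: eq_integrable => // x _; rewrite patchE; case: ifPn => // /negP nS /=.
rewrite (_ : psi x = 0) ?mulr0//; apply/eqP; apply: contra_notT nS => px.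
by rewrite inE; exact: subset_closure.
Qed.

(** [gradient] chooses some weak gradient; this lemma transfers to it a bound proved for the
    constructed one. On each box it is [null_of_weak_null] applied to the entries of [G1 - G2]. *)
Lemma weak_gradient_unique Om u G1 G2 : open Om ->
  weak_gradient Om u G1 -> weak_gradient Om u G2 -> ae_in Om (fun x => G1 x = G2 x).
Proof.
move=> oOm wg1 wg2; have [Q cov] := box_cover oOm.
apply: (ae_from_boxes cov) => n [pQ r0 sub].
have ij : forall ij : 'I_d * 'I_N, {ae mu, forall x, bx (Q n).1 x -> G1 x ij.1 ij.2 - G2 x ij.1 ij.2 = 0}.
  move=> [i j] /=.
  have i1 := wg1.1.2 _ (@collar_compact _ _) sub i j.
  have i2 := wg2.1.2 _ (@collar_compact _ _) sub i j.
  have i12 := integrableB (measurable_collar _ _) i1 i2.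
  apply: (Rintegral_norm_eq0 (measurable_bx _) (integrable_collar r0 i12)).
  apply: (null_of_weak_null r0 pQ sub i12) => psi tpsi.
  have e1 := weak_gradient_partial wg1 i j tpsi; have e2 := weak_gradient_partial wg2 i j tpsi.
  have mOm := open_lebesgue_measurable oOm.
  have p1 := L1loc_mul_test i j mOm wg1.1 tpsi; have p2 := L1loc_mul_test i j mOm wg2.1 tpsi.
  under eq_Rintegral do rewrite mulrBl.
  by rewrite RintegralB//; apply/eqP; rewrite subr_eq0 -eqr_opp -e1 -e2.
have H' := @filter_forall _ _ _ _ (ae_lebesgue_filter R N) ij.
apply: (@filterS _ _ (ae_lebesgue_filter R N) _ _ _ H') => x H xQ; apply/matrixP => i j.
by apply/eqP; rewrite -subr_eq0; apply/eqP; exact: (H (i, j)).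
Qed.

End weak_gradient_lemmas.

Lemma ge0_Rintegral_subset d (T : measurableType d) (R : realType)
    (mu : {measure set T -> \bar R}) (D E : set T) (f : T -> R) :
  measurable D -> measurable E -> E `<=` D -> mu.-integrable D (EFin \o f) ->
  (forall x, D x -> 0 <= f x) -> \int[mu]_(x in E) f x <= \int[mu]_(x in D) f x.
Proof.
move=> mD mE ED fi f0; rewrite -[in leLHS](setIidr ED) -Rintegral_indic.
apply: (le_Rintegral mD (integrableM_indic mD mE fi) fi) => x Dx.
by rewrite ler_piMr ?f0// indicE; case: (_ \in _).
Qed.

Section compactness.
Context {R : realType} {N d : nat}.
Local Notation mu := (@lebesgue R N).
Local Notation LT := (lebesgue_type R N).
Local Notation rV := 'rV[R]_N.
Implicit Types (Om : set rV) (u : rV -> 'rV[R]_d) (G : rV -> 'M[R]_(d, N)).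

Lemma weak_pairing_cvg Om (U : nat -> rV -> 'rV[R]_d) u i (h : rV -> R) (C : R) :
  measurable (Om : set LT) -> weakly_cvg_L1 Om U u ->
  measurable_fun (Om : set LT) h -> (forall x, `|h x| <= C) ->
  \int[mu]_(x in Om) (U k x ord0 i * h x) @[k --> \oo] -->
    (\int[mu]_(x in Om) (u x ord0 i * h x) : R).
Proof. by move=> mOm wc mh hC; exact: wc _ (pairing_dual i mOm mh hC). Qed.

Lemma box_strong_cvg Om (U : nat -> rV -> 'rV[R]_d) u (G : nat -> rV -> 'M[R]_(d, N))
    (M : R) Qr i :
  measurable (Om : set LT) -> L1 Om u -> (forall k, L1 Om (U k)) ->
  weakly_cvg_L1 Om U u -> (forall k, weak_gradient Om (U k) (G k)) ->
  (forall k, mu.-integrable Om (EFin \o (fun x => sqn (G k x)))) ->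
  (forall k, \int[mu]_(x in Om) sqn (G k x) <= M) ->
  inner_box Om Qr ->
  \int[mu]_(x in bx Qr.1) `|U k x ord0 i - u x ord0 i| @[k --> \oo] --> (0 : R).
Proof.
case: Qr => Q r; move=> mOm Lu LU wc wg sG GM [/= pQ r0 sub].
have mQ := measurable_bx Q.
have QOm : bx Q `<=` Om by move=> x /(bx_sub_collar r0); exact: sub.
have gi k j := (wg k).1.2 _ (@collar_compact _ _ r Q) sub i j.
(* The L^1 bound [M + N * vol Q] on a row of the gradient comes from [|t| <= t ^ 2 + 1] for each of
   its [N] entries. *)
apply: (@strong_cvg_box R N Om r Q (fun k x => U k x ord0 i) (fun x => u x ord0 i)
  (fun k j x => G k x i j) (M + N%:R * vol Q) mOm r0 pQ sub).
- by move=> k; exact: LU.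
- exact: Lu.
- exact: gi.
- by move=> k j; exact: weak_gradient_partial.
- move=> k; have iG := integrable_sum_normr mQ (fun j => integrable_collar r0 (gi k j)).
  have sQ := integrableS mOm mQ QOm (sG k).
  have cQ := integrable_cst_bx N%:R pQ.
  apply: (@le_trans _ _ (\int[mu]_(x in bx Q) (sqn (G k x) + N%:R))).
    apply: (le_Rintegral mQ iG (integrableD mQ sQ cQ)) => x _.
    apply: (@le_trans _ _ (\sum_(j < N) (G k x i j ^+ 2 + 1))).
      apply: ler_sum => j _; have := sqr_ge0 (`|G k x i j| - 1).
      rewrite -(real_normK (num_real (G k x i j))); have := normr_ge0 (G k x i j).
      by move: `|_| => t; nra.
    rewrite big_split/= sumr_const card_ord lerD2r /sqn [leRHS](bigD1 i)//= lerDl.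
    by apply: sumr_ge0 => *; apply: sumr_ge0 => *; exact: sqr_ge0.
  rewrite RintegralD//; rewrite (Rintegral_cst_bx _ pQ) lerD2r.
  apply: le_trans (GM k); apply: (ge0_Rintegral_subset mOm mQ QOm (sG k)) => x _.
  exact: sqn_ge0.
- move=> P pP PQ; have mP := measurable_bx P.
  have POm := subset_trans (subbox_sub PQ) QOm.
  have mI : measurable_fun (Om : set LT) (\1_(bx P) : rV -> R) by exact: measurable_indic.
  have := weak_pairing_cvg (i := i) mOm wc mI (normr_indic_le1 (bx P)).
  rewrite Rintegral_indic (setIidr POm).
  by under eq_cvg do rewrite Rintegral_indic (setIidr POm).
Qed.

(** Diagonal choice: [phi k] makes the distance at most [2 ^ -k] on all inner boxes of index at most
    [k], so on box [n] the distances are summable from [k = n] on. The inequality [k <= phi k]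
    replaces monotonicity of [phi]: it is enough to preserve limits at infinity. *)
Lemma ae_subsequence Om (U : nat -> rV -> 'rV[R]_d) u : open Om ->
  L1 Om u -> (forall k, L1 Om (U k)) ->
  (forall Qr i, inner_box Om Qr ->
    \int[mu]_(x in bx Qr.1) `|U k x ord0 i - u x ord0 i| @[k --> \oo] --> (0 : R)) ->
  exists phi : nat -> nat, (forall k, (k <= phi k)%N) /\
    ae_in Om (fun x => U (phi k) x @[k --> \oo] --> u x).
Proof.
move=> oOm Lu LU sc; have mOm := open_lebesgue_measurable oOm.
have [Q cov] := box_cover oOm.
have /choice[phi phiP] : forall k, exists m, (k <= m)%N /\
    forall n, (n <= k)%N -> inner_box Om (Q n) -> forall i,
    \int[mu]_(x in bx (Q n).1) `|U m x ord0 i - u x ord0 i| <= 1 / 2 ^+ k.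
  move=> k.
  have H : \forall m \near \oo, forall ni : 'I_k.+1 * 'I_d, inner_box Om (Q ni.1) ->
      \int[mu]_(x in bx (Q ni.1).1) `|U m x ord0 ni.2 - u x ord0 ni.2| <= 1 / 2 ^+ k.
    apply: filter_forall => -[n i] /=.
    have [iQ|nQ] := pselect (inner_box Om (Q n)); last by apply: nearW => m /nQ.
    have /ge0_cvg0P H := sc (Q n) i iQ.
    have e0 : (0 : R) < 1 / 2 ^+ k by rewrite divr_gt0// exprn_gt0.
    by apply: filterS (H (fun m => Rintegral_ge0 mu (fun x _ => normr_ge0 _)) _ e0) => m Hm _.
  have [m _ mP] := H; exists (maxn k m); split; first exact: leq_maxl.
  move=> n nk iQ i.
  exact: (mP (maxn k m) (leq_maxr _ _) (Ordinal (nk : (n < k.+1)%N), i)).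
exists phi; split => [k|]; first by have [] := phiP k.
apply: (ae_from_boxes cov) => n iQ; have [pQ r0 sub] := iQ.
have QOm : bx (Q n).1 `<=` Om by move=> x /(bx_sub_collar r0); exact: sub.
have mQ := measurable_bx (Q n).1.
have H : forall i : 'I_d, {ae mu, forall x, bx (Q n).1 x ->
    U (phi (k + n)%N) x ord0 i - u x ord0 i @[k --> \oo] --> (0 : R)}.
  move=> i; apply: (@fast_ae_cvg0 _ _ _ mu (bx (Q n).1) (fun k x => U (phi (k + n)%N) x ord0 i - u x ord0 i) 1 mQ).
    by move=> k; exact: (integrableB mQ (integrableS mOm mQ QOm (LU _ ord0 i)) (integrableS mOm mQ QOm (Lu ord0 i))).
  move=> k; have [_ HH] := phiP (k + n)%N.
  apply: (le_trans (HH n (leq_addl _ _) iQ i)).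
  by rewrite ler_pM2l// lef_pV2 ?posrE ?exprn_gt0// ler_weXn2l ?ler1n// leq_addr.
have H' := @filter_forall _ _ _ _ (ae_lebesgue_filter R N) H.
apply: (@filterS _ _ (ae_lebesgue_filter R N) _ _ _ H') => x Hx xQ.
apply: cvg_mx => i0 i; rewrite (ord1 i0).
rewrite -(cvg_shiftn n) /=.
have : (U (phi (k + n)%N) x ord0 i - u x ord0 i + u x ord0 i) @[k --> \oo] --> (0 + u x ord0 i : R).
  by apply: cvgD; [exact: Hx|exact: cvg_cst].
rewrite add0r (_ : (fun k => _ + _) = (fun k => U (phi (k + n)%N) x ord0 i))//.
by apply/funext => k; rewrite subrK.
Qed.

(** Both sides of the integration by parts formula respect midpoints, so the formula holds on the
    hull. The function side converges because a ball about the limit that contains the values on a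
    tail also contains those on its hull; the gradient side converges by L^1 convergence. *)
Lemma hull_weak_gradient Om (U : nat -> rV -> 'rV[R]_d) u (G_ : nat -> rV -> 'M[R]_(d, N))
    (w : nat -> rV -> 'rV[R]_d * 'M[R]_(d, N)) (K : nat -> nat) G :
  open Om -> (mu Om < +oo)%E ->
  L1 Om u -> (forall k, L1 Om (U k)) ->
  weakly_cvg_L1 Om U u -> (forall k, weak_gradient Om (U k) (G_ k)) ->
  (forall k, mu.-integrable Om (EFin \o (fun x => sqn (G_ k x)))) ->
  (forall k, (k <= K k)%N) ->
  (forall k, mid_hull (fun k x => (U k x, G_ k x)) (K k) (w k)) ->
  (forall i j, mu.-integrable Om (EFin \o (fun x => G x i j))) ->
  (forall i j, \int[mu]_(x in Om) `|(w k x).2 i j - G x i j| @[k --> \oo] --> (0 : R)) ->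
  weak_gradient Om u G.
Proof.
move=> oOm Omoo Lu LU wc wg sG kK hK iG cG; have mOm := open_lebesgue_measurable oOm.
split.
  split => [i j|C cC COm i j]; first exact: (integrable_measurable (iG i j)).
  have mC : measurable (C : set LT).
    apply: closed_lebesgue_measurable; apply: compact_closed cC; exact: norm_hausdorff.
  exact: (integrableS mOm mC COm (iG i j)).
move=> i j psi tpsi.
have [C HC] := test_bounded j tpsi; have [mpsi mdpsi] := test_measurable j Om tpsi.
pose s k x := (U k x, G_ k x).
have si k : @sq_integrable _ _ R mu d N 'rV[R]_d Om (s k).
  split => [i' j'|]; first exact: ((wg k).1.1 i' j').
  exact: sG.
pose I1 (f : rV -> 'rV[R]_d * 'M[R]_(d, N)) := \int[mu]_(x in Om) ((f x).1 ord0 i * partial j psi x).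
pose I2 (f : rV -> 'rV[R]_d * 'M[R]_(d, N)) := \int[mu]_(x in Om) ((f x).2 i j * psi x).
have hP k f : mid_hull s k f -> mu.-integrable Om (EFin \o (fun x => (f x).1 ord0 i)).
  elim => {f} [k' _|f g _ fi _ gi]; first exact: (LU k' ord0 i).
  have := integrableZl mOm 2^-1 (integrableD mOm fi gi).
  by apply: eq_integrable => // x _; rewrite /midpoint/= !mxE.
have hP2 k f : mid_hull s k f -> mu.-integrable Om (EFin \o (fun x => (f x).2 i j)).
  move=> hf; exact: (sq_integrable_entry i j mOm Omoo (mid_hull_sq_integrable mOm si hf)).
have i1 k f (hf : mid_hull s k f) := integrable_mul_bounded mOm (hP k f hf) mdpsi (fun x => (HC x).2).
have i2 k f (hf : mid_hull s k f) := integrable_mul_bounded mOm (hP2 k f hf) mpsi (fun x => (HC x).1).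
have I1mid k f g : mid_hull s k f -> mid_hull s k g -> I1 (midpoint f g) = 2^-1 * (I1 f + I1 g).
  move=> hf hg; rewrite /I1 -RintegralD ?(i1 k)// -RintegralZl//.
    by apply: eq_Rintegral => x _; rewrite !mxE; ring.
  exact: (integrableD mOm (i1 k f hf) (i1 k g hg)).
have I2mid k f g : mid_hull s k f -> mid_hull s k g -> I2 (midpoint f g) = 2^-1 * (I2 f + I2 g).
  move=> hf hg; rewrite /I2 -RintegralD ?(i2 k)// -RintegralZl//.
    by apply: eq_Rintegral => x _; rewrite !mxE; ring.
  exact: (integrableD mOm (i2 k f hf) (i2 k g hg)).
have I12 k f : mid_hull s k f -> I1 f = - I2 f.
  elim => {f} [k' _|f g hf If hg Ig]; first exact: (weak_gradient_partial (wg k') i j tpsi).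
  by rewrite (I1mid k)// (I2mid k)// If Ig; ring.
have c1 : I1 (w k) @[k --> \oo] --> (\int[mu]_(x in Om) (u x ord0 i * partial j psi x) : R).
  have := weak_pairing_cvg (i := i) mOm wc mdpsi (fun x => (HC x).2).
  set l := \int[mu]_(x in Om) (u x ord0 i * _) => /cvgrPdist_le wl.
  apply/cvgrPdist_le => e /wl[n _ nP]; exists n => // k /= nk.
  have : mid_hull s n (w k) by apply: mid_hull_le (hK k); exact: leq_trans nk (kK k).
  elim => {w hK cG} [k' nk'|f g hf If hg Ig]; first exact: (nP k' nk').
  rewrite (I1mid n)// (_ : l - _ = 2^-1 * ((l - I1 f) + (l - I1 g))); last by field.
  rewrite normrM ger0_norm; last by lra.
  have := ler_normD (l - I1 f) (l - I1 g); lra.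
have c2 : I2 (w k) @[k --> \oo] --> (\int[mu]_(x in Om) (G x i j * psi x) : R).
  have iGp := integrable_mul_bounded mOm (iG i j) mpsi (fun x => (HC x).1).
  have cC : C * \int[mu]_(x in Om) `|(w k x).2 i j - G x i j| @[k --> \oo] --> (C * 0 : R).
    by apply: cvgM; [exact: cvg_cst|exact: cG].
  rewrite mulr0 in cC.
  have C0 : 0 <= C by apply: le_trans (HC 0).1.
  have /ge0_cvg0P H := cC.
  apply/cvgrPdist_le => e e0; apply: filterS (H _ _ e0) => [k|k]; last first.
    by rewrite mulr_ge0//; apply: Rintegral_ge0 => x _.
  apply: le_trans; rewrite distrC /I2 -RintegralB//; last exact: i2 (hK k).
  have idif := integrableB mOm (hP2 _ _ (hK k)) (iG i j).
  have idp := integrableB mOm (i2 _ _ (hK k)) iGp.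
  rewrite -RintegralZl//; last exact: integrable_normr idif.
  apply: (le_trans (le_normr_Rintegral mOm idp)).
  apply: (le_Rintegral mOm (integrable_normr idp) (integrableZl mOm C (integrable_normr idif))) => x _.
  by rewrite -mulrBl normrM mulrC ler_wpM2r// (HC x).1.
apply: (cvg_unique (@norm_hausdorff _ R^o) c1).
rewrite (_ : (fun k => I1 (w k)) = (fun k => - I2 (w k))); first exact: cvgN.
by apply/funext => k; exact: I12 (hK k).
Qed.

Lemma limit_level Om f (alpha gamma M : R) (U : nat -> rV -> 'rV[R]_d) u
    (G_ : nat -> rV -> 'M[R]_(d, N)) :
  open Om -> (mu Om < +oo)%E ->
  ae_in Om (fun x => lower_semicontinuous
    (fun q : 'rV[R]_d * 'M[R]_(d, N) => (f x q.1 q.2)%:E)) ->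
  ae_in Om (fun x => forall z, level_convex (f x z)) ->
  0 < alpha -> 0 < gamma ->
  ae_in Om (fun x => forall z xi, alpha * enorm xi `^ gamma <= f x z xi) ->
  L1 Om u -> (forall k, L1 Om (U k)) ->
  weakly_cvg_L1 Om U u -> (forall k, weak_gradient Om (U k) (G_ k)) ->
  (forall k, mu.-integrable Om (EFin \o (fun x => sqn (G_ k x)))) ->
  (forall k, \int[mu]_(x in Om) sqn (G_ k x) <= M) ->
  ae_in Om (fun x => forall e, 0 < e ->
    \forall k \near \oo, f x (U k x) (G_ k x) <= 1 + e) ->
  exists2 G, weak_gradient Om u G & ae_in Om (fun x => f x (u x) (G x) <= 1).
Proof.
move=> oOm Omoo lsc lc a0 g0 coer Lu LU wc wg sG GM gx.
have mOm := open_lebesgue_measurable oOm.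
have [|phi [kphi aeU]] := ae_subsequence oOm Lu LU.
  by move=> Qr i; exact: box_strong_cvg.
pose V k := U (phi k); pose H k := G_ (phi k).
have wcV : weakly_cvg_L1 Om V u.
  move=> T LT; apply: (cvg_comp phi (fun k => T (U k))); last exact: wc T LT.
  move=> P [n _ nP]; exists n => // k /= nk; apply: nP => /=.
  exact: leq_trans nk (kphi k).
have [||w [K [G [kK hK iG aeG cG]]]] := @hull_L2_limit _ LT R mu d N 'rV[R]_d Om (fun k x => (V k x, H k x)) M mOm Omoo.
- move=> k; split => [i j|]; first exact: ((wg (phi k)).1.1 i j).
  exact: sG.
- by move=> k; exact: GM.
exists G.
  by apply: (@hull_weak_gradient Om V u H w K G) => // k; [exact: LU|exact: wg|exact: sG].
have aeG' := @filter_forall _ _ _ _ (ae_lebesgue_filter R N) (fun ij : 'I_d * 'I_N => aeG ij.1 ij.2).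
have F := ae_lebesgue_filter R N.
have := @filterI _ _ F _ _ (@filterI _ _ F _ _ (@filterI _ _ F _ _ lsc lc) (@filterI _ _ F _ _ coer gx))
  (@filterI _ _ F _ _ aeU aeG').
apply: (@filterS _ _ F) => x [[[lscx lcx] [coerx gxx]] [Ux Gx]] Omx.
apply: (@level_limit R N d (f x) alpha gamma (fun k => V k x) (u x) (fun k => H k x) (fun k => (w k x).2) K (G x)) => //.
- exact: lscx.
- exact: lcx.
- exact: coerx.
- exact: Ux.
- move=> e e0; have [n _ nP] := gxx Omx e e0; exists n => // k /= nk; apply: nP => /=.
  exact: leq_trans nk (kphi k).
- move=> k C Cmid CK.
  apply: (@mid_hull_pointwise R rV _ _ (K k) (w k) [set p | C p.2] x _ _ (hK k)) => //=.
  by move=> a b; exact: Cmid.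
- by move=> i j; exact: (Gx (i, j)).
Qed.

End compactness.

(** * Modulars *)

Section limsup_liminf.
Context {R : realType}.
Implicit Types (w : nat -> \bar R) (a : \bar R).

Lemma limn_esup_lt_near w a : (limn_esup w < a)%E -> \forall n \near \oo, (w n < a)%E.
Proof.
move=> /ereal_inf_lt[_ [V nV <-] Va]; apply: filterS nV => n Vn.
by apply: le_lt_trans Va; apply: ereal_sup_ubound; exists n.
Qed.

Lemma limn_esup_le_near w a : (\forall n \near \oo, (w n <= a)%E) -> (limn_esup w <= a)%E.
Proof.
move=> H; apply: (@le_trans _ _ (ereal_sup [set w x | x in [set n | (w n <= a)%E]])).
  by apply: ereal_inf_lbound; exists [set n | (w n <= a)%E].
by apply: ge_ereal_sup => _ [n wn <-].
Qed.

Lemma limn_einf_gt_near w a : (a < limn_einf w)%E -> \forall n \near \oo, (a < w n)%E.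
Proof.
rewrite /limn_einf lteNr => /limn_esup_lt_near; apply: filterS => n.
by rewrite lteN2.
Qed.

Lemma limn_einf_ge_near w a : (\forall n \near \oo, (a <= w n)%E) -> (a <= limn_einf w)%E.
Proof.
move=> H; rewrite /limn_einf leeNr; apply: limn_esup_le_near.
by apply: filterS H => n; rewrite leeN2.
Qed.

End limsup_liminf.

Lemma measurable_fun_pair_on d d1 d2 (T : measurableType d) (T1 : measurableType d1)
    (T2 : measurableType d2) (D : set T) (f : T -> T1) (g : T -> T2) :
  measurable_fun D f -> measurable_fun D g ->
  measurable_fun D (fun x => (f x, g x)).
Proof.
move=> mf mg mD.
have h : @measurable _ (T1 * T2)%type = <<s preimage_set_system setT fst measurable `|`
  preimage_set_system setT snd measurable >> by [].
apply: (measurability _ h) => // _ [_ [[A mA <-]|[A mA <-]] <-]; rewrite setTI.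
  exact: mf.
exact: mg.
Qed.

Section integrand.
Context {R : realType} {N d : nat}.
Local Notation mu := (@lebesgue R N).
Local Notation LT := (lebesgue_type R N).
Local Notation rV := 'rV[R]_N.
Implicit Types (Om : set rV) (f : rV -> 'rV[R]_d -> 'M[R]_(d, N) -> R)
  (u : rV -> 'rV[R]_d) (G : rV -> 'M[R]_(d, N)) (phi : rV -> R -> \bar R).

Lemma integrand_measurable Om f u G : measurable (Om : set LT) ->
  normal_integrand Om f ->
  (forall i j, L0 Om (fun x => u x i j)) -> (forall i j, L0 Om (fun x => G x i j)) ->
  L0 Om (fun x => f x (u x) (G x)).
Proof.
move=> mOm [mf _] mu_ mG.
have h1 : measurable_fun (Om : set LT) (fun x : LT => (x : LT)) by exact: measurable_id.
have h2 : measurable_fun (Om : set LT) (u : LT -> borel_type 'rV[R]_d).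
  exact: measurable_fun_borel.
have h3 : measurable_fun (Om : set LT) (G : LT -> borel_type 'M[R]_(d, N)).
  exact: measurable_fun_borel.
have h := measurable_fun_pair_on (measurable_fun_pair_on h1 h2) h3.
apply: (measurable_comp _ _ mf h).
  by apply: measurableX; [apply: measurableX|].
by move=> _ [x Omx <-].
Qed.

Lemma weak_gradient_gradient Om u : W11loc Om u -> weak_gradient Om u (gradient Om u).
Proof. by move=> [_ [G wG]]; exact: getPex (ex_intro _ G wG). Qed.

Lemma W11loc_integrand Om f u : measurable (Om : set LT) -> normal_integrand Om f ->
  W11loc Om u -> L0 Om (fun x => f x (u x) (gradient Om u x)).
Proof.
move=> mOm nf Wu; have wG := weak_gradient_gradient Wu.
apply: integrand_measurable => //; first exact: Wu.1.1.
exact: wG.1.1.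
Qed.

Lemma L1_L1loc Om u : measurable (Om : set LT) -> L1 Om u -> L1loc Om u.
Proof.
move=> mOm Lu; split => [i j|K cK KOm i j]; first exact: (integrable_measurable (Lu i j)).
have mK : measurable (K : set LT).
  apply: closed_lebesgue_measurable; apply: compact_closed cK; exact: norm_hausdorff.
exact: (integrableS mOm mK KOm (Lu i j)).
Qed.

Lemma ess_sup_lt_ae Om (h : rV -> \bar R) (c : \bar R) : (ess_sup_in Om h < c)%E ->
  ae_in Om (fun x => (h x <= c)%E).
Proof.
move=> /ereal_inf_lt[y hy yc]; apply: (@filterS _ _ (ae_lebesgue_filter R N) _ _ _ hy) => x hx Omx.
exact: le_trans (hx Omx) (ltW yc).
Qed.

Lemma ess_inf_gt_ae Om (h : rV -> \bar R) (c : \bar R) : (c < ess_inf_in Om h)%E ->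
  ae_in Om (fun x => (c <= h x)%E).
Proof.
move=> /ereal_sup_gt[y hy yc]; apply: (@filterS _ _ (ae_lebesgue_filter R N) _ _ _ hy) => x hx Omx.
exact: le_trans (ltW yc) (hx Omx).
Qed.

(* Om may be negligible, in which case the essential infimum is +oo. *)
Lemma ess_inf_root_ae Om (h : rV -> \bar R) (p th : R) : 1 <= p -> 0 < th ->
  (forall x, Om x -> (0 <= h x)%E) ->
  (th%:E < ess_inf_in Om h `^ p^-1)%E ->
  ae_in Om (fun x => ((th `^ p)%:E <= h x)%E).
Proof.
move=> p1 th0 h0 H; apply: ess_inf_gt_ae; move: H.
have p0 : 0 < p by lra.
have pn0 : p != 0 by rewrite gt_eqF.
have : (0 <= ess_inf_in Om h)%E by apply: ereal_sup_ubound => /=; apply: aeW.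
case: (ess_inf_in Om h) => [r| |] //=; rewrite ?ltry//.
rewrite lee_fin !lte_fin => r0 H; rewrite ltNge; apply/negP => rth.
move: H; rewrite ltNge => /negP; apply.
rewrite -[leRHS](powRr1 (ltW th0)) -(mulfV pn0) powRrM.
by apply: ge0_ler_powR => //; rewrite ?nnegrE ?powR_ge0// invr_ge0 ltW.
Qed.

Lemma modular_ge0 Om phi (g : rV -> R) : (forall x t, Om x -> 0 <= t -> (0 <= phi x t)%E) ->
  (0 <= modular Om phi g)%E.
Proof. by move=> phi0; apply: integral_ge0 => x Omx; exact: phi0. Qed.

Lemma energy_W11loc Om f phi u : W11loc Om u ->
  energy Om f phi u = modular Om phi (fun x => f x (u x) (gradient Om u x)).
Proof. by move=> Wu; rewrite /energy; case: asboolP. Qed.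

Lemma energy_lty_W11loc Om f phi u : (energy Om f phi u < +oo)%E -> W11loc Om u.
Proof. by rewrite /energy; case: asboolP => // _; rewrite ltxx. Qed.

Lemma energy_ge0 Om f phi u : (forall x t, Om x -> 0 <= t -> (0 <= phi x t)%E) ->
  (0 <= energy Om f phi u)%E.
Proof.
by move=> phi0; rewrite /energy; case: ifP => _; [exact: modular_ge0|exact: leey].
Qed.

Lemma phi_infty_ge0 (x : rV) (t : R) : (0 <= phi_infty x t)%E.
Proof. by rewrite /phi_infty; case: ifP. Qed.

Lemma measurable_phi_infty Om (g : rV -> R) : measurable (Om : set LT) -> L0 Om g ->
  measurable_fun (Om : set LT) (fun x => phi_infty x `|g x|).
Proof.
move=> mOm mg; apply: (measurable_fun_if mOm); last 2 first.
- exact: measurable_cst.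
- exact: measurable_cst.
apply: measurable_fun_ler; last exact: measurable_cst.
exact: (measurableT_comp (@normr_measurable R setT) mg).
Qed.

Lemma energy_infty_eq0 Om f u : W11loc Om u ->
  ae_in Om (fun x => `|f x (u x) (gradient Om u x)| <= 1) ->
  measurable (Om : set LT) -> normal_integrand Om f ->
  energy_infty Om f u = 0%E.
Proof.
move=> Wu H mOm nf; rewrite /energy_infty energy_W11loc// /modular.
apply/eqP; rewrite eq_le; apply/andP; split; last first.
  by apply: integral_ge0 => x _; exact: phi_infty_ge0.
rewrite -(@integral0 _ _ R mu Om); apply: (ae_ge0_le_integral mOm).
- by move=> x _; exact: phi_infty_ge0.
- exact/(measurable_phi_infty mOm)/W11loc_integrand.
- by [].
- exact: measurable_cst.
apply: (@filterS _ _ (ae_lebesgue_filter R N) _ _ _ H) => x hx Omx.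
by rewrite /phi_infty hx.
Qed.

Lemma energy_infty_lty_ae Om f u : measurable (Om : set LT) -> normal_integrand Om f ->
  (energy_infty Om f u < +oo)%E ->
  W11loc Om u /\ ae_in Om (fun x => `|f x (u x) (gradient Om u x)| <= 1).
Proof.
move=> mOm nf Eoo; have Wu := energy_lty_W11loc Eoo; split => //.
move: Eoo; rewrite /energy_infty energy_W11loc// /modular => Eoo.
have pi : mu.-integrable Om (fun x => phi_infty x `|f x (u x) (gradient Om u x)|).
  apply/integrableP; split; first exact/(measurable_phi_infty mOm)/W11loc_integrand.
  apply: le_lt_trans Eoo; rewrite le_eqVlt; apply/orP; left; apply/eqP.
  by apply: eq_integral => x _; rewrite gee0_abs// phi_infty_ge0.
have := integrable_ae mOm pi.
move=> H; apply: (@filterS _ _ (ae_lebesgue_filter R N) _ _ _ H) => x hx /hx.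
by rewrite /phi_infty; case: ifP.
Qed.

(** Where [|g| <= 1], monotonicity bounds the integrand by [phi x 1]. *)
Lemma modular_le_cst Om phi (g : rV -> R) (c : R) : measurable (Om : set LT) ->
  weak_Phi Om phi -> L0 Om g -> 0 <= c ->
  ae_in Om (fun x => `|g x| <= 1) -> ae_in Om (fun x => (phi x 1%R <= c%:E)%E) ->
  (modular Om phi g <= c%:E * lebesgue Om)%E.
Proof.
move=> mOm [phi0 mphi _ mono _] mg c0 g1 phic.
rewrite /modular -(integral_cst mu mOm c%:E).
apply: (ae_ge0_le_integral mOm).
- by move=> x Omx; exact: phi0.
- exact: mphi.
- by move=> x _; rewrite lee_fin.
- exact: measurable_cst.
have F := ae_lebesgue_filter R N.
have := @filterI _ _ F _ _ (@filterI _ _ F _ _ g1 phic) mono.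
apply: (@filterS _ _ F) => x [[gx px] mx] Omx.
by apply: le_trans (px Omx); apply: mx => //; exact: gx.
Qed.

End integrand.

(** * Integral bounds drawn from (aInc) *)

Section power_bounds.
Context {R : realType} {N d : nat}.
Local Notation mu := (@lebesgue R N).
Local Notation LT := (lebesgue_type R N).
Local Notation rV := 'rV[R]_N.
Implicit Types (Om : set rV) (g : rV -> R) (phi : rV -> R -> \bar R) (p L th C e alpha gamma : R).

(** Cut off below 1 because (aInc) compares [phi x t] with [phi x 1] through the factor [t^-1],
    which must not exceed 1. *)
Definition tail_power th p (t : R) : R := if 1 <= t then (th * t) `^ p else 0.

Lemma tail_power_ge0 th p t : 0 <= tail_power th p t.
Proof. by rewrite /tail_power; case: ifP => _ //; exact: powR_ge0. Qed.

Lemma measurable_tail_power Om g th p : measurable (Om : set LT) -> L0 Om g ->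
  measurable_fun (Om : set LT) (fun x => tail_power th p `|g x|).
Proof.
move=> mOm mg; have mng := measurableT_comp (@normr_measurable R setT) mg.
apply: (measurable_fun_if mOm); last exact: measurable_cst.
  by apply: measurable_fun_ler; [exact: measurable_cst|exact: mng].
apply: (measurable_funS mOm); first by move=> x [].
apply: (measurableT_comp (measurable_powR p)).
by apply: measurable_funM; [exact: measurable_cst|exact: mng].
Qed.

(** For [t >= 1], (aInc) with [lam = t^-1] bounds [phi x 1], hence [th ^ p], by
    [L * t ^ -p * phi x t]; multiply by [t ^ p]. *)
Lemma tail_power_le_phi phi (x : rV) p L th t : 1 <= p -> 1 <= L -> 0 < th -> 0 <= t ->
  (0 <= phi x t)%E ->
  (forall t lam : R, 0 <= t -> 0 <= lam <= 1 ->
    (phi x (lam * t)%R <= (L * lam `^ p)%:E * phi x t)%E) ->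
  ((th `^ p)%:E <= phi x 1%R)%E ->
  ((tail_power th p t)%:E <= L%:E * phi x t)%E.
Proof.
move=> p1 L1 th0 t0 phi0 inc ph1; have L0 : 0 < L by lra.
rewrite /tail_power; case: ifP => t1; last by rewrite mule_ge0// lee_fin ltW.
have tp : 0 < t by lra.
have := inc t t^-1 t0; rewrite mulVf ?gt_eqF// invr_ge0 t0 invf_le1// t1 => /(_ isT).
move=> /(le_trans ph1); case: (phi x t) phi0 => [r| |] //.
  rewrite lee_fin => r0; rewrite -!EFinM !lee_fin => H.
  rewrite powRM ?(ltW th0)// -[leRHS]mulr1.
  have tt : t^-1 `^ p * t `^ p = 1.
    by rewrite -powRM ?invr_ge0// mulVf ?gt_eqF// powR1.
  have := ler_wpM2r (powR_ge0 t p) H.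
  rewrite (_ : L * t^-1 `^ p * r * t `^ p = L * r * (t^-1 `^ p * t `^ p)); last by ring.
  by rewrite tt.
by move=> _ _; rewrite gt0_muley ?leey// lte_fin.
Qed.

Lemma tail_power_integral Om phi g p L th C : measurable (Om : set LT) ->
  weak_Phi Om phi -> L0 Om g -> aInc Om phi p L -> 1 <= p -> 1 <= L -> 0 < th ->
  ae_in Om (fun x => ((th `^ p)%:E <= phi x 1%R)%E) ->
  (modular Om phi g <= C%:E)%E ->
  (\int[mu]_(x in Om) (tail_power th p `|g x|)%:E <= (L * C)%:E)%E.
Proof.
move=> mOm [phi0 mphi _ _ _] mg inc p1 L1 th0 ph1 gC.
have L0 : 0 <= L by lra.
apply: (@le_trans _ _ (\int[mu]_(x in Om) (L%:E * phi x `|g x|%R))%E); last first.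
  have -> := @ge0_integralZl _ _ R mu Om mOm _ (mphi _ mg) L%:E
    (fun x Omx => phi0 x _ Omx (normr_ge0 (g x))) L0.
  by rewrite EFinM; apply: lee_wpmul2l => //; rewrite lee_fin.
apply: (ae_ge0_le_integral mOm).
- by move=> x _; rewrite lee_fin tail_power_ge0.
- by apply/measurable_EFinP; exact: measurable_tail_power.
- by move=> x Omx; apply: mule_ge0; [rewrite lee_fin|exact: phi0].
- exact: measurable_funeM (mphi _ mg).
have F := ae_lebesgue_filter R N.
apply: (@filterS _ _ F _ _ _ (@filterI _ _ F _ _ inc ph1)) => x [ix px] Omx.
by apply: tail_power_le_phi => //; [exact: phi0|exact: ix|exact: px].
Qed.

Lemma integrable_tail_power Om g p th C : measurable (Om : set LT) -> L0 Om g ->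
  (\int[mu]_(x in Om) (tail_power th p `|g x|)%:E <= C%:E)%E ->
  mu.-integrable Om (EFin \o (fun x => tail_power th p `|g x|)) /\
  \int[mu]_(x in Om) tail_power th p `|g x| <= C.
Proof.
move=> mOm mg gC.
have it : mu.-integrable Om (EFin \o (fun x => tail_power th p `|g x|)).
  apply/integrableP; split.
    by apply/measurable_EFinP; exact: measurable_tail_power.
  apply: le_lt_trans (ltry C); apply: le_trans gC.
  rewrite le_eqVlt; apply/orP; left; apply/eqP.
  by apply: eq_integral => x _; rewrite gee0_abs// lee_fin tail_power_ge0.
split; first exact: it.
by rewrite -lee_fin fineK//; exact: integrable_fin_num it.
Qed.

(** Chebyshev's inequality: on [B] the tail power is at least [(th * (1 + e)) ^ p]. The measure is
    written as the L^1 norm of an indicator to fit [fast_ae_cvg0]. *)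
Lemma tail_measure Om g p th C e : measurable (Om : set LT) -> (mu Om < +oo)%E -> L0 Om g ->
  1 <= p -> 0 < th -> 0 <= e ->
  (\int[mu]_(x in Om) (tail_power th p `|g x|)%:E <= C%:E)%E ->
  let B := [set x | Om x /\ 1 + e < `|g x|] in
  mu.-integrable Om (EFin \o (\1_B : rV -> R)) /\
  \int[mu]_(x in Om) `|\1_B x : R| <= C / (th * (1 + e)) `^ p.
Proof.
move=> mOm Omoo mg p1 th0 e0 gC B.
have [it tC] := integrable_tail_power mOm mg gC.
have s0 : 0 < (th * (1 + e)) `^ p by apply: powR_gt0; rewrite mulr_gt0//; lra.
have mB : measurable (B : set LT).
  have mng : measurable_fun (Om : set LT) (fun x => `|g x|).
    exact: measurableT_comp (@normr_measurable R setT) mg.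
  have := mng mOm _ (measurable_itv `]1 + e, +oo[).
  by congr measurable; apply/seteqP; split => x /=; rewrite in_itv/= andbT.
have iB : mu.-integrable Om (EFin \o (\1_B : rV -> R)).
  apply: (@integrable_le _ _ R mu Om (\1_B : rV -> R) (cst 1) mOm) => [||].
  - exact: measurable_indic.
  - by move=> x _; exact: normr_indic_le1.
  - exact: integrable_cst_fin.
split; first exact: iB.
rewrite ler_pdivlMr// mulrC; apply: le_trans tC.
have iBn := integrable_normr iB.
rewrite -RintegralZl//.
apply: (le_Rintegral mOm (integrableZl mOm _ iBn) it) => x Omx.
rewrite indicE; have [|_] := boolP (x \in B); last first.
  by rewrite normr0 mulr0 tail_power_ge0.
rewrite inE => -[_ xg]; rewrite normr1 mulr1 /tail_power ifT; last by lra.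
apply: ge0_ler_powR; first by lra.
- by rewrite nnegrE mulr_ge0 ?(ltW th0)//; lra.
- by rewrite nnegrE mulr_ge0 ?(ltW th0).
by rewrite ler_pM2l// ltW.
Qed.

(** With [q = 2 / gamma], coercivity bounds [sqn (G x)] by [(g x / alpha) ^ q], which is
    [(2 / alpha) ^ q] times [(g x / 2) ^ q]; the latter is compared with the tail power for
    [th = 2^-1]. *)
Lemma gradient_L2_bound Om g (G : rV -> 'M[R]_(d, N)) p C alpha gamma :
  measurable (Om : set LT) -> (mu Om < +oo)%E -> L0 Om g ->
  (forall i j, L0 Om (fun x => G x i j)) ->
  0 < alpha -> 0 < gamma -> 2 / gamma <= p ->
  ae_in Om (fun x => alpha * enorm (G x) `^ gamma <= g x) ->
  (\int[mu]_(x in Om) (tail_power 2^-1 p `|g x|)%:E <= C%:E)%E ->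
  mu.-integrable Om (EFin \o (fun x => sqn (G x))) /\
  \int[mu]_(x in Om) sqn (G x) <= (2 / alpha) `^ (2 / gamma) * (fine (mu Om) + C).
Proof.
move=> mOm Omoo mg mG a0 g0 qp coer gC.
have [it tC] := integrable_tail_power mOm mg gC.
set q := 2 / gamma; have q0 : 0 < q by rewrite divr_gt0.
set k := (2 / alpha) `^ q.
have k0 : 0 <= k by exact: powR_ge0.
have i1 := integrable_cst_fin (mu := mu) 1 mOm Omoo.
have ik := integrableZl mOm k (integrableD mOm i1 it).
have mS := @measurable_sqn _ LT R d N Om G mG.
have bound : ae_in Om (fun x => sqn (G x) <= k * (1 + tail_power 2^-1 p `|g x|)).
  apply: (@filterS _ _ (ae_lebesgue_filter R N) _ _ _ coer) => x cx Omx.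
  have {}cx := cx Omx.
  have e0 : 0 <= enorm (G x) by exact: sqrtr_ge0.
  have gx0 : 0 <= g x by apply: le_trans cx; rewrite mulr_ge0 ?(ltW a0)// powR_ge0.
  rewrite (ger0_norm gx0).
  have sqE : sqn (G x) = (enorm (G x) `^ gamma) `^ q.
    rewrite -powRrM /q mulrC divfK ?gt_eqF// -[2]/(2%:R) powR_mulrn// sqr_sqrtr//.
    exact: sqn_ge0.
  have s1 : sqn (G x) <= k * (g x / 2) `^ q.
    rewrite sqE /k -powRM ?divr_ge0 ?(ltW a0)//.
    apply: ge0_ler_powR; rewrite ?nnegrE ?powR_ge0 ?(ltW q0)//.
      by rewrite mulr_ge0// divr_ge0// ltW.
    rewrite (_ : 2 / alpha * (g x / 2) = g x / alpha); last by field; rewrite gt_eqF.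
    by rewrite ler_pdivlMr// mulrC.
  apply: (le_trans s1); rewrite ler_wpM2l//.
  (* If [g x <= 2], the power of [g x / 2] is at most 1; otherwise the base exceeds 1 and the
     exponent may be raised to [p]. *)
  have [g2|g2] := leP (g x) 2.
    apply: (@le_trans _ _ 1); last by rewrite lerDl tail_power_ge0.
    rewrite [leRHS](_ : 1 = 1 `^ q); last by rewrite powR1.
    apply: ge0_ler_powR; rewrite ?nnegrE ?(ltW q0)//.
      by rewrite divr_ge0.
    lra.
  rewrite /tail_power ifT; last by lra.
  apply: (@le_trans _ _ ((2^-1 * g x) `^ p)); last by rewrite lerDr.
  by rewrite mulrC; apply: ler_powR => //; lra.
have le_int : (\int[mu]_(x in Om) (sqn (G x))%:E <=
    \int[mu]_(x in Om) (k * (1 + tail_power 2^-1 p `|g x|))%:E)%E.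
  apply: (ae_ge0_le_integral mOm).
  - by move=> x _; rewrite lee_fin sqn_ge0.
  - exact/measurable_EFinP.
  - by move=> x _; rewrite lee_fin mulr_ge0// addr_ge0// tail_power_ge0.
  - exact: measurable_int ik.
  exact: bound.
have iS : mu.-integrable Om (EFin \o (fun x => sqn (G x))).
  apply/integrableP; split; first exact/measurable_EFinP.
  apply: le_lt_trans (integrable_lty mOm ik); apply: le_trans le_int.
  rewrite le_eqVlt; apply/orP; left; apply/eqP.
  by apply: eq_integral => x _; rewrite gee0_abs// lee_fin sqn_ge0.
split; first exact: iS.
apply: (@le_trans _ _ (\int[mu]_(x in Om) (k * (1 + tail_power 2^-1 p `|g x|)))).
  by apply: fine_le le_int; [exact: integrable_fin_num iS|exact: integrable_fin_num ik].
rewrite RintegralZl//; last exact: (integrableD mOm i1 it).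
rewrite ler_wpM2l// RintegralD// lerD//.
by rewrite Rintegral_cst// mul1r.
Qed.

End power_bounds.

Lemma powR_large {R : realType} (s K : R) : 1 < s -> 0 < K ->
  exists A, forall q, A <= q -> K <= s `^ q.
Proof.
move=> s1 K0; exists (ln K / ln s) => q Aq.
have ls : 0 < ln s by exact: ln_gt0.
apply: (@le_trans _ _ (s `^ (ln K / ln s))); last by apply: ler_powR => //; exact: ltW.
rewrite /powR gt_eqF; last by lra.
by rewrite divfK ?gt_eqF// lnK// posrE.
Qed.

(** * The limsup and liminf inequalities *)

Section gamma_convergence.
Context {R : realType} {N d : nat}.
Local Notation mu := (@lebesgue R N).
Local Notation LT := (lebesgue_type R N).
Local Notation rV := 'rV[R]_N.
Implicit Types (Om : set rV) (f : rV -> 'rV[R]_d -> 'M[R]_(d, N) -> R)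
  (u : rV -> 'rV[R]_d) (phi : nat -> rV -> R -> \bar R) (p : nat -> R).

Lemma limsup_energy Om f phi u : open Om -> (mu Om < +oo)%E ->
  normal_integrand Om f -> (forall n, weak_Phi Om (phi n)) ->
  limn_esup (fun n => ess_sup_in Om (phi n ^~ 1)) = 0%E ->
  (limn_esup (fun n => energy Om f (phi n) u) <= energy_infty Om f u)%E.
Proof.
move=> oOm Omoo nf wphi sup0; have mOm := open_lebesgue_measurable oOm.
have [->|] := eqVneq (energy_infty Om f u) +oo%E; first exact: leey.
rewrite -ltey => /(energy_infty_lty_ae mOm nf)[Wu f1].
rewrite (energy_infty_eq0 Wu f1 mOm nf).
apply/lee_addgt0Pr => e e0; rewrite add0e; apply: limn_esup_le_near.
have Om0 : 0 <= fine (mu Om) by exact: fine_ge0 (measure_ge0 _ _).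
(* Adding 1 covers the case of a negligible [Om]. *)
pose c := e / (fine (mu Om) + 1).
have c0 : 0 < c by rewrite divr_gt0//; lra.
have : (limn_esup (fun n => ess_sup_in Om (phi n ^~ 1%R)) < c%:E)%E by rewrite sup0 lte_fin.
move=> /limn_esup_lt_near; apply: filterS => n /ess_sup_lt_ae phic.
rewrite energy_W11loc//.
have := modular_le_cst mOm (wphi n) (W11loc_integrand mOm nf Wu) (ltW c0) f1 phic.
move=> /le_trans; apply.
rewrite -[X in (_ * X)%E]fineK; last by rewrite ge0_fin_numE ?measure_ge0.
rewrite -EFinM lee_fin /c mulrAC ler_pdivrMr; last by lra.
by rewrite ler_wpM2l ?(ltW e0)//; lra.
Qed.

(** The energies are bounded for infinitely many [n], as a finite liminf provides, and the resulting
    level is 1 whatever the constant [C]. *)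
Lemma energy_bounded_level Om f (alpha gamma L : R) phi p (C : R) u (u_ : nat -> rV -> 'rV[R]_d) :
  open Om -> (mu Om < +oo)%E -> normal_integrand Om f ->
  ae_in Om (fun x => forall z, level_convex (f x z)) ->
  0 < alpha -> 0 < gamma ->
  ae_in Om (fun x => forall z xi, alpha * enorm xi `^ gamma <= f x z xi) ->
  1 <= L -> (forall n, weak_Phi Om (phi n)) -> (forall n, 1 <= p n) ->
  (1 <= limn_einf (fun n => ess_inf_in Om (phi n ^~ 1%R) `^ (p n)^-1%R))%E ->
  (forall n, aInc Om (phi n) (p n) L) -> p n @[n --> \oo] --> +oo ->
  L1 Om u -> (forall n, L1 Om (u_ n)) -> weakly_cvg_L1 Om u_ u ->
  (forall m, exists2 n, (m <= n)%N & (energy Om f (phi n) (u_ n) <= C%:E)%E) ->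
  W11loc Om u /\ ae_in Om (fun x => f x (u x) (gradient Om u x) <= 1).
Proof.
move=> oOm Omoo nf lc a0 g0 coer L1' wphi p1 inf1 inc poo Lu LU wc freq.
have mOm := open_lebesgue_measurable oOm.
pose e k : R := k.+1%:R^-1.
have e0 k : 0 < e k by rewrite /e invr_gt0 ltr0n.
(* [th k] lies strictly between [(1 + e k)^-1] and 1: being below 1, it is eventually exceeded by
   the root of the essential infimum, while [th k * (1 + e k) > 1] makes the bound of [tail_measure]
   decay as the exponent grows. *)
pose th k := (1 + e k / 2)^-1.
have th0 k : 0 < th k by rewrite invr_gt0; move: (e0 k); lra.
have th1 k : th k < 1 by rewrite invf_lt1; move: (e0 k); lra.
have s1 k : 1 < th k * (1 + e k).
  by rewrite /th mulrC ltr_pdivlMr; move: (e0 k); lra.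
have pge A : \forall n \near \oo, A <= p n by move/cvgryPge : poo; apply.
(* [good] makes the measures of the sets where [|f| > 1 + e k] summable. *)
pose good k n := [/\ (k <= n)%N, (energy Om f (phi n) (u_ n) <= C%:E)%E,
  2 / gamma <= p n, 2 ^+ k <= (th k * (1 + e k)) `^ p n &
  ((th k)%:E < ess_inf_in Om (phi n ^~ 1%R) `^ (p n)^-1%R)%E /\
  ((2^-1)%:E < ess_inf_in Om (phi n ^~ 1%R) `^ (p n)^-1%R)%E].
have [n_ n_P] : {n_ : nat -> nat & forall k, good k (n_ k)}.
  apply: choice => k.
  have [A hA] := powR_large (s1 k) (exprn_gt0 k (ltr0n R 2)).
  have near_th t : t < 1 -> \forall n \near \oo,
      (t%:E < ess_inf_in Om (phi n ^~ 1%R) `^ (p n)^-1%R)%E.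
    by move=> t1; apply: limn_einf_gt_near; apply: lt_le_trans inf1; rewrite lte_fin.
  have half1 : (2^-1 : R) < 1 by rewrite invf_lt1 ?ltr1n.
  have := filterI (filterI (near_th _ (th1 k)) (near_th _ half1))
    (filterI (pge (2 / gamma)) (pge A)).
  move=> [m _ hm]; have [n mn En] := freq (maxn k m).
  move: mn; rewrite geq_max => /andP[kn mn].
  have [[h1 h2] [h3 h4]] := hm n mn.
  by exists n; split => //; exact: hA.
pose U k := u_ (n_ k); pose G k := gradient Om (U k).
have WU k : W11loc Om (U k).
  have [_ En _ _ _] := n_P k; apply: (energy_lty_W11loc (f := f) (phi := phi (n_ k))).
  exact: le_lt_trans En (ltry C).
have wG k : weak_gradient Om (U k) (G k) by exact: weak_gradient_gradient.
pose g k x := f x (U k x) (G k x).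
have mg k : L0 Om (g k) by exact: W11loc_integrand.
have gC k : (modular Om (phi (n_ k)) (g k) <= C%:E)%E.
  by have [_ + _ _ _] := n_P k; rewrite (energy_W11loc _ _ (WU k)).
have tail k t : 0 < t ->
    (t%:E < ess_inf_in Om (phi (n_ k) ^~ 1%R) `^ (p (n_ k))^-1%R)%E ->
    (\int[mu]_(x in Om) (tail_power t (p (n_ k)) `|g k x|)%:E <= (L * C)%:E)%E.
  move=> t0 tinf.
  apply: (tail_power_integral mOm (wphi (n_ k)) (mg k) (inc (n_ k)) (p1 _)
    L1' t0 _ (gC k)).
  apply: (ess_inf_root_ae (p1 _) t0 _ tinf) => x Omx.
  by have [phi0 _ _ _ _] := wphi (n_ k); exact: phi0.
have F := ae_lebesgue_filter R N.
have coerU k : ae_in Om (fun x => alpha * enorm (G k x) `^ gamma <= g k x).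
  by apply: (@filterS _ _ F _ _ _ coer) => x cx Omx; exact: cx.
have sG k : mu.-integrable Om (EFin \o (fun x => sqn (G k x))) /\
    \int[mu]_(x in Om) sqn (G k x) <= (2 / alpha) `^ (2 / gamma) * (fine (mu Om) + L * C).
  have [_ _ pk _ [_ hk]] := n_P k.
  apply: (gradient_L2_bound mOm Omoo (mg k) _ a0 g0 pk (coerU k)).
    exact: (wG k).1.1.
  by apply: tail hk; rewrite invr_gt0.
pose B k := [set x | Om x /\ 1 + e k < `|g k x|].
have LC0 : 0 <= L * C.
  rewrite -lee_fin; have [_ _ _ _ [hk _]] := n_P 0%N.
  apply: le_trans (tail 0%N _ (th0 0%N) hk).
  by apply: integral_ge0 => x _; rewrite lee_fin tail_power_ge0.
have sB k : mu.-integrable Om (EFin \o (\1_(B k) : rV -> R)) /\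
    \int[mu]_(x in Om) `|\1_(B k) x : R| <= L * C / 2 ^+ k.
  have [_ _ _ pk [hk _]] := n_P k.
  have [iB hB] := tail_measure mOm Omoo (mg k) (p1 _) (th0 k) (ltW (e0 k)) (tail k _ (th0 k) hk).
  split; first exact: iB.
  apply: (le_trans hB); apply: ler_wpM2l => //.
  by rewrite lef_pV2 ?posrE ?exprn_gt0//; apply: lt_le_trans pk; rewrite exprn_gt0.
(* In the manner of Borel and Cantelli: almost every point lies in only finitely many [B k], since
   the indicators tend to 0 there. *)
have Bae := @fast_ae_cvg0 _ LT R mu Om (fun k => \1_(B k) : rV -> R) (L * C) mOm
  (fun k => (sB k).1) (fun k => (sB k).2).
have [||G0 wG0 G01] := limit_level oOm Omoo nf.2 lc a0 g0 coer Lu (fun k => LU (n_ k)) _ wG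
    (fun k => (sG k).1) (fun k => (sG k).2).
- move=> T LT'; apply: (cvg_comp n_ (fun k => T (u_ k))); last exact: wc T LT'.
  move=> P [m _ mP]; exists m => // k /= mk; apply: mP => /=.
  by have [kn _ _ _ _] := n_P k; exact: leq_trans mk kn.
- apply: (@filterS _ _ F _ _ _ Bae) => x hx Omx r r0.
  have /cvgrPdist_lt/(_ 1 ltr01) hB := hx Omx.
  have er : \forall k \near \oo, e k < r.
    by have /cvgrPdist_lt/(_ r r0) := @cvg_harmonic R; apply: filterS => k;
      rewrite sub0r normrN gtr0_norm.
  apply: filterS (filterI hB er) => k [Bk ek].
  have nB : ~ B k x.
    by move=> Bx; move: Bk; rewrite indicE mem_set// sub0r normrN normr1 ltxx.
  have : `|g k x| <= 1 + e k.
    by rewrite leNgt; apply/negP => ?; apply: nB; split.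
  move=> /(le_trans (ler_norm _)) /le_trans; apply.
  by rewrite lerD2l ltW.
have Wu : W11loc Om u by split; [exact: L1_L1loc|exists G0].
split; first exact: Wu.
have uG := weak_gradient_unique oOm wG0 (weak_gradient_gradient Wu).
apply: (@filterS _ _ F _ _ _ (@filterI _ _ F _ _ uG G01)) => x [ux gx] Omx.
by rewrite -(ux Omx); exact: gx.
Qed.

End gamma_convergence.

Theorem theorem4p4 (R : realType) (N d : nat) (Om : set 'rV[R]_N)
    (f : 'rV[R]_N -> 'rV[R]_d -> 'M[R]_(d, N) -> R)
    (alpha gamma L : R) (phi : nat -> 'rV[R]_N -> R -> \bar R) (p : nat -> R) :
  (2 <= N)%N -> (1 <= d)%N ->
  domain Om -> (lebesgue Om < +oo)%E ->
  normal_integrand Om f ->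
  ae_in Om (fun x => forall z, level_convex (f x z)) ->
  0 < alpha -> 0 < gamma ->
  ae_in Om (fun x => forall z xi, alpha * enorm xi `^ gamma <= f x z xi) ->
  1 <= L ->
  (forall n, weak_Phi Om (phi n)) ->
  (forall n, 1 <= p n) ->
  limn_esup (fun n => ess_sup_in Om (phi n ^~ 1)) = 0%E ->
  (1 <= limn_einf (fun n => ess_inf_in Om (phi n ^~ 1%R) `^ (p n)^-1%R))%E ->
  (forall n, aInc Om (phi n) (p n) L) ->
  p n @[n --> \oo] --> +oo ->
  forall (u : 'rV[R]_N -> 'rV[R]_d) (u_ : nat -> 'rV[R]_N -> 'rV[R]_d),
    L1 Om u -> (forall n, L1 Om (u_ n)) -> weakly_cvg_L1 Om u_ u ->
    (limn_esup (fun n => energy Om f (phi n) u) <= energy_infty Om f u)%E /\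
    (energy_infty Om f u <= limn_einf (fun n => energy Om f (phi n) (u_ n)))%E.
Proof.
move=> _ _ [oOm _] Omoo nf lc a0 g0 coer L1' wphi p1 sup0 inf1 inc poo u u_ Lu LU wc.
split; first exact: limsup_energy.
have mOm := open_lebesgue_measurable oOm.
set l := limn_einf _.
have l0 : (0 <= l)%E.
  apply: limn_einf_ge_near; apply: nearW => n; apply: energy_ge0.
  by have [] := wphi n.
have [->|] := eqVneq l +oo%E; first exact: leey.
rewrite -ltey => loo.
have lfin : l \is a fin_num by rewrite ge0_fin_numE.
(* Otherwise the energies would exceed [l + 1] from some index on, and so would their liminf [l]. *)
have freq m : exists2 n, (m <= n)%N &
    (energy Om f (phi n) (u_ n) <= (fine l + 1)%:E)%E.
  apply: contrapT => H.
  have : ((fine l + 1)%:E <= l)%E.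
    apply: limn_einf_ge_near; exists m => // n /= mn.
    by rewrite leNgt; apply/negP => /ltW En; apply: H; exists n.
  by rewrite -[X in (_ <= X)%E -> _](fineK lfin) lee_fin gerDl ler10.
have [Wu f1] := energy_bounded_level oOm Omoo nf lc a0 g0 coer L1' wphi p1 inf1
  inc poo Lu LU wc freq.
rewrite (energy_infty_eq0 Wu _ mOm nf)//.
have F := ae_lebesgue_filter R N.
apply: (@filterS _ _ F _ _ _ (@filterI _ _ F _ _ coer f1)) => x [cx fx] Omx.
(* Coercivity makes [f] nonnegative, so the upper bound on [f] bounds [|f|]. *)
rewrite ger0_norm; first exact: fx.
by apply: le_trans (cx Omx _ _); rewrite mulr_ge0 ?(ltW a0)// powR_ge0.
Qed.
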